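(* Let $f=\frac1m\sum_{i=1}^m f_i$, let Assumptions (A1)–(A5) of the context hold, and put $L_f=L_0+L_1\zeta$ and $\Delta_f=f(\bar{\mathbf x}^0)-\inf_{\mathbf x\in\mathbb R^d}f(\mathbf x)$. Run the algorithm DNSGD of the context with $$\eta=\min\Big\{\frac{\epsilon}{4L_f+1},\frac1{2L_1}\Big\},\qquad b\ge\max\Big\{\frac{256(4L_f+1)^2\sigma^2}{mL_f^2\epsilon^2},\frac{1024L_1^2\sigma^2}{mL_f^2}\Big\},$$ $$T\ge\max\Big\{\frac{8(4L_f+1)\Delta_\Phi}{\epsilon^2},\frac{16L_1\Delta_\Phi}{\epsilon}\Big\},\qquad K=\mathcal O\Big(\frac{\log(\sqrt m(1+\eta))}{\sqrt\gamma}\Big),$$ where $\Delta_\Phi=f(\bar{\mathbf x}^0)-\inf_{\mathbf x\in\mathbb R^d}f(\mathbf x)+\frac{2\eta}{\sqrt m}\mathbb E[\|\mathbf V^0-\mathbf 1\bar{\mathbf v}^0\|]$, and further set the number of initial communication rounds as $\hat K=\tilde{\mathcal O}(1/\sqrt\gamma)$. Then $\Delta_\Phi=\Theta(\Delta_f)$, and the output of DNSGD guarantees $\mathbb E[\|\nabla f(\hat{\mathbf x}_i)\|]\le\epsilon$ for each agent $i\in\{1,\dots,m\}$, where $\hat{\mathbf x}_i$ is uniformly sampled from $\{\mathbf x_i^0,\dots,\mathbf x_i^{T-1}\}$ generated by the $i$th agent. Additionally, each agent requires the sample complexity of $$Tb=\mathcal O\Big(\frac1m\Big(\frac{L_f\sigma^2\Delta_f}{\epsilon^4}+\frac{\sigma^2}{\epsilon^2}+\frac{L_1^3\sigma^2\Delta_f}{L_f^2\epsilon}+\frac{L_1^2\sigma^2}{L_f^2}\Big)\Big),$$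 and the algorithm requires the communication complexity of $$TK+\hat K=\tilde{\mathcal O}\Big(\frac{L_f\Delta_f}{\sqrt\gamma\,\epsilon^2}+\frac{L_1\Delta_f}{\sqrt\gamma\,\epsilon}\Big),$$ where $\tilde{\mathcal O}(\cdot)$ hides logarithmic factors.
   Context: Notation. $\|\cdot\|$ is the Euclidean norm of vectors and the Frobenius norm of matrices; $\mathbf 1=[1,\dots,1]^\top\in\mathbb R^m$. A matrix such as $\mathbf X\in\mathbb R^{m\times d}$ has rows $\mathbf x_1,\dots,\mathbf x_m$ (row $i$ is the local variable of agent $i$), and $\bar{\mathbf x}=\frac1m\mathbf 1^\top\mathbf X\in\mathbb R^{1\times d}$ is the mean of its rows (likewise $\bar{\mathbf v}$ for $\mathbf V$). Row and column vectors are identified as function inputs. $1/L_1:=+\infty$ if $L_1=0$. $\epsilon>0$ is the target accuracy. Assumptions. There are $m$ agents with differentiable, possibly nonconvex functions $f_i:\mathbb R^d\to\mathbb R$, $f_i(\mathbf x)=\mathbb E[F_i(\mathbf x;\boldsymbol\xi_i)]$, $\boldsymbol\xi_i\sim\mathcal D_i$, and $f=\frac1m\sum_{i=1}^m f_i$. (A1) $\inf_{\mathbf x\in\mathbb R^d}f(\mathbf x)>-\infty$. (A2) Each $f_i$ is $(L_0,L_1)$-smooth with $L_0,L_1\ge0$: $\|\nabla f_i(\mathbf x)-\nabla f_i(\mathbf y)\|\le(L_0+L_1\|\nabla f_i(\mathbf x)\|)\|\mathbf x-\mathbf y\|$ for all $\mathbf x,\mathbf y\in\mathbb R^d$ with $\|\mathbf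 x-\mathbf y\|\le1/L_1$. (A3) There is $\zeta\ge0$ with $\|\nabla f_i(\mathbf x)-\nabla f(\mathbf x)\|\le\zeta$ for all $i$ and all $\mathbf x\in\mathbb R^d$. (A4) There is $\sigma>0$ such that for all $i$ and $\mathbf x$, agent $i$ can draw $\boldsymbol\xi_i\sim\mathcal D_i$ and access $\nabla F_i(\mathbf x;\boldsymbol\xi_i)$ with $\mathbb E[\nabla F_i(\mathbf x;\boldsymbol\xi_i)]=\nabla f_i(\mathbf x)$ and $\mathbb E[\|\nabla F_i(\mathbf x;\boldsymbol\xi_i)-\nabla f_i(\mathbf x)\|^2]\le\sigma^2$. (A5) $\mathbf W\in\mathbb R^{m\times m}$ is the mixing matrix of a connected undirected network on the $m$ agents: $\mathbf W$ is symmetric with $w_{i,j}\ge0$, and $w_{i,j}\ne0$ iff agents $i,j$ are connected or $i=j$; $\mathbf 0\preceq\mathbf W\preceq\mathbf I$, $\mathbf W\mathbf 1=\mathbf W^\top\mathbf 1=\mathbf 1$, $\operatorname{null}(\mathbf I-\mathbf W)=\operatorname{span}(\mathbf 1)$. $\lambda_2(\mathbf W)\in[0,1)$ is the second largest eigenvalue of $\mathbf W$, and $\gamma=1-\lambda_2(\mathbf W)$ is the spectral gap. Subroutine AccGossip$(\mathbf Y^{(0)},\mathbf W,K)$: set $\mathbf Y^{(-1)}=\mathbf Y^{(0)}$, $\eta_y=\frac{1-\sqrt{1-\lambda_2(\mathbf W)^2}}{1+\sqrt{1-\lambda_2(\mathbf W)^2}}$, iterate $\mathbf Y^{(k+1)}=(1+\eta_y)\mathbf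 W\mathbf Y^{(k)}-\eta_y\mathbf Y^{(k-1)}$ for $k=0,1,\dots,K$, and output $\mathbf Y^{(K)}$. Algorithm DNSGD with inputs $\bar{\mathbf x}^0\in\mathbb R^{1\times d}$, $\mathbf W$, $\eta>0$, $\hat K,K,T,b\in\mathbb N$. Set $\mathbf X^0=\mathbf 1\bar{\mathbf x}^0$. For every $t\ge0$, each agent $i$ draws i.i.d. samples $\boldsymbol\xi_{i,k}^t\sim\mathcal D_i$, $k=1,\dots,b$ (fresh at every $t$, and independent across agents), and $\mathbf G^t$ is the matrix whose $i$th row is $\frac1b\sum_{k=1}^b\nabla F_i(\mathbf x_i^t;\boldsymbol\xi_{i,k}^t)$. Set $\mathbf V^0=\mathrm{AccGossip}(\mathbf G^0,\mathbf W,\hat K)$. For $t=0,\dots,T-1$: let $\mathbf U^t$ be the matrix with $i$th row $\mathbf v_i^t/\|\mathbf v_i^t\|$; $\mathbf X^{t+1}=\mathrm{AccGossip}(\mathbf X^t-\eta\mathbf U^t,\mathbf W,K)$; $\mathbf V^{t+1}=\mathrm{AccGossip}(\mathbf V^t+\mathbf G^{t+1}-\mathbf G^t,\mathbf W,K)$. Each agent $i$ outputs $\hat{\mathbf x}_i$ drawn uniformly from $\{\mathbf x_i^0,\dots,\mathbf x_i^{T-1}\}$.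
   Formalization: L_f>0 and T≥1 are assumed; Δ_Φ=Θ(Δ_f) and both complexities need Δ_f>0. The complexities hold for T, b, K, K̂ within a constant factor of their prescribed orders, with constants depending on that factor and a positive lower bound on L_f (absolute constants fail as L_f→0). *)

(* Defs.v *)
From HB Require Import structures.
From mathcomp Require Import all_boot all_order all_algebra.
From mathcomp Require Import all_classical all_reals all_analysis.

Set Implicit Arguments.
Unset Strict Implicit.
Unset Printing Implicit Defensive.

Import Order.TTheory GRing.Theory Num.Theory.
Import numFieldNormedType.Exports.

Local Open Scope classical_set_scope.
Local Open Scope ring_scope.

(** * Vectors, matrices, gradients *)

(* The library norm `|A| on matrices is the sup norm; this is the Frobenius
   norm, hence the Euclidean norm on row vectors. *)
Definition fnorm (R : realType) (p q : nat) (A : 'M[R]_(p, q)) : R :=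
  Num.sqrt (\sum_i \sum_j A i j ^+ 2).

Definition ones (R : realType) (m : nat) : 'cV[R]_m := const_mx 1.

Definition rowmean (R : realType) (m d : nat) (X : 'M[R]_(m, d)) : 'rV[R]_d :=
  m%:R^-1 *: ((ones R m)^T *m X).

(* Frobenius distance of X to the matrix all of whose rows are the row mean. *)
Definition consensus_error (R : realType) (m d : nat) (X : 'M[R]_(m, d)) : R :=
  fnorm (X - ones R m *m rowmean X).

Definition grad (R : realType) (d : nat) (g : 'rV[R]_d -> R) (x : 'rV[R]_d) :
    'rV[R]_d :=
  \row_j 'D_(delta_mx 0 j) g x.

Definition average (R : realType) (m d : nat) (f : 'I_m -> 'rV[R]_d -> R) :
    'rV[R]_d -> R :=
  fun x => m%:R^-1 * \sum_i f i x.

Definition infval (R : realType) (d : nat) (g : 'rV[R]_d -> R) : R :=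
  inf (range g).

(** * Assumptions on the objective *)

(* The radius 1/L1 is read as +oo when L1 = 0. *)
Definition L0L1_smooth (R : realType) (d : nat) (L0 L1 : R)
    (g : 'rV[R]_d -> R) : Prop :=
  forall x y : 'rV[R]_d, (0 < L1 -> fnorm (x - y) <= L1^-1) ->
    fnorm (grad g x - grad g y) <= (L0 + L1 * fnorm (grad g x)) * fnorm (x - y).

Definition bounded_heterogeneity (R : realType) (m d : nat) (zeta : R)
    (f : 'I_m -> 'rV[R]_d -> R) : Prop :=
  forall i x, fnorm (grad (f i) x - grad (average f) x) <= zeta.

(* The stochastic gradient of agent i at x for the sample s. *)
Definition sgrad (R : realType) (d : nat) (Xi : Type)
    (F : 'rV[R]_d -> Xi -> R) (x : 'rV[R]_d) (s : Xi) : 'rV[R]_d :=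
  grad (F ^~ s) x.

(* g is the expectation of F( . ; s) for s drawn from D. *)
Definition expected_loss (R : realType) (d : nat) (dX : measure_display)
    (Xi : measurableType dX) (D : probability Xi R)
    (F : 'rV[R]_d -> Xi -> R) (g : 'rV[R]_d -> R) : Prop :=
  forall x, D.-integrable setT (fun s => (F x s)%:E) /\
            (g x)%:E = ('E_D[F x])%E.

(* Joint measurability is what makes the iterates random variables.  The vector
   argument is read off a tuple because the product sigma-algebra on tuples,
   i.e. the Borel sets of R^d, is the one provided by the library. *)
Definition stochastic_oracle (R : realType) (d : nat) (dX : measure_display)
    (Xi : measurableType dX) (D : probability Xi R) (sigma : R)
    (F : 'rV[R]_d -> Xi -> R) (g : 'rV[R]_d -> R) : Prop :=
  [/\ forall j, measurable_fun setT
        (fun z : d.-tuple R * Xi => sgrad F (\row_k tnth z.1 k) z.2 0 j),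
      forall x, {ae D, forall s, differentiable (F ^~ s) x},
      forall x j, D.-integrable setT (fun s => (sgrad F x s 0 j)%:E) /\
                  ('E_D[fun s => (sgrad F x s 0 j)%R] = (grad g x 0 j)%R%:E)%E &
      forall x, ('E_D[fun s => (fnorm (sgrad F x s - grad g x) ^+ 2)%R]
                 <= (sigma ^+ 2)%:E)%E].

(** * Mixing matrix *)

Definition psdmx (R : realType) (m : nat) (A : 'M[R]_m) : Prop :=
  forall v : 'cV[R]_m, 0 <= (v^T *m A *m v) 0 0.

Definition mixing_matrix (R : realType) (m : nat) (W : 'M[R]_m) : Prop :=
  exists e : rel 'I_m,
    [/\ symmetric e /\ (forall i j, connect e i j),
        W^T = W /\ (forall i j, 0 <= W i j),
        forall i j, (W i j != 0) = e i j || (i == j),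
        psdmx W /\ psdmx (1%:M - W) &
        (W *m ones R m = ones R m /\ W^T *m ones R m = ones R m) /\
        (forall v : 'cV[R]_m,
           (1%:M - W) *m v = 0 <-> exists a : R, v = a *: ones R m)].

Definition decreasing_spectrum (R : realType) (m : nat) (W : 'M[R]_m)
    (s : seq R) : Prop :=
  sorted >=%R s /\ char_poly W = \prod_(a <- s) ('X - a%:P).

(* Second largest eigenvalue, counted with multiplicity.  The characteristic
   polynomial of a symmetric matrix splits, so the spectrum exists and is
   unique.  For m = 1 there is no second eigenvalue and the value is 0. *)
Definition lambda2 (R : realType) (m : nat) (W : 'M[R]_m) : R :=
  (xget [::] (decreasing_spectrum W : set (seq R)))`_1.

Definition spectral_gap (R : realType) (m : nat) (W : 'M[R]_m) : R :=
  1 - lambda2 W.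

(** * Algorithms *)

Definition gossip_eta (R : realType) (m : nat) (W : 'M[R]_m) : R :=
  (1 - Num.sqrt (1 - lambda2 W ^+ 2)) / (1 + Num.sqrt (1 - lambda2 W ^+ 2)).

(* The iterated pair is (Y^(k), Y^(k-1)). *)
Definition AccGossip (R : realType) (m d : nat) (Y0 : 'M[R]_(m, d))
    (W : 'M[R]_m) (K : nat) : 'M[R]_(m, d) :=
  (iter K (fun Y : 'M[R]_(m, d) * 'M[R]_(m, d) =>
     ((1 + gossip_eta W) *: (W *m Y.1) - gossip_eta W *: Y.2, Y.1))
     (Y0, Y0)).1.

(* A zero row is left equal to zero, since 0^-1 = 0. *)
Definition normalize_rows (R : realType) (m d : nat) (V : 'M[R]_(m, d)) :
    'M[R]_(m, d) :=
  \matrix_(i < m) ((fnorm (row i V))^-1 *: row i V).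

Definition minibatch_grad (R : realType) (m d b : nat) (Xi : 'I_m -> Type)
    (F : forall i, 'rV[R]_d -> Xi i -> R) (X : 'M[R]_(m, d))
    (s : forall i : 'I_m, 'I_b -> Xi i) : 'M[R]_(m, d) :=
  \matrix_(i < m) (b%:R^-1 *: \sum_(k < b) sgrad (F i) (row i X) (s i k)).

(* The pair (X^t, V^t), for a given realization s of all the samples. *)
Fixpoint dnsgd (R : realType) (m d b : nat) (Xi : 'I_m -> Type)
    (F : forall i, 'rV[R]_d -> Xi i -> R) (W : 'M[R]_m) (x0 : 'rV[R]_d)
    (eta : R) (Khat K : nat) (s : nat -> forall i : 'I_m, 'I_b -> Xi i)
    (t : nat) {struct t} : 'M[R]_(m, d) * 'M[R]_(m, d) :=
  match t with
  | 0 =>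
      let X0 := ones R m *m x0 in
      (X0, AccGossip (minibatch_grad F X0 (s 0%N)) W Khat)
  | t'.+1 =>
      let X := (dnsgd F W x0 eta Khat K s t').1 in
      let V := (dnsgd F W x0 eta Khat K s t').2 in
      let X' := AccGossip (X - eta *: normalize_rows V) W K in
      (X', AccGossip (V + minibatch_grad F X' (s t'.+1)
                        - minibatch_grad F X (s t')) W K)
  end.

(** * Sampling *)

Definition mutually_independent (R : realType) (dO : measure_display)
    (Omega : measurableType dO) (P : probability Omega R) (I : choiceType)
    (dT : I -> measure_display) (T : forall p : I, measurableType (dT p))
    (Z : forall p : I, Omega -> T p) : Prop :=
  forall (J : seq I) (A : forall p : I, set (T p)),
    uniq J -> (forall p, measurable (A p)) ->
    P (\bigcap_(p in [set` J]) (Z p @^-1` A p)) =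
      (\prod_(p <- J) P (Z p @^-1` A p))%E.

(* N is independent of the sigma-algebra generated by the whole family Z. *)
Definition independent_of_family (R : realType) (dO : measure_display)
    (Omega : measurableType dO) (P : probability Omega R) (I : choiceType)
    (dT : I -> measure_display) (T : forall p : I, measurableType (dT p))
    (Z : forall p : I, Omega -> T p) (N : Omega -> nat) : Prop :=
  forall (n : nat) (J : seq I) (A : forall p : I, set (T p)),
    uniq J -> (forall p, measurable (A p)) ->
    P (N @^-1` [set n] `&` \bigcap_(p in [set` J]) (Z p @^-1` A p)) =
      (P (N @^-1` [set n]) * P (\bigcap_(p in [set` J]) (Z p @^-1` A p)))%E.

(* xi t i k is the k-th sample of agent i at round t; tau i is the index drawn
   by agent i for its output. *)
Definition dnsgd_sampling (R : realType) (m b T : nat)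
    (dX : 'I_m -> measure_display) (Xi : forall i, measurableType (dX i))
    (D : forall i, probability (Xi i) R)
    (dO : measure_display) (Omega : measurableType dO) (P : probability Omega R)
    (xi : nat -> forall i : 'I_m, 'I_b -> {RV P >-> Xi i})
    (tau : 'I_m -> {RV P >-> nat}) : Prop :=
  let xi' := fun p : nat * 'I_m * 'I_b =>
    (xi p.1.1 p.1.2 p.2 : Omega -> Xi p.1.2) in
  [/\ forall t i k (A : set (Xi i)), measurable A ->
        P (xi t i k @^-1` A) = D i A,
      mutually_independent P xi',
      forall i t, (t < T)%N -> P (tau i @^-1` [set t]) = (T%:R^-1)%:E &
      forall i, independent_of_family P xi' (tau i)].

(** * Parameters *)

(* 1/(2 L1) is read as +oo when L1 = 0. *)
Definition step_size (R : realType) (Lf L1 eps : R) : R :=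
  if L1 == 0 then eps / (4 * Lf + 1)
  else Num.min (eps / (4 * Lf + 1)) (1 / (2 * L1)).

Definition batch_bound (R : realType) (m : nat) (Lf L1 sigma eps : R) : R :=
  Num.max
    (256 * (4 * Lf + 1) ^+ 2 * sigma ^+ 2 / (m%:R * Lf ^+ 2 * eps ^+ 2))
    (1024 * L1 ^+ 2 * sigma ^+ 2 / (m%:R * Lf ^+ 2)).

Definition horizon_bound (R : realType) (Lf L1 eps : R) (DeltaPhi : \bar R) :
    \bar R :=
  maxe ((8 * (4 * Lf + 1) / eps ^+ 2)%:E * DeltaPhi)%E
       ((16 * L1 / eps)%:E * DeltaPhi)%E.

(* K is compared with gossip_log / sqrt gamma. *)
Definition gossip_log (R : realType) (m : nat) (eta : R) : R :=
  ln (Num.sqrt m%:R * (1 + eta)).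

(* The logarithm hidden in the order of magnitude of the number of initial
   communication rounds, which is compared with init_log / sqrt gamma. *)
Definition init_log (R : realType) (eta zeta sigma Deltaf : R) : R :=
  ln (2 + eta * (zeta + sigma) / Deltaf).

(* Main.v *)
Require Import Defs.
From HB Require Import structures.
From mathcomp Require Import all_boot all_order all_algebra.
From mathcomp Require Import all_classical all_reals all_analysis.
From mathcomp Require Import complex measurable_realfun ring lra.

(** Why DNSGD converges.

    Gossip.  In an orthonormal eigenbasis of [W] accelerated gossip becomes a
    family of scalar heavy-ball recursions, one per eigenvalue.  The momentum
    is critical for [lambda2], so that off the constants every coordinate is
    at most [2 exp (- K sqrt gamma / 4)] times the initial one
    ([AccGossip_contracts]).  The prescribed [K] makes the contraction factor
    [rho] satisfy [rho sqrt m <= 1 / 512] ([gossip_rounds]).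

    Sure analysis.  Normalized directions have norm at most 1, so for every
    outcome of the samples the iterates stay within [eta / 256] of their mean.
    At the mean iterate [x] the objective has gradient modulus
    [Lf + L1 |grad f x|], which gives a descent inequality; a step along the
    normalized tracker [v] instead of the gradient loses twice the error of
    [v].  That error is the consensus error of [V], divided by 512 at each
    round up to the increments of the gradients, plus the noise of the mean
    minibatch gradient.  Adding a small multiple of the consensus error to the
    objective makes the inequalities telescope: the sum of the gradient norms
    along the trajectory is bounded by [Deltaf / eta], the initial consensus
    error and the noises ([trajectory_bound]).  This is a deterministic
    statement.

    Expectations.  The iterate of round [t] is a function of the samples of
    the earlier rounds, hence independent of a sample of round [t]; freezing
    the past by Fubini shows that the noise of a fresh sample is orthogonal to
    everything computed from the other samples ([fresh_noise_orthogonal]).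
    The noises of one round are therefore pairwise orthogonal, their variances
    add up ([second_moment_sum]), and the mean gradient noise is at most
    [sigma / sqrt (m b) <= eps / 64].  Since the output index is uniform and
    independent of the samples, the expected gradient norm at the output is
    the average of the expected norms over the rounds ([mean_output]); the
    choice of [eta], [b] and [T] makes it at most [eps]
    ([dnsgd_convergence]).

    Complexity.  The initial gossip rounds bring the initial consensus error
    below a multiple of [Deltaf / eta], so that [DeltaPhi] lies between
    [Deltaf] and [5 Deltaf] ([potential_le]).  With [T], [b], [K]
    and [Khat] within a constant factor of their prescribed orders, the two
    complexities are arithmetic consequences, using
    [4 Lf + 1 <= (4 + 1 / ell) Lf] ([sample_complexity],
    [communication_complexity]). *)

Set Implicit Arguments.
Unset Strict Implicit.
Unset Printing Implicit Defensive.

Import Order.TTheory GRing.Theory Num.Theory.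
Import numFieldNormedType.Exports.

Local Open Scope classical_set_scope.
Local Open Scope ring_scope.

(** * Frobenius norm and row means *)

Section FrobeniusNorm.
Variable R : realType.

Definition fdot p q (A B : 'M[R]_(p, q)) : R := \sum_i \sum_j A i j * B i j.

Lemma fdotC p q (A B : 'M[R]_(p, q)) : fdot A B = fdot B A.
Proof. by apply: eq_bigr => i _; apply: eq_bigr => j _; rewrite mulrC. Qed.

Lemma fdotDl p q (A B C : 'M[R]_(p, q)) : fdot (A + B) C = fdot A C + fdot B C.
Proof.
rewrite -big_split; apply: eq_bigr => i _; rewrite -big_split.
by apply: eq_bigr => j _; rewrite mxE mulrDl.
Qed.

Lemma fdotZl p q a (A B : 'M[R]_(p, q)) : fdot (a *: A) B = a * fdot A B.
Proof.
rewrite mulr_sumr; apply: eq_bigr => i _; rewrite mulr_sumr.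
by apply: eq_bigr => j _; rewrite mxE mulrA.
Qed.

Lemma fdotNl p q (A B : 'M[R]_(p, q)) : fdot (- A) B = - fdot A B.
Proof. by rewrite -scaleN1r fdotZl mulN1r. Qed.

Lemma fdotDr p q (A B C : 'M[R]_(p, q)) : fdot C (A + B) = fdot C A + fdot C B.
Proof. by rewrite fdotC fdotDl !(fdotC C). Qed.

Lemma fdotZr p q a (A B : 'M[R]_(p, q)) : fdot A (a *: B) = a * fdot A B.
Proof. by rewrite fdotC fdotZl fdotC. Qed.

Lemma fdotNr p q (A B : 'M[R]_(p, q)) : fdot A (- B) = - fdot A B.
Proof. by rewrite fdotC fdotNl fdotC. Qed.

Lemma fdot0l p q (A : 'M[R]_(p, q)) : fdot 0 A = 0.
Proof. by have := fdotZl 0 (0 : 'M[R]_(p, q)) A; rewrite scale0r mul0r. Qed.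

Lemma fdot0r p q (A : 'M[R]_(p, q)) : fdot A 0 = 0.
Proof. by rewrite fdotC fdot0l. Qed.

Lemma fdot_suml p q (I : Type) (r : seq I) (Q : pred I) (A : I -> 'M[R]_(p, q)) B :
  fdot (\sum_(k <- r | Q k) A k) B = \sum_(k <- r | Q k) fdot (A k) B.
Proof.
by elim/big_rec2: _ => [|k x y _ <-]; rewrite ?fdot0l ?fdotDl.
Qed.

Lemma fdot_sumr p q (I : Type) (r : seq I) (Q : pred I) (A : I -> 'M[R]_(p, q)) B :
  fdot B (\sum_(k <- r | Q k) A k) = \sum_(k <- r | Q k) fdot B (A k).
Proof. by rewrite fdotC fdot_suml; apply: eq_bigr => k _; rewrite fdotC. Qed.

Lemma fdot_ge0 p q (A : 'M[R]_(p, q)) : 0 <= fdot A A.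
Proof. by do 2!apply: sumr_ge0 => ? _; rewrite -expr2 sqr_ge0. Qed.

Lemma fnormE p q (A : 'M[R]_(p, q)) : fnorm A = Num.sqrt (fdot A A).
Proof.
by congr Num.sqrt; apply: eq_bigr => i _; apply: eq_bigr => j _; rewrite expr2.
Qed.

Lemma fnorm_sqr p q (A : 'M[R]_(p, q)) : fnorm A ^+ 2 = fdot A A.
Proof. by rewrite fnormE sqr_sqrtr ?fdot_ge0. Qed.

Lemma fnorm_ge0 p q (A : 'M[R]_(p, q)) : 0 <= fnorm A.
Proof. exact: sqrtr_ge0. Qed.

Lemma fnorm0 p q : fnorm (0 : 'M[R]_(p, q)) = 0.
Proof. by rewrite fnormE fdot0l sqrtr0. Qed.

Lemma fnormZ p q a (A : 'M[R]_(p, q)) : fnorm (a *: A) = `|a| * fnorm A.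
Proof. by rewrite !fnormE fdotZl fdotZr mulrA -expr2 sqrtrM ?sqr_ge0 ?sqrtr_sqr. Qed.

Lemma fnormN p q (A : 'M[R]_(p, q)) : fnorm (- A) = fnorm A.
Proof. by rewrite -scaleN1r fnormZ normrN1 mul1r. Qed.

Lemma fnormB p q (A B : 'M[R]_(p, q)) : fnorm (A - B) = fnorm (B - A).
Proof. by rewrite -fnormN opprB. Qed.

Lemma fnorm_eq0 p q (A : 'M[R]_(p, q)) : fnorm A = 0 -> A = 0.
Proof.
move=> A0; have : fdot A A = 0 by rewrite -fnorm_sqr A0 expr0n.
move/eqP; rewrite psumr_eq0; last by move=> i _; apply: sumr_ge0 => j _; rewrite -expr2 sqr_ge0.
move=> /allP H; apply/matrixP => i j; rewrite mxE.
have := H i (mem_index_enum _); rewrite psumr_eq0 /=; last by move=> k _; rewrite -expr2 sqr_ge0.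
by move=> /allP /(_ j (mem_index_enum _)) /=; rewrite mulf_eq0 orbb => /eqP.
Qed.

(** Cauchy-Schwarz, from [0 <= |b A - a B|^2] with [a = |A|] and [b = |B|]. *)
Lemma fdot_le p q (A B : 'M[R]_(p, q)) : fdot A B <= fnorm A * fnorm B.
Proof.
have [->|/eqP A0] := pselect (A = 0); first by rewrite fdot0l fnorm0 mul0r.
have [->|/eqP B0] := pselect (B = 0); first by rewrite fdot0r fnorm0 mulr0.
have a0 : 0 < fnorm A by rewrite lt_def fnorm_ge0 andbT; apply: contra_neq A0; exact: fnorm_eq0.
have b0 : 0 < fnorm B by rewrite lt_def fnorm_ge0 andbT; apply: contra_neq B0; exact: fnorm_eq0.
have := fdot_ge0 (fnorm B *: A - fnorm A *: B).
rewrite fdotDl !fdotDr !fdotNl !fdotNr !fdotZl !fdotZr -!fnorm_sqr (fdotC B A).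
move: (fnorm A) (fnorm B) (fdot A B) a0 b0 => a b x a0 b0 H.
have ab : 0 < a * b by rewrite mulr_gt0.
by rewrite -(ler_pM2l ab); lra.
Qed.

Lemma fnormD p q (A B : 'M[R]_(p, q)) : fnorm (A + B) <= fnorm A + fnorm B.
Proof.
rewrite -(@ler_pXn2r _ 2) ?nnegrE ?addr_ge0 ?fnorm_ge0//.
rewrite fnorm_sqr fdotDl !fdotDr (fdotC B) -!fnorm_sqr sqrrD.
by have := fdot_le A B; lra.
Qed.

Lemma fnormDB p q (A B C : 'M[R]_(p, q)) : fnorm (A - C) <= fnorm (A - B) + fnorm (B - C).
Proof. by have := fnormD (A - B) (B - C); rewrite addrA subrK. Qed.

Lemma fnorm_sum p q (I : Type) (r : seq I) (Q : pred I) (A : I -> 'M[R]_(p, q)) :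
  fnorm (\sum_(k <- r | Q k) A k) <= \sum_(k <- r | Q k) fnorm (A k).
Proof.
elim/big_rec2: _ => [|k x y _ h]; first by rewrite fnorm0.
by apply: le_trans (fnormD _ _) _; rewrite lerD2l.
Qed.

Lemma fdot_rows p q (A B : 'M[R]_(p, q)) :
  fdot A B = \sum_i fdot (row i A) (row i B).
Proof.
apply: eq_bigr => i _; rewrite /fdot big_ord1.
by apply: eq_bigr => j _; rewrite !mxE.
Qed.

Lemma fnorm_sqr_rows p q (A : 'M[R]_(p, q)) :
  fnorm A ^+ 2 = \sum_i fnorm (row i A) ^+ 2.
Proof. by rewrite fnorm_sqr fdot_rows; apply: eq_bigr => i _; rewrite fnorm_sqr. Qed.

Lemma fnorm_sqr_rV d (v : 'rV[R]_d) : fnorm v ^+ 2 = \sum_j v 0 j ^+ 2.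
Proof. by rewrite fnorm_sqr /fdot big_ord1; apply: eq_bigr => j _; rewrite expr2. Qed.

Lemma fnorm_row_le p q (A : 'M[R]_(p, q)) i : fnorm (row i A) <= fnorm A.
Proof.
rewrite -(@ler_pXn2r _ 2) ?nnegrE ?fnorm_ge0//.
rewrite (fnorm_sqr_rows A) (bigD1 i)//= lerDl.
by apply: sumr_ge0 => j _; rewrite sqr_ge0.
Qed.

Lemma fnorm_le_rows p q (A : 'M[R]_(p, q)) c : 0 <= c ->
  (forall i, fnorm (row i A) <= c) -> fnorm A <= Num.sqrt p%:R * c.
Proof.
move=> c0 H; rewrite -(@ler_pXn2r _ 2) ?nnegrE ?mulr_ge0 ?sqrtr_ge0 ?fnorm_ge0//.
rewrite exprMn (sqr_sqrtr (ler0n R p)) fnorm_sqr_rows.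
apply: (@le_trans _ _ (\sum_(i < p) c ^+ 2)).
  by apply: ler_sum => i _; rewrite ler_pXn2r ?nnegrE ?fnorm_ge0.
by rewrite sumr_const card_ord -[X in X <= _]mulr_natl.
Qed.

(** Cauchy-Schwarz against the all-ones vector. *)
Lemma sum_fnorm_rows p q (A : 'M[R]_(p, q)) :
  \sum_i fnorm (row i A) <= Num.sqrt p%:R * fnorm A.
Proof.
pose u : 'rV[R]_p := \row_i fnorm (row i A).
have := fdot_le (const_mx 1 : 'rV_p) u.
have -> : fdot (const_mx 1) u = \sum_i fnorm (row i A).
  by rewrite /fdot big_ord1; apply: eq_bigr => i _; rewrite !mxE mul1r.
have -> : fnorm (const_mx 1 : 'rV[R]_p) = Num.sqrt p%:R.
  rewrite /fnorm big_ord1; congr Num.sqrt.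
  under eq_bigr do rewrite mxE expr1n.
  by rewrite sumr_const card_ord.
suff -> : fnorm u = fnorm A by [].
rewrite [LHS]/fnorm big_ord1 -[RHS]ger0_norm ?fnorm_ge0// -sqrtr_sqr fnorm_sqr_rows.
by congr Num.sqrt; apply: eq_bigr => i _; rewrite mxE.
Qed.

End FrobeniusNorm.

Section RowMean.
Variables (R : realType) (m d : nat).
Hypothesis m0 : (0 < m)%N.
Implicit Types X Y : 'M[R]_(m, d).

Let mN0 : (m%:R : R) != 0.
Proof. by rewrite pnatr_eq0 -lt0n. Qed.

Lemma rowmeanE X : rowmean X = m%:R^-1 *: \sum_i row i X.
Proof.
congr (_ *: _); apply/rowP => j; rewrite !mxE summxE.
by apply: eq_bigr => i _; rewrite !mxE mul1r.
Qed.

Lemma row_ones (x : 'rV[R]_d) i : row i (ones R m *m x) = x.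
Proof. by apply/rowP => j; rewrite !mxE big_ord1 !mxE mul1r. Qed.

Lemma ones_ones : (ones R m)^T *m ones R m = m%:R%:M.
Proof.
apply/matrixP => i j; rewrite !ord1 !mxE.
under eq_bigr do rewrite !mxE mulr1.
by rewrite sumr_const card_ord.
Qed.

Lemma rowmean_ones (x : 'rV[R]_d) : rowmean (ones R m *m x) = x.
Proof. by rewrite /rowmean mulmxA ones_ones mul_scalar_mx scalerA mulVf ?scale1r. Qed.

Lemma rowmeanD X Y : rowmean (X + Y) = rowmean X + rowmean Y.
Proof. by rewrite /rowmean mulmxDr scalerDr. Qed.

Lemma rowmeanZ a X : rowmean (a *: X) = a *: rowmean X.
Proof. by rewrite /rowmean -scalemxAr !scalerA mulrC. Qed.

Lemma rowmeanN X : rowmean (- X) = - rowmean X.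
Proof. by rewrite -scaleN1r rowmeanZ scaleN1r. Qed.

Lemma consensus_ge0 X : 0 <= consensus_error X.
Proof. exact: fnorm_ge0. Qed.

Lemma consensusD X Y :
  consensus_error (X + Y) <= consensus_error X + consensus_error Y.
Proof.
rewrite /consensus_error rowmeanD mulmxDr opprD addrACA; exact: fnormD.
Qed.

Lemma consensusZ a X : consensus_error (a *: X) = `|a| * consensus_error X.
Proof. by rewrite /consensus_error rowmeanZ -scalemxAr -scalerBr fnormZ. Qed.

Lemma consensusN X : consensus_error (- X) = consensus_error X.
Proof. by rewrite -scaleN1r consensusZ normrN1 mul1r. Qed.

Lemma consensus_ones (x : 'rV[R]_d) : consensus_error (ones R m *m x) = 0.
Proof. by rewrite /consensus_error rowmean_ones subrr fnorm0. Qed.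

(** Pythagoras: the deviation from the mean is orthogonal to the matrices with
    equal rows. *)
Lemma consensus_le_fnorm X : consensus_error X <= fnorm X.
Proof.
rewrite -(@ler_pXn2r _ 2) ?nnegrE ?fnorm_ge0// !fnorm_sqr.
set Z := ones R m *m rowmean X.
have ZE Y : fdot Z Y = m%:R * fdot (rowmean X) (rowmean Y).
  rewrite fdot_rows.
  under eq_bigr do rewrite row_ones.
  by rewrite -fdot_sumr (rowmeanE Y) fdotZr mulrA mulfV ?mul1r.
have H : fdot Z X = fdot Z Z by rewrite !ZE rowmean_ones.
rewrite fdotDl !fdotDr !fdotNl !fdotNr (fdotC X Z) H.
by have := fdot_ge0 Z; lra.
Qed.

Lemma consensus_le X (x : 'rV[R]_d) : consensus_error X <= fnorm (X - ones R m *m x).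
Proof.
apply: le_trans (consensus_le_fnorm _).
rewrite -[X in consensus_error X <= _](subrK (ones R m *m x)).
by apply: le_trans (consensusD _ _) _; rewrite consensus_ones addr0.
Qed.

Lemma row_consensus X i : fnorm (row i X - rowmean X) <= consensus_error X.
Proof.
have -> : row i X - rowmean X = row i (X - ones R m *m rowmean X).
  by rewrite linearB/= row_ones.
exact: fnorm_row_le.
Qed.

Lemma sum_row_consensus X :
  \sum_i fnorm (row i X - rowmean X) <= Num.sqrt m%:R * consensus_error X.
Proof.
apply: le_trans (sum_fnorm_rows _).
by apply: ler_sum => i _; rewrite linearB/= row_ones.
Qed.

Lemma fnorm_rowmean_le X c : (forall i, fnorm (row i X) <= c) -> fnorm (rowmean X) <= c.
Proof.
move=> H; rewrite rowmeanE fnormZ ger0_norm ?invr_ge0 ?ler0n//.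
rewrite -(@ler_pM2l _ m%:R) ?ltr0n// mulrA mulfV ?mul1r//.
apply: le_trans (fnorm_sum _ _ _) _.
apply: le_trans (ler_sum _ (fun i _ => H i)) _.
by rewrite sumr_const card_ord mulr_natl.
Qed.

End RowMean.

(** * Spectral theorem for real symmetric matrices *)

Section RealSpectral.
Variable R : realType.
Local Notation C := R[i].
Local Notation toC := (real_complex R).

Let Remx p q (M : 'M[C]_(p, q)) : 'M[R]_(p, q) := map_mx (@complex.Re R) M.
Let Immx p q (M : 'M[C]_(p, q)) : 'M[R]_(p, q) := map_mx (@complex.Im R) M.

Let Re_sum (I : finType) (F : I -> C) :
  complex.Re (\sum_i F i) = \sum_i complex.Re (F i).
Proof. by apply: (big_morph (@complex.Re R)) => // -[a b] [c e]. Qed.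

Let Im_sum (I : finType) (F : I -> C) :
  complex.Im (\sum_i F i) = \sum_i complex.Im (F i).
Proof. by apply: (big_morph (@complex.Im R)) => // -[a b] [c e]. Qed.

Let Remx_mul p q s (M : 'M[C]_(p, q)) (N : 'M[C]_(q, s)) :
  Remx (M *m N) = Remx M *m Remx N - Immx M *m Immx N.
Proof.
apply/matrixP => i j; rewrite !mxE Re_sum -sumrB.
by apply: eq_bigr => k _; rewrite !mxE; case: (M i k) (N k j) => [a b] [c e].
Qed.

Let Immx_mul p q s (M : 'M[C]_(p, q)) (N : 'M[C]_(q, s)) :
  Immx (M *m N) = Remx M *m Immx N + Immx M *m Remx N.
Proof.
apply/matrixP => i j; rewrite !mxE Im_sum -big_split.
by apply: eq_bigr => k _; rewrite !mxE; case: (M i k) (N k j) => [a b] [c e] /=.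
Qed.

Let Remx_toC p q (M : 'M[R]_(p, q)) : Remx (map_mx toC M) = M.
Proof. by apply/matrixP => i j; rewrite !mxE. Qed.

Let Immx_toC p q (M : 'M[R]_(p, q)) : Immx (map_mx toC M) = 0.
Proof. by apply/matrixP => i j; rewrite !mxE. Qed.

Let Remx_adj p q (M : 'M[C]_(p, q)) : Remx (map_mx Num.conj M^T) = (Remx M)^T.
Proof. by apply/matrixP => i j; rewrite !mxE; case: (M j i). Qed.

Let Immx_adj p q (M : 'M[C]_(p, q)) : Immx (map_mx Num.conj M^T) = - (Immx M)^T.
Proof. by apply/matrixP => i j; rewrite !mxE; case: (M j i). Qed.

(** A real symmetric matrix is Hermitian over [R[i]], hence diagonal with real
    eigenvalues in the basis given by a unitary [P = A + iB].  The identities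
    are the real and imaginary parts of [P W = D P] and of
    [P P^* = P^* P = 1].  The pair [(A, B)] does the work of a real orthogonal
    matrix: it defines an isometry, and its pairs of rows are eigenvectors. *)
Lemma real_symmetric_spectral (m : nat) (W : 'M[R]_m) : W^T = W ->
  exists (mu : 'rV[R]_m) (A B : 'M[R]_m),
  [/\ char_poly W = \prod_j ('X - (mu 0 j)%:P),
      A *m W = diag_mx mu *m A /\ B *m W = diag_mx mu *m B,
      A^T *m A + B^T *m B = 1%:M,
      A *m A^T + B *m B^T = 1%:M &
      B *m A^T = A *m B^T].
Proof.
move=> Wsym; pose WC := map_mx toC W.
have WCherm : WC \is hermsymmx.
  apply: realsym_hermsym.
    apply/is_hermitianmxP; rewrite expr0 scale1r.
    by apply/matrixP => i j; rewrite !mxE -[in LHS]Wsym mxE.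
  by apply/mxOverP => i j; rewrite mxE; apply/complex_realP; exists (W i j).
have Dreal := hermitian_spectral_diag_real WCherm.
have /orthomx_spectralP WCE := hermitian_normalmx WCherm.
set P := spectralmx WC in WCE; set D := spectral_diag WC in Dreal WCE.
have Pu : P \is unitarymx by exact: spectral_unitarymx.
have Punit := unitarymx_unit Pu.
have PW : P *m WC = diag_mx D *m P by rewrite [in LHS]WCE -mulmxA mulKVmx.
have PP1 : P *m map_mx Num.conj P^T = 1%:M by apply/unitarymxP.
have PP2 : map_mx Num.conj P^T *m P = 1%:M by rewrite -invmx_unitary// mulVmx.
have DE : D = map_mx toC (Remx D).
  apply/matrixP => i j; rewrite !mxE RRe_real//; exact: (mxOverP Dreal).
have DdE : diag_mx D = map_mx toC (diag_mx (Remx D)).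
  by rewrite {1}DE map_diag_mx.
exists (Remx D), (Remx P), (Immx P).
have [H1 H2] : Remx P *m W = diag_mx (Remx D) *m Remx P /\
               Immx P *m W = diag_mx (Remx D) *m Immx P.
  split.
    have := congr1 (@Remx _ _) PW.
    by rewrite DdE !Remx_mul !Remx_toC !Immx_toC mulmx0 mul0mx !subr0.
  have := congr1 (@Immx _ _) PW.
  by rewrite DdE !Immx_mul !Remx_toC !Immx_toC mulmx0 mul0mx add0r addr0.
have re1 : Remx (1%:M : 'M[C]_m) = 1%:M.
  by apply/matrixP => i j; rewrite !mxE; case: eqP.
have im1 : Immx (1%:M : 'M[C]_m) = 0.
  by apply/matrixP => i j; rewrite !mxE; case: eqP.
split => //.
- apply: (map_poly_inj toC); rewrite map_char_poly -/WC.
  have -> : char_poly WC = char_poly (diag_mx D).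
    rewrite /char_poly /char_poly_mx {1}WCE !map_mxM.
    set Q := map_mx polyC P; set Q' := map_mx polyC (invmx P).
    have QQ : Q' *m Q = 1%:M by rewrite -map_mxM mulVmx// map_mx1.
    have -> : 'X%:M - Q' *m map_mx polyC (diag_mx D) *m Q =
        Q' *m ('X%:M - map_mx polyC (diag_mx D)) *m Q.
      by rewrite mulmxBr mulmxBl mul_mx_scalar -scalemxAl QQ scalemx1.
    rewrite !det_mulmx mulrAC -det_mulmx QQ det1 mul1r //.
  rewrite char_poly_trig ?diag_mx_is_trig// rmorph_prod/=.
  apply: eq_bigr => j _; rewrite {1}DE !mxE eqxx mulr1n.
  by rewrite rmorphB /= map_polyX map_polyC.
- have := congr1 (@Remx _ _) PP2.
  by rewrite Remx_mul Remx_adj Immx_adj re1 mulNmx opprK.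
- have := congr1 (@Remx _ _) PP1.
  by rewrite Remx_mul Remx_adj Immx_adj re1 mulmxN opprK.
- have := congr1 (@Immx _ _) PP1.
  rewrite Immx_mul Remx_adj Immx_adj im1 mulmxN addrC => /eqP.
  by rewrite subr_eq0 => /eqP.
Qed.
End RealSpectral.

(** * Two-term recursions *)

Section HeavyBall.
Variable R : realType.
Implicit Types a r mu h : R.

Definition two_term (x y : R) (q : R * R) : R * R := (x * q.1 - y * q.2, q.1).

(** The step has determinant 1 and preserves this quadratic form, which is
    definite for [a < 1]. *)
Lemma two_term_invariant a q k :
  let q' := iter k (two_term (2 * a) 1) q in
  q'.1 ^+ 2 - 2 * a * q'.1 * q'.2 + q'.2 ^+ 2 =
  q.1 ^+ 2 - 2 * a * q.1 * q.2 + q.2 ^+ 2.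
Proof.
elim: k => [//|k] /=; set q' := iter k _ _ => <-.
by ring.
Qed.

(** The form is [2 - 2 a] at the start and at least [(1 - a ^ 2) x ^ 2] along the
    sequence.  At [a = 1] the form degenerates, but the sequence is constant. *)
Lemma two_term_bounded a k : 0 <= a <= 1 ->
  `|(iter k (two_term (2 * a) 1) (1, 1)).1| <= 2.
Proof.
move=> /andP[a0 a1].
have [a_lt1|a_ge1] := ltP a 1.
  have := @two_term_invariant a (1, 1) k; rewrite /=.
  move: (iter k _ _) => -[x y] /= H.
  rewrite -(@ler_pXn2r _ 2) ?nnegrE// real_normK ?num_real//.
  have H2 : (1 - a ^+ 2) * x ^+ 2 <= 2 - 2 * a by have := sqr_ge0 (y - a * x); lra.
  have : (1 - a) * ((1 + a) * x ^+ 2) <= (1 - a) * 2 by lra.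
  by rewrite ler_pM2l ?subr_gt0// => ?; nra.
have -> : a = 1 by lra.
suff -> : iter k (two_term (2 * 1) 1) (1, 1) = (1, 1) by rewrite /= normr1 ler1n.
by elim: k => [//|k /= ->]; rewrite /two_term /=; congr pair; ring.
Qed.

(** The form is 1 at the start and equals
    [(x' - a x) ^ 2 + (1 - a ^ 2) x ^ 2], so consecutive terms satisfy
    [|x' - a x| <= 1]. *)
Lemma two_term_linear a k : 0 <= a <= 1 ->
  `|(iter k (two_term (2 * a) 1) (1, 0)).1| <= k%:R + 1.
Proof.
move=> /andP[a0 a1]; elim: k => [|k IH]; first by rewrite /= normr1 add0r.
have := @two_term_invariant a (1, 0) k.+1; rewrite iterS.
move: (iter k _ _) IH => -[x y] /= IH H.
have H2 : `|2 * a * x - 1 * y - a * x| <= 1.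
  rewrite -(@ler_pXn2r _ 2) ?nnegrE// real_normK ?num_real// expr1n.
  have : 0 <= (1 - a ^+ 2) * x ^+ 2 by rewrite mulr_ge0 ?sqr_ge0//; nra.
  by move: H; lra.
have -> : 2 * a * x - 1 * y = (2 * a * x - 1 * y - a * x) + a * x by ring.
apply: le_trans (ler_normD _ _) _.
rewrite normrM (ger0_norm a0) -natr1.
have : a * `|x| <= `|x| by rewrite ler_piMl.
lra.
Qed.

(** With momentum [r ^ 2] the iteration at an eigenvalue [mu] is
    [r ^ k (r C_k + (1 - r) U_k)], where [C] and [U] solve the Chebyshev
    recursion of parameter [a = mu (1 + r ^ 2) / (2 r) <= 1], started at (1, 1)
    and at (1, 0): the first one is bounded, the second one grows linearly,
    but its weight is only [1 - r]. *)
Lemma heavy_ball_decay mu r k : 0 <= r <= 1 -> 0 <= mu ->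
  mu * (1 + r ^+ 2) <= 2 * r ->
  `|(iter k (two_term ((1 + r ^+ 2) * mu) (r ^+ 2)) (1, 1)).1| <=
    (2 + k%:R * (1 - r)) * r ^+ k.
Proof.
move=> /andP[r0 r1] mu0 mur.
have [r_eq0|r_neq0] := eqVneq r 0.
  have -> : mu = 0 by move: mur; rewrite r_eq0; nra.
  rewrite r_eq0; case: k => [|k].
    by rewrite /= normr1 mul0r addr0 expr0 mulr1 ler1n.
  by rewrite /= /two_term /= mulr0 !mul0r expr0n /= mul0r subrr normr0 exprS mul0r mulr0.
have rgt0 : 0 < r by rewrite lt_def r_neq0.
pose a := mu * (1 + r ^+ 2) / (2 * r).
have a01 : 0 <= a <= 1.
  rewrite /a divr_ge0 ?mulr_ge0 ?addr_ge0 ?sqr_ge0 ?ler0n//=.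
  by rewrite ler_pdivrMr ?mulr_gt0// mul1r.
have aE : (1 + r ^+ 2) * mu = 2 * a * r by rewrite /a; field.
set f := two_term _ _; pose g := two_term (2 * a) 1.
have [H1 H2] : (iter k f (1, 1)).1 = r ^+ k * (r * (iter k g (1, 1)).1 + (1 - r) * (iter k g (1, 0)).1) /\
  (iter k f (1, 1)).2 * r = r ^+ k * (r * (iter k g (1, 1)).2 + (1 - r) * (iter k g (1, 0)).2).
  have f1 q : (f q).1 = 2 * a * r * q.1 - r * (q.2 * r).
    by rewrite /f /two_term /= aE; ring.
  have f2 q : (f q).2 = q.1 by [].
  have g1 q : (g q).1 = 2 * a * q.1 - q.2 by rewrite /g /two_term /= mul1r.
  have g2 q : (g q).2 = q.1 by [].
  elim: k => [|k [IH1 IH2]]; first by rewrite /=; split; ring.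
  by rewrite !iterS f1 f2 !g1 !g2 IH2 IH1 exprS; split; ring.
rewrite H1 normrM normrX (ger0_norm r0) mulrC ler_wpM2r ?exprn_ge0//.
apply: le_trans (ler_normD _ _) _; rewrite !normrM (ger0_norm r0).
rewrite (@ger0_norm _ (1 - r)) ?subr_ge0//.
have := @two_term_bounded a k a01; have := @two_term_linear a k a01.
rewrite -/g; move: `|(iter k g (1, 0)).1| `|(iter k g (1, 1)).1| => u c Hu Hc.
have : r * c <= r * 2 by rewrite ler_pM2l.
have : (1 - r) * u <= (1 - r) * (k%:R + 1) by rewrite ler_wpM2l ?subr_ge0.
by have : (0 : R) <= k%:R by []; nra.
Qed.

End HeavyBall.

(** * Spectrum of a mixing matrix *)

Section MixingSpectrum.
Variables (R : realType) (m : nat) (W : 'M[R]_m).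

Lemma lambda2_perm (mu : 'rV[R]_m) :
  char_poly W = \prod_j ('X - (mu 0 j)%:P) ->
  exists s : seq R, [/\ sorted >=%R s, perm_eq s [seq mu 0 j | j : 'I_m] & lambda2 W = s`_1].
Proof.
move=> cW; pose t := [seq mu 0 j | j : 'I_m].
have cW' : char_poly W = \prod_(a <- t) ('X - a%:P).
  by rewrite cW /t /image_mem big_map big_enum.
have : decreasing_spectrum W (sort >=%R t).
  split; first exact/sort_sorted/ge_total.
  by rewrite cW'; apply: perm_big; rewrite perm_sym perm_sort.
move=> /(@xgetI _ [::]) [s1 s2].
exists (xget [::] (decreasing_spectrum W : set (seq R))); split => //.
by apply: prod_XsubC_eq; rewrite -cW'.
Qed.

(** [0 <= W <= 1] puts the spectrum in [0, 1].  Eigenvectors for 1 are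
    constant; two orthonormal vectors cannot both be constant, so 1 is a simple
    eigenvalue, and it does occur.  It is thus the first entry of the decreasing
    spectrum, and [lambda2 < 1] dominates all the others. *)
Lemma mixing_spectral : (0 < m)%N -> mixing_matrix W ->
  0 <= lambda2 W < 1 /\
  exists (mu : 'rV[R]_m) (A B : 'M[R]_m),
  [/\ A *m W = diag_mx mu *m A, B *m W = diag_mx mu *m B,
      A^T *m A + B^T *m B = 1%:M &
      forall j, (0 <= mu 0 j <= lambda2 W) \/
        (exists a b : R, row j A = a *: (ones R m)^T /\ row j B = b *: (ones R m)^T)].
Proof.
move=> m0 [e [_ [Wsym _] _ [psdW psdIW] [[W1 _] nullW]]].
have [mu [A [B [cW [AW BW] AB1 AB2 BA]]]] := real_symmetric_spectral Wsym.
have rowE (M : 'M[R]_m) j : M *m W = diag_mx mu *m M -> row j M *m W = mu 0 j *: row j M.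
  move=> H; rewrite -row_mul H; apply/rowP => k; rewrite !mxE (bigD1 j)//= !mxE eqxx mulr1n.
  by rewrite big1 ?addr0// => l lj; rewrite !mxE eq_sym (negPf lj) mulr0n mul0r.
have normE j : fdot (row j A) (row j A) + fdot (row j B) (row j B) = 1.
  have := congr1 (fun M : 'M[R]_m => M j j) AB2.
  rewrite !mxE eqxx mulr1n => <-; congr (_ + _); rewrite /fdot big_ord1;
    by apply: eq_bigr => k _; rewrite !mxE.
have quadE (v : 'rV[R]_m) x : v *m W = x *: v ->
    ((v^T)^T *m W *m v^T) 0 0 = x * fdot v v.
  move=> H; rewrite trmxK H -scalemxAl mxE; congr (_ * _); rewrite /fdot big_ord1 mxE.
  by apply: eq_bigr => k _; rewrite !mxE.
have mu_ge0 j : 0 <= mu 0 j.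
  have := psdW (row j A)^T; have := psdW (row j B)^T.
  rewrite (quadE _ _ (rowE _ j AW)) (quadE _ _ (rowE _ j BW)) => h1 h2.
  by rewrite -[mu 0 j]mulr1 -(normE j) mulrDr addr_ge0.
have mu_le1 j : mu 0 j <= 1.
  have q1 (v : 'rV[R]_m) : v *m W = mu 0 j *: v ->
      ((v^T)^T *m (1%:M - W) *m v^T) 0 0 = (1 - mu 0 j) * fdot v v.
    move=> H; rewrite trmxK mulmxBr mulmx1 H -{1}[v]scale1r -scalerBl -scalemxAl mxE.
    by congr (_ * _); rewrite /fdot big_ord1 mxE; apply: eq_bigr => k _; rewrite !mxE.
  have := psdIW (row j A)^T; have := psdIW (row j B)^T.
  rewrite (q1 _ (rowE _ j AW)) (q1 _ (rowE _ j BW)) => h1 h2.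
  have E : 1 - mu 0 j = (1 - mu 0 j) * fdot (row j A) (row j A) + (1 - mu 0 j) * fdot (row j B) (row j B).
    by rewrite -mulrDr normE mulr1.
  by rewrite -subr_ge0 E addr_ge0.
have const_row (M : 'M[R]_m) j : M *m W = diag_mx mu *m M -> mu 0 j = 1 ->
    exists a : R, row j M = a *: (ones R m)^T.
  move=> MW mu1; have := rowE _ j MW; rewrite mu1 scale1r => H.
  have [|a Ha] := (nullW (row j M)^T).1.
    by rewrite mulmxBl mul1mx -[X in X *m _]Wsym -trmx_mul H subrr.
  by exists a; rewrite -linearZ /= -Ha trmxK.
have uniq1 i j : mu 0 i = 1 -> mu 0 j = 1 -> i = j.
  move=> mui muj; apply/eqP/negPn/negP => ij.
  have [a1 A1] := const_row _ _ AW mui; have [b1 B1] := const_row _ _ BW mui.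
  have [a2 A2] := const_row _ _ AW muj; have [b2 B2] := const_row _ _ BW muj.
  have Mij (M N : 'M[R]_m) k l x y : row k M = x *: (ones R m)^T -> row l N = y *: (ones R m)^T ->
      (M *m N^T) k l = x * y * m%:R.
    move=> /rowP HM /rowP HN; rewrite mxE (eq_bigr (fun=> x * y)).
      by rewrite sumr_const card_ord mulr_natr.
    by move=> h _; have := HM h; have := HN h; rewrite !mxE !mulr1 => -> ->.
  have e1 := congr1 (fun M : 'M[R]_m => M i j) AB2.
  have e2 := congr1 (fun M : 'M[R]_m => M i j) BA.
  have e3 := congr1 (fun M : 'M[R]_m => M i i) AB2.
  have e4 := congr1 (fun M : 'M[R]_m => M j j) AB2.
  move: e1 e2 e3 e4; rewrite mxE (Mij _ _ _ _ _ _ A1 A2) (Mij _ _ _ _ _ _ B1 B2).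
  rewrite (Mij _ _ _ _ _ _ B1 A2) (Mij _ _ _ _ _ _ A1 B2).
  rewrite [in X in _ -> _ -> X -> _]mxE (Mij _ _ _ _ _ _ A1 A1) (Mij _ _ _ _ _ _ B1 B1).
  rewrite [in X in _ -> _ -> _ -> X -> _]mxE (Mij _ _ _ _ _ _ A2 A2) (Mij _ _ _ _ _ _ B2 B2).
  rewrite !mxE (negPf ij) !eqxx mulr0n mulr1n => e1 e2 e3 e4.
  have mn0 : (m%:R : R) != 0 by rewrite pnatr_eq0 -lt0n.
  have e1' : a1 * a2 + b1 * b2 = 0 by apply: (mulIf mn0); rewrite mul0r -e1; ring.
  have e2' : b1 * a2 - a1 * b2 = 0.
    by apply/eqP; rewrite subr_eq0; apply/eqP/(mulIf mn0).
  have : (a1 * a1 * m%:R + b1 * b1 * m%:R) * (a2 * a2 * m%:R + b2 * b2 * m%:R) =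
     ((a1 * a2 + b1 * b2) ^+ 2 + (b1 * a2 - a1 * b2) ^+ 2) * m%:R ^+ 2 by ring.
  rewrite e1' e2' e3 e4 expr0n /= addr0 mul0r mulr1 => /eqP.
  by rewrite oner_eq0.
have [j1 mu1] : exists j, mu 0 j = 1.
  apply: contrapT => /forallNP Hn.
  have kill (M : 'M[R]_m) : M *m W = diag_mx mu *m M -> M *m ones R m = 0.
    move=> MW; have H : M *m ones R m = diag_mx mu *m (M *m ones R m).
      by rewrite mulmxA -MW -mulmxA W1.
    apply/colP => j; rewrite [RHS]mxE.
    move/colP: H => /(_ j); rewrite [RHS]mxE (bigD1 j)//= big1; last first.
      by move=> l lj; rewrite !mxE eq_sym (negPf lj) mulr0n mul0r.
    rewrite addr0 [diag_mx _ _ _]mxE eqxx mulr1n => H.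
    have : (1 - mu 0 j) * (M *m ones R m) j 0 = 0 by rewrite mulrBl mul1r -H subrr.
    by move/eqP; rewrite mulf_eq0 subr_eq0 => /orP[/eqP h|/eqP//]; case: (Hn j).
  have : ones R m = 0.
    by rewrite -[LHS]mul1mx -AB1 mulmxDl -!mulmxA (kill _ AW) (kill _ BW) !mulmx0 addr0.
  move/colP/(_ (Ordinal m0)); rewrite !mxE => /eqP; by rewrite oner_eq0.
have [s [s_sorted s_perm ->]] := lambda2_perm cW.
have szs : size s = m by rewrite (perm_size s_perm) size_image card_ord.
have sle a b : (a <= b < size s)%N -> s`_b <= s`_a.
  move=> /andP[ab bs].
  apply: (sorted_leq_nth (rev_trans (@le_trans _ R)) (fun x : R => lexx x) 0 s_sorted) => //.
  exact: leq_ltn_trans bs.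
have sP x : x \in s -> exists j, x = mu 0 j.
  by rewrite (perm_mem s_perm) => /mapP[j _ ->]; exists j.
have s0 : s`_0 = 1.
  have : mu 0 j1 \in s by rewrite (perm_mem s_perm); apply: map_f; rewrite mem_enum.
  rewrite mu1 => /(nthP 0)[k kl sk]; apply/eqP; rewrite eq_le; apply/andP; split.
    have [|j ->] := sP s`_0; last exact: mu_le1.
    by rewrite mem_nth// szs.
  by rewrite -sk sle.
have cnt1 : count_mem 1 s = 1%N.
  rewrite (permP s_perm) /image_mem count_map -size_filter.
  rewrite (eq_in_filter (a2 := pred1 j1)).
    by rewrite size_filter count_uniq_mem ?enum_uniq// mem_enum.
  move=> j _ /=; apply/eqP/eqP => [h|->//]; exact: uniq1.
split.
  case: (ltnP 1 (size s)) => hs; last by rewrite nth_default// lexx ltr01.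
  have [|j sj] := sP s`_1; first exact: mem_nth.
  rewrite {1}sj mu_ge0/= lt_neqAle andbC {1}sj mu_le1/=.
  apply/negP => /eqP h1.
  move: cnt1 s0 hs h1; case: (s) => [|x [|y t]]//= + x1 _ y1.
  by rewrite x1 y1 !eqxx.
exists mu, A, B; split => // j.
have [muj|muj] := eqVneq (mu 0 j) 1.
  by right; have [a Ha] := const_row _ _ AW muj; have [b Hb] := const_row _ _ BW muj; exists a, b.
left; rewrite mu_ge0/=.
have : mu 0 j \in s by rewrite (perm_mem s_perm); apply: map_f; rewrite mem_enum.
move=> /(nthP 0)[[|k] kl sk]; first by rewrite -sk s0 eqxx in muj.
by rewrite -sk sle.
Qed.
End MixingSpectrum.

(** * Contraction of accelerated gossip *)

Section GossipRate.
Variable R : realType.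

(** With [r = lambda2 / (1 + sqrt (1 - lambda2 ^ 2))] the momentum is [r ^ 2], and
    [z ^ 2 - (1 + r ^ 2) lambda2 z + r ^ 2] has the double root [r]: the recursion
    is critically damped at [lambda2]. *)
Lemma gossip_eta_root (m : nat) (W : 'M[R]_m) : 0 <= lambda2 W < 1 ->
  exists r, [/\ 0 <= r, r * (1 + Num.sqrt (spectral_gap W)) <= 1,
    gossip_eta W = r ^+ 2 & lambda2 W * (1 + r ^+ 2) = 2 * r].
Proof.
rewrite /gossip_eta /spectral_gap; move: (lambda2 W) => l /andP[l0 l1].
have s2 : Num.sqrt (1 - l ^+ 2) ^+ 2 = 1 - l ^+ 2 by rewrite sqr_sqrtr//; nra.
have g_le : Num.sqrt (1 - l) <= Num.sqrt (1 - l ^+ 2) by rewrite ler_sqrt; nra.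
have s0 : 0 <= Num.sqrt (1 - l ^+ 2) by exact: sqrtr_ge0.
have g0 : 0 <= Num.sqrt (1 - l) by exact: sqrtr_ge0.
move: (Num.sqrt (1 - l ^+ 2)) (Num.sqrt (1 - l)) s2 g_le s0 g0 => s g s2 g_le s0 g0.
have s1 : 1 + s != 0 by apply: lt0r_neq0; lra.
have rE : (1 - s) / (1 + s) = (l / (1 + s)) ^+ 2.
  rewrite expr_div_n; apply: (mulIf (expf_neq0 2 s1)).
  rewrite (divfK (expf_neq0 2 s1)) expr2 mulrA divfK//.
  by rewrite (_ : l ^+ 2 = 1 - s ^+ 2); [ring | rewrite s2; ring].
exists (l / (1 + s)); split.
- by rewrite divr_ge0//; lra.
- by rewrite mulrAC ler_pdivrMr ?mul1r; [nra|lra].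
- exact: rE.
- by rewrite -rE; field.
Qed.

(** The linear factor is absorbed by half of the geometric decay: for [r = q ^ 2]
    the sequence [(2 + k (1 - q ^ 2)) q ^ k] is nonincreasing in [k]. *)
Lemma linear_geometric_le (r : R) k : 0 <= r <= 1 ->
  (2 + k%:R * (1 - r)) * r ^+ k <= 2 * Num.sqrt r ^+ k.
Proof.
move=> /andP[r0 r1]; rewrite -{1 2}(sqr_sqrtr r0).
have q0 : 0 <= Num.sqrt r by exact: sqrtr_ge0.
have q1 : Num.sqrt r <= 1 by rewrite -sqrtr1 ler_sqrt.
move: (Num.sqrt r) q0 q1 => q q0 q1.
rewrite -exprM mul2n -addnn exprD mulrA ler_wpM2r ?exprn_ge0//.
elim: k => [|k IH]; first by rewrite mul0r addr0 expr0 mulr1.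
rewrite [q ^+ k.+1]exprS; have := exprn_ge0 k q0; have : (0 : R) <= k%:R by [].
rewrite -[k.+1%:R]natr1; move: (q ^+ k) (k%:R : R) IH => x y IH y0 x0.
have h : (2 + (y + 1) * (1 - q ^+ 2)) * q <= 2 + y * (1 - q ^+ 2).
  have : 0 <= (1 - q) ^+ 2 * (2 + q + y * (1 + q)).
    by rewrite mulr_ge0 ?sqr_ge0// addr_ge0 ?mulr_ge0//; lra.
  by rewrite -[X in _ -> is_true X]subr_ge0; congr (is_true (_ <= _)); ring.
rewrite mulrA; apply: le_trans IH; exact: ler_wpM2r.
Qed.

(** [r <= 1 / (1 + g) <= 1 - g / 2 <= exp (- g / 2)]. *)
Lemma sqrt_pow_le_exp (r g : R) k : 0 <= r -> 0 <= g <= 1 -> r * (1 + g) <= 1 ->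
  Num.sqrt r ^+ k <= expR (- (k%:R * g / 4)).
Proof.
move=> r0 /andP[g0 g1] rg.
have q0 : 0 <= Num.sqrt r by exact: sqrtr_ge0.
have -> : - (k%:R * g / 4) = k%:R * (- (g / 4)) by ring.
rewrite mulrC expRM_natr; apply: lerXn2r; rewrite ?nnegrE ?expR_ge0//.
rewrite -(@ler_pXn2r _ 2) ?nnegrE ?expR_ge0// sqr_sqrtr// -expRM_natr.
have e : 1 + - (g / 4) * 2 <= expR (- (g / 4) * 2) by exact: expR_ge1Dx.
apply: le_trans e; nra.
Qed.

Lemma fdot_tr p q (M N : 'M[R]_(p, q)) : fdot M N = \tr (M^T *m N).
Proof.
rewrite /fdot exchange_big; apply: eq_bigr => j _; rewrite !mxE.
by apply: eq_bigr => i _; rewrite !mxE.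
Qed.

Variables (m d : nat) (W : 'M[R]_m).
Hypotheses (m0 : (0 < m)%N) (mixW : mixing_matrix W).
Implicit Type Y : 'M[R]_(m, d).

Let W1 : W *m ones R m = ones R m.
Proof. by have [e [_ _ _ _ [[]]]] := mixW. Qed.

Let rowmeanW Y : rowmean (W *m Y) = rowmean Y.
Proof.
have [e [_ [Ws _] _ _ _]] := mixW.
by rewrite /rowmean mulmxA -[X in _ *m X *m _]Ws -trmx_mul W1.
Qed.

Let gossip_step (Y : 'M[R]_(m, d) * 'M[R]_(m, d)) :=
  ((1 + gossip_eta W) *: (W *m Y.1) - gossip_eta W *: Y.2, Y.1).

Lemma rowmean_AccGossip Y K : rowmean (AccGossip Y W K) = rowmean Y.
Proof.
suff [] : rowmean (iter K gossip_step (Y, Y)).1 = rowmean Y /\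
  rowmean (iter K gossip_step (Y, Y)).2 = rowmean Y by [].
elim: K => [//|K [IH1 IH2]] /=; split => //.
by rewrite rowmeanD rowmeanN !rowmeanZ rowmeanW IH1 IH2 scalerDl scale1r addrK.
Qed.

(** In an eigenbasis the coordinates of the iterates obey scalar recursions. *)
Let eigen_iter (M : 'M[R]_m) (mu : 'rV[R]_m) Y K j : M *m W = diag_mx mu *m M ->
  let c := ones R m *m rowmean Y in
  let q := iter K (two_term ((1 + gossip_eta W) * mu 0 j) (gossip_eta W)) (1, 1) in
  row j (M *m ((iter K gossip_step (Y, Y)).1 - c)) = q.1 *: row j (M *m (Y - c)) /\
  row j (M *m ((iter K gossip_step (Y, Y)).2 - c)) = q.2 *: row j (M *m (Y - c)).
Proof.
move=> MW c; set h := gossip_eta W.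
have rowMW Z : row j (M *m (W *m Z)) = mu 0 j *: row j (M *m Z).
  rewrite mulmxA MW -mulmxA; apply/rowP => k; rewrite [LHS]mxE [in LHS]mxE (bigD1 j)//= big1.
    by rewrite addr0 [diag_mx _ _ _]mxE eqxx mulr1n !mxE.
  by move=> l lj; rewrite [diag_mx _ _ _]mxE eq_sym (negPf lj) mulr0n mul0r.
have Wc : W *m c = c by rewrite mulmxA W1.
elim: K => [|K [IH1 IH2]]; first by rewrite /= !scale1r.
rewrite !iterS; move: IH1 IH2; move: (iter K _ _) (iter K _ _) => q Z IH1 IH2.
split => //=.
have -> : (1 + h) *: (W *m Z.1) - h *: Z.2 - c =
    (1 + h) *: (W *m (Z.1 - c)) - h *: (Z.2 - c).
  rewrite mulmxBr Wc; move: (W *m Z.1) => V.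
  by apply/matrixP => k l; rewrite !mxE; ring.
have rZ a (N : 'M[R]_(m, d)) : row j (a *: N) = a *: row j N by exact: linearZ.
have rB (N N' : 'M[R]_(m, d)) : row j (N - N') = row j N - row j N' by exact: linearB.
by rewrite mulmxBr rB -!scalemxAr !rZ rowMW IH1 IH2 scalerBl !scalerA.
Qed.

Lemma spectral_gap_bounds : 0 < spectral_gap W <= 1.
Proof.
have [/andP[l0 l1] _] := mixing_spectral m0 mixW.
by rewrite /spectral_gap subr_gt0 l1 lerBlDr lerDl.
Qed.

(** The eigenvectors define an isometry, so each coordinate of the deviation from
    the mean can be bounded separately.  Those on constant eigenvectors are 0;
    the others are multiplied by a heavy-ball sequence at an eigenvalue at most
    [lambda2]. *)
Lemma AccGossip_contracts Y K :
  consensus_error (AccGossip Y W K) <=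
  2 * expR (- (K%:R * Num.sqrt (spectral_gap W) / 4)) * consensus_error Y.
Proof.
have [l01 [mu [A [B [AW BW AB1 muP]]]]] := mixing_spectral m0 mixW.
have [r [r0 rg hE lr]] := gossip_eta_root l01.
have g0 : 0 <= Num.sqrt (spectral_gap W) by exact: sqrtr_ge0.
have r1 : r <= 1 by nra.
have g1 : Num.sqrt (spectral_gap W) <= 1.
  by rewrite -sqrtr1 ler_sqrt//; have /andP[] := spectral_gap_bounds.
set b := 2 * _.
have b0 : 0 <= b by rewrite mulr_ge0 ?expR_ge0.
have pb j : 0 <= mu 0 j <= lambda2 W ->
    `|(iter K (two_term ((1 + gossip_eta W) * mu 0 j) (gossip_eta W)) (1, 1)).1| <= b.
  move=> /andP[mu0 mul]; rewrite hE.
  apply: le_trans (heavy_ball_decay _ _ mu0 _) _; rewrite ?r0//.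
    by rewrite -lr ler_wpM2r ?addr_ge0 ?sqr_ge0.
  apply: le_trans (linear_geometric_le _ _) _; rewrite ?r0//.
  by rewrite /b ler_wpM2l// sqrt_pow_le_exp ?g0.
have isom (M : 'M[R]_(m, d)) : fnorm M ^+ 2 = fnorm (A *m M) ^+ 2 + fnorm (B *m M) ^+ 2.
  rewrite !fnorm_sqr !fdot_tr !trmx_mul -!mulmxA -mxtraceD -mulmxDr.
  by rewrite !mulmxA -mulmxDl AB1 mul1mx.
rewrite /consensus_error rowmean_AccGossip.
set c := ones R m *m rowmean Y.
have zero1 : (ones R m)^T *m (Y - c) = 0.
  by rewrite mulmxBr mulmxA ones_ones mul_scalar_mx /rowmean scalerA mulfV ?scale1r ?subrr// pnatr_eq0 -lt0n.
have rows (M : 'M[R]_m) j : M *m W = diag_mx mu *m M ->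
    (0 <= mu 0 j <= lambda2 W) \/ (exists a, row j M = a *: (ones R m)^T) ->
    fnorm (row j (M *m (AccGossip Y W K - c))) ^+ 2 <= b ^+ 2 * fnorm (row j (M *m (Y - c))) ^+ 2.
  move=> MW H; rewrite -exprMn lerXn2r ?nnegrE ?mulr_ge0 ?fnorm_ge0//.
  have [-> _] := eigen_iter Y K j MW; rewrite fnormZ.
  case: H => [/pb H|[a Ha]]; first by rewrite ler_wpM2r ?fnorm_ge0.
  by rewrite row_mul Ha -scalemxAl zero1 scaler0 fnorm0 !mulr0.
rewrite -(@ler_pXn2r _ 2) ?nnegrE ?mulr_ge0 ?fnorm_ge0// exprMn [leLHS]isom (isom (Y - c)).
rewrite mulrDr; apply: lerD; rewrite fnorm_sqr_rows [in leRHS]fnorm_sqr_rows mulr_sumr;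
  apply: ler_sum => j _; apply: rows => //; case: (muP j) => [?|[x [y [? ?]]]];
  by [left|right; exists x|right; exists y].
Qed.

End GossipRate.

Lemma consensus_error1 (R : realType) (m d : nat) (Y : 'M[R]_(m, d)) :
  (m <= 1)%N -> consensus_error Y = 0.
Proof.
case: m Y => [|[|//]] Y _; rewrite /consensus_error.
  by rewrite [_ - _]flatmx0 fnorm0.
rewrite (_ : _ - _ = 0) ?fnorm0//; apply/row_matrixP => i.
by rewrite linearB /= row_ones row0 rowmeanE big_ord1 invr1 scale1r (ord1 i) subrr.
Qed.

Section GossipParameters.
Variables (R : realType) (m : nat) (W : 'M[R]_m).
Hypotheses (m0 : (0 < m)%N) (mixW : mixing_matrix W).

Lemma gossip_log_ge0 (eta : R) : 0 <= eta -> 0 <= gossip_log m eta.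
Proof.
move=> e0; apply: ln_ge0.
have s1 : 1 <= Num.sqrt (m%:R : R) by rewrite -[leLHS]sqrtr1 ler_sqrt ?ler0n// ler1n.
have e1 : 1 <= 1 + eta by rewrite lerDl.
exact: mulr_ege1.
Qed.

(** Since [84 = 4 * 21], the rate is at most [2 / (sqrt m) ^ 21].  One power of
    [sqrt m] compensates the factor [sqrt m] and, for [m >= 2], the other twenty
    are at least [2 ^ 10].  A single agent has no consensus error, whatever the
    number of rounds. *)
Lemma gossip_rounds (eta : R) K : 0 <= eta ->
  84 * (gossip_log m eta / Num.sqrt (spectral_gap W)) <= K%:R ->
  exists2 rho : R, 0 <= rho /\ Num.sqrt m%:R * rho <= 512^-1 &
    forall (d : nat) (Y : 'M[R]_(m, d)),
      consensus_error (AccGossip Y W K) <= rho * consensus_error Y.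
Proof.
move=> e0 HK; case: (leqP m 1) => [m1|m2].
  exists 0; first by split; rewrite ?mulr0.
  by move=> d Y; rewrite !consensus_error1 ?mulr0.
exists (2 * expR (- (K%:R * Num.sqrt (spectral_gap W) / 4))); last first.
  by move=> d Y; exact: AccGossip_contracts.
split; first by rewrite mulr_ge0 ?expR_ge0.
have /andP[gap0 gap1] := spectral_gap_bounds m0 mixW.
have g0 : 0 < Num.sqrt (spectral_gap W) by rewrite sqrtr_gt0.
have s2 : 2 <= Num.sqrt (m%:R : R) ^+ 2 by rewrite sqr_sqrtr ?ler0n// (ler_nat _ 2).
have s0 : 0 < Num.sqrt (m%:R : R) by rewrite sqrtr_gt0 ltr0n.
have x1 : 0 < Num.sqrt (m%:R : R) * (1 + eta) by rewrite mulr_gt0//; lra.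
have H : expR (- (K%:R * Num.sqrt (spectral_gap W) / 4)) <= (Num.sqrt m%:R ^+ 21)^-1.
  apply: (@le_trans _ _ (expR (- (21 * gossip_log m eta)))).
    rewrite ler_expR; move: HK; rewrite mulrA ler_pdivrMr//; lra.
  rewrite expRN mulrC expRM_natr lnK ?posrE// lef_pV2 ?posrE ?exprn_gt0//.
  by apply: lerXn2r; rewrite ?nnegrE ?(ltW s0) ?(ltW x1)// ler_peMr ?(ltW s0)//; lra.
apply: (@le_trans _ _ (Num.sqrt m%:R * (2 * (Num.sqrt m%:R ^+ 21)^-1))).
  by rewrite ler_pM2l// ler_wpM2l.
have -> : Num.sqrt (m%:R : R) * (2 * (Num.sqrt m%:R ^+ 21)^-1) = 2 * ((Num.sqrt m%:R ^+ 2) ^+ 10)^-1.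
  by rewrite -exprM exprS; field; rewrite lt0r_neq0.
have : 2 ^+ 10 <= (Num.sqrt (m%:R : R) ^+ 2) ^+ 10 by rewrite lerXn2r ?nnegrE ?sqr_ge0.
move=> h; rewrite (_ : 512^-1 = 2 * (2 ^+ 10)^-1); last by field.
by rewrite ler_pM2l// lef_pV2 ?posrE ?exprn_gt0.
Qed.

End GossipParameters.

(** * Gradients *)

Section Gradient.
Variables (R : realType) (d : nat).
Implicit Types (g : 'rV[R]_d -> R) (x y v : 'rV[R]_d).

Lemma derive_grad g x v : differentiable g x -> 'D_v g x = fdot (grad g x) v.
Proof.
move=> dg; rewrite deriveE// {1}(row_sum_delta v) linear_sum /= /fdot big_ord1.
by apply: eq_bigr => j _; rewrite linearZ /= -deriveE// mxE mulrC.
Qed.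

(** The mean value theorem for [s |-> g (x + s (y - x))], whose difference
    quotients are those of [g] in the direction [y - x]. *)
Lemma grad_mvt g x y : (forall z, differentiable g z) ->
  exists2 s : R, 0 <= s <= 1 & g y - g x = fdot (grad g (x + s *: (y - x))) (y - x).
Proof.
move=> dg; pose phi s := g (x + s *: (y - x)).
have quotE s : (fun h : R => h^-1 *: ((phi \o shift s) (h *: (1 : R^o)) - phi s)) =
    (fun h : R => h^-1 *: ((g \o shift (x + s *: (y - x))) (h *: (y - x)) - g (x + s *: (y - x)))).
  apply/funext => h; rewrite /phi /= /shift /=; congr (_ *: (g _ - _)).
  have -> : h *: (1 : R^o) = h := mulr1 h.
  by rewrite scalerDl addrCA.
have dphi s : is_derive (s : R^o) 1 (phi : R^o -> R^o) (fdot (grad g (x + s *: (y - x))) (y - x)).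
  split.
    rewrite /derivable quotE; exact: diff_derivable.
  by rewrite -derive_grad// /derive quotE.
have cphi : {within `[0%R, 1%R]%classic, continuous (phi : R^o -> R^o)}.
  apply: derivable_within_continuous => s _; exact: ex_derive.
have [s s01 Hs] := MVT_segment ler01 (fun s _ => dphi s) cphi.
exists s; first by move: s01; rewrite in_itv.
by move: Hs; rewrite /phi subr0 mulr1 scale1r scale0r addr0 [x + (y - x)]addrC subrK.
Qed.

Lemma grad_average (m : nat) (f : 'I_m -> 'rV[R]_d -> R) x :
  (forall i, differentiable (f i) x) ->
  grad (average f) x = m%:R^-1 *: \sum_i grad (f i) x.
Proof.
move=> df; apply/rowP => j; rewrite !mxE summxE.
have dv i : derivable (f i) x (delta_mx 0 j) by exact: diff_derivable.
have -> : average f = m%:R^-1 \*: (\sum_i f i).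
  by apply/funext => z; rewrite /average /= fct_sumE.
rewrite deriveZ; last exact: derivable_sum.
rewrite derive_sum//; congr (_ * _).
by apply: eq_bigr => i _; rewrite mxE.
Qed.

Lemma differentiable_average (m : nat) (f : 'I_m -> 'rV[R]_d -> R) x :
  (forall i, differentiable (f i) x) -> differentiable (average f) x.
Proof.
move=> df; have -> : average f = m%:R^-1 \*: (\sum_i f i).
  by apply/funext => z; rewrite /average /= fct_sumE.
by apply: differentiableZ; apply: differentiable_sum.
Qed.

End Gradient.

(** * Sure analysis of a trajectory *)

(** The estimates along a trajectory once the vectors are replaced by their
    norms.  Separating them keeps the linear arithmetic small. *)
Section Arithmetic.
Variable R : realType.

Lemma drift_arith (A B M e : R) : 0 <= M * e ->
  A <= M * (e + e / 256) -> B <= M * (e / 256) -> A + B <= 2 * (M * e).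
Proof. by move=> h; rewrite mulrDr mulrA; lra. Qed.

Lemma tracking_arith (s rho a b u v w : R) : 0 < s -> 0 <= rho -> s * rho <= 512^-1 ->
  rho <= 512^-1 -> 0 <= a -> 0 <= u -> 0 <= v -> 0 <= w ->
  s * b <= rho * (s * a + (s * (s * u) + s * (s * v) + s * (2 * w))) ->
  b <= 512^-1 * (a + (u + v) + 2 * w).
Proof.
move=> s0 r0 rs r1 a0 u0 v0 w0 dV.
have dV' : b <= rho * a + (s * rho) * (u + v) + rho * (2 * w).
  rewrite -(@ler_pM2l _ s)//; apply: le_trans dV _; rewrite le_eqVlt; apply/orP; left.
  by apply/eqP; ring.
apply: le_trans dV' _; rewrite !mulrDr; apply: lerD; first apply: lerD.
- by rewrite ler_wpM2r.
- by rewrite -!mulrDr ler_wpM2r// addr_ge0.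
- by rewrite ler_wpM2r// mulr_ge0.
Qed.

(** One round of the telescoping.  Of the weight [2 + 1/64] of the consensus
    error [c0], the descent uses 2 and the next round less than [1/64].  The
    terms in [Mw] add up to less than [33/32], and [Mw <= Lw + g / 2] takes
    [33/64] of the gradient norm [g] for them: [31/64] remains. *)
Lemma potential_arith (e F0 F1 S1 S2 c0 c1 C g n q Mw Lw : R) : 0 < e ->
  0 <= c0 -> 0 <= Mw -> Mw <= Lw + g / 2 -> 0 <= q ->
  F1 <= F0 - e * g + e * (2 * c0 + 2 * n + (1 + 1 / 128) * Mw) ->
  c1 <= 512^-1 * (c0 + q + 2 * Mw) ->
  F0 / e + (2 + 1 / 64) * c0 + 31 / 64 * S1 <= C + S2 ->
  F1 / e + (2 + 1 / 64) * c1 + 31 / 64 * (S1 + g) <=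
  C + (S2 + (2 * n + q / 128 + 33 / 32 * Lw)).
Proof.
move=> e0 c00 M0 Mg q0 H1 Hc IH.
have : F1 / e <= F0 / e - g + (2 * c0 + 2 * n + (1 + 1 / 128) * Mw).
  rewrite ler_pdivrMr//; apply: le_trans H1 _; rewrite le_eqVlt; apply/orP; left.
  by apply/eqP; field; exact: lt0r_neq0.
move: (F1 / e) (F0 / e) IH => y x IH Hy; lra.
Qed.

Lemma rows_arith (h D g Mw Lw : R) : h <= D + g -> D <= Mw / 256 -> Mw <= Lw + g / 2 ->
  h <= 513 / 512 * g + Lw / 256.
Proof. lra. Qed.

Lemma collect_arith (S A TL G : R) : 0 <= TL -> 0 <= G ->
  31 / 64 * G <= A + S -> 513 / 512 * G + TL / 256 <= 17 / 8 * (A + (S + TL / 32)).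
Proof. lra. Qed.

Lemma split_arith (x L : R) : x + 17 / 16 * L = x + 33 / 32 * L + 1 / 32 * L.
Proof. by field. Qed.

Lemma half_arith (L1 eta g : R) : L1 * eta <= 1 / 2 -> 0 <= g -> L1 * g * eta <= g / 2.
Proof. by move=> h g0; rewrite mulrAC; have := ler_wpM2r g0 h; lra. Qed.

End Arithmetic.

Section Objective.
Variables (R : realType) (m d : nat) (L0 L1 zeta : R).
Variable f : 'I_m -> 'rV[R]_d -> R.
Hypotheses (m0 : (0 < m)%N) (L00 : 0 <= L0) (L10 : 0 <= L1) (zeta0 : 0 <= zeta).
Hypothesis df : forall i x, differentiable (f i) x.
Hypothesis smooth : forall i, L0L1_smooth L0 L1 (f i).
Hypothesis het : bounded_heterogeneity zeta f.
Implicit Types x y : 'rV[R]_d.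

Definition gradmx (X : 'M[R]_(m, d)) : 'M[R]_(m, d) := \matrix_i grad (f i) (row i X).

Let F := average f.
Let Lf := L0 + L1 * zeta.
Let M x := Lf + L1 * fnorm (grad F x).

Lemma Lf_ge0 : 0 <= Lf. Proof. by rewrite addr_ge0 ?mulr_ge0. Qed.

Lemma modulus_ge0 x : 0 <= M x.
Proof. by rewrite addr_ge0 ?Lf_ge0 ?mulr_ge0 ?fnorm_ge0. Qed.

(** By heterogeneity the gradient of an agent exceeds that of the average by at
    most [zeta], so one modulus [M x] serves all the agents. *)
Lemma grad_lipschitz i x y : (0 < L1 -> fnorm (x - y) <= L1^-1) ->
  fnorm (grad (f i) x - grad (f i) y) <= M x * fnorm (x - y).
Proof.
move=> xy; apply: le_trans (@smooth i x y xy) _.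
apply: ler_wpM2r; first exact: fnorm_ge0.
rewrite /M /Lf -addrA lerD2l -mulrDr; apply: ler_wpM2l => //.
have := fnormD (grad (f i) x - grad F x) (grad F x).
by rewrite subrK => /le_trans; apply; rewrite lerD2r; exact: het.
Qed.

Lemma gradmx_mean X : rowmean (gradmx X) = m%:R^-1 *: \sum_i grad (f i) (row i X).
Proof.
rewrite rowmeanE; congr (_ *: _); apply: eq_bigr => i _.
by apply/rowP => j; rewrite !mxE.
Qed.

Lemma row_gradmx X i : row i (gradmx X) = grad (f i) (row i X).
Proof. by apply/rowP => j; rewrite !mxE. Qed.

Lemma average_lipschitz x y : (0 < L1 -> fnorm (x - y) <= L1^-1) ->
  fnorm (grad F x - grad F y) <= M x * fnorm (x - y).
Proof.
move=> xy; rewrite !grad_average// -scalerBr -sumrB fnormZ ger0_norm ?invr_ge0 ?ler0n//.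
rewrite mulrC ler_pdivrMr ?ltr0n// mulr_natr.
apply: le_trans (fnorm_sum _ _ _) _.
rewrite -[leRHS](_ : \sum_(i < m) M x * fnorm (x - y) = _); last by rewrite sumr_const card_ord.
by apply: ler_sum => i _; exact: grad_lipschitz.
Qed.

(** By the mean value theorem the increment of [F] is the slope at an
    intermediate point; the gradient there is within [M x |y - x|] of the one at
    [x].  Integrating along the segment would halve the quadratic term. *)
Lemma average_descent x y : (0 < L1 -> fnorm (y - x) <= L1^-1) ->
  F y <= F x + fdot (grad F x) (y - x) + M x * fnorm (y - x) ^+ 2.
Proof.
move=> xy; have dF z : differentiable F z by exact: differentiable_average.
have [s /andP[s0 s1] H] := grad_mvt x y dF.
have step : fnorm (x - (x + s *: (y - x))) = s * fnorm (y - x).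
  by rewrite opprD addNKr fnormN fnormZ ger0_norm.
have := @average_lipschitz x (x + s *: (y - x)); rewrite step.
have sle : s * fnorm (y - x) <= fnorm (y - x) by rewrite ler_piMl ?fnorm_ge0.
move=> /(_ (fun h => le_trans sle (xy h))) H2.
have : fdot (grad F (x + s *: (y - x)) - grad F x) (y - x) <= M x * fnorm (y - x) ^+ 2.
  apply: le_trans (fdot_le _ _) _; rewrite expr2 mulrA ler_wpM2r ?fnorm_ge0//.
  rewrite fnormB; apply: le_trans H2 _.
  by rewrite ler_wpM2l// modulus_ge0.
by rewrite fdotDl fdotNl -H; lra.
Qed.

(** The inner product of [v] with its own direction is [|v|], and replacing [v] by
    [g] changes both sides by at most [|g - v|].  For [v = 0] the error is [|g|]
    itself. *)
Lemma normalized_progress (g v : 'rV[R]_d) :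
  fnorm g - 2 * fnorm (g - v) <= fdot g ((fnorm v)^-1 *: v).
Proof.
have [v0|v0] := eqVneq (fnorm v) 0.
  rewrite (fnorm_eq0 v0) scaler0 fdot0r subr0; have := fnorm_ge0 g; lra.
have u1 : fnorm ((fnorm v)^-1 *: v) = 1.
  by rewrite fnormZ ger0_norm ?invr_ge0 ?fnorm_ge0// mulVf.
have vu : fdot v ((fnorm v)^-1 *: v) = fnorm v.
  by rewrite fdotZr -fnorm_sqr expr2 mulrA mulVf// mul1r.
have := fdot_le (v - g) ((fnorm v)^-1 *: v).
rewrite fdotDl fdotNl vu u1 mulr1 fnormB.
have := fnormD (g - v) v; rewrite subrK; lra.
Qed.

Lemma fnorm_normalize_le1 (V : 'M[R]_(m, d)) i : fnorm (row i (normalize_rows V)) <= 1.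
Proof.
rewrite rowK fnormZ ger0_norm ?invr_ge0 ?fnorm_ge0//.
have [->|v0] := eqVneq (fnorm (row i V)) 0; first by rewrite mulr0.
by rewrite mulVf.
Qed.

(** Gossip enters the analysis as a map that preserves the mean and contracts the
    consensus error. *)
Section Trajectory.
Variables (eta rho : R) (x0 : 'rV[R]_d) (X V G : nat -> 'M[R]_(m, d)).
Variable gossip : 'M[R]_(m, d) -> 'M[R]_(m, d).
Hypotheses (eta0 : 0 < eta) (etaL : L1 * eta <= 1 / 2).
Hypotheses (rho0 : 0 <= rho) (rho_small : Num.sqrt m%:R * rho <= 512^-1).
Hypothesis gossip_mean : forall Y, rowmean (gossip Y) = rowmean Y.
Hypothesis gossip_contract : forall Y, consensus_error (gossip Y) <= rho * consensus_error Y.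
Hypothesis X0 : X 0%N = ones R m *m x0.
Hypothesis XS : forall t, X t.+1 = gossip (X t - eta *: normalize_rows (V t)).
Hypothesis V0 : rowmean (V 0%N) = rowmean (G 0%N).
Hypothesis VS : forall t, V t.+1 = gossip (V t + G t.+1 - G t).

Let xbar t := rowmean (X t).
Let g t := fnorm (grad F (xbar t)).
Let c t := consensus_error (V t) / Num.sqrt m%:R.
Let n t := fnorm (rowmean (G t) - rowmean (gradmx (X t))).
Let N t := fnorm (G t - gradmx (X t)).

Let sm_ge1 : 1 <= Num.sqrt (m%:R : R).
Proof. by rewrite -[leLHS]sqrtr1 ler_sqrt ?ler0n// ler1n. Qed.

Let rho_le : rho <= 512^-1.
Proof. by have := sm_ge1; move: rho_small rho0; nra. Qed.

Let step_ok (u : R) : u <= 2 * eta -> 0 < L1 -> u <= L1^-1.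
Proof.
move=> u2 L1p; apply: le_trans u2 _.
rewrite -(@ler_pM2l _ L1)// mulfV ?lt0r_neq0//; have := etaL; lra.
Qed.

(** The normalized directions form a matrix of norm at most [sqrt m], so one round
    turns an error [e] into at most [rho (e + eta sqrt m)], which preserves the
    bound [2 rho eta sqrt m]. *)
Lemma consensus_X t : consensus_error (X t) <= eta / 256.
Proof.
suff H : consensus_error (X t) <= 2 * rho * (Num.sqrt m%:R * eta) by move: rho_small eta0; nra.
elim: t => [|t IH].
  by rewrite X0 consensus_ones// !mulr_ge0 ?sqrtr_ge0// ltW.
rewrite XS; apply: le_trans (gossip_contract _) _.
have : consensus_error (X t - eta *: normalize_rows (V t)) <=
    consensus_error (X t) + eta * Num.sqrt m%:R.
  apply: le_trans (consensusD _ _) _; rewrite lerD2l consensusN consensusZ gtr0_norm//.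
  rewrite ler_pM2l//; apply: le_trans (consensus_le_fnorm m0 _) _.
  rewrite -[leRHS]mulr1; apply: fnorm_le_rows => // i; exact: fnorm_normalize_le1.
move=> /(ler_wpM2l rho0) /le_trans; apply.
have : 0 <= Num.sqrt m%:R * eta by rewrite mulr_ge0 ?sqrtr_ge0 ?ltW.
move: (Num.sqrt m%:R) IH => s; move: rho0 rho_le => r0 r1 IH se.
have : rho * consensus_error (X t) <= rho * (2 * rho * (s * eta)) by rewrite ler_wpM2l.
have : 0 <= rho * (s * eta) by rewrite mulr_ge0.
nra.
Qed.

Lemma rowmean_V t : rowmean (V t) = rowmean (G t).
Proof.
elim: t => [//|t IH]; rewrite VS gossip_mean !rowmeanD rowmeanN IH.
by rewrite addrAC subrr add0r.
Qed.

Lemma xbarS t : xbar t.+1 = xbar t - eta *: rowmean (normalize_rows (V t)).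
Proof. by rewrite /xbar XS gossip_mean rowmeanD rowmeanN rowmeanZ. Qed.

Lemma xbar_step t : fnorm (xbar t.+1 - xbar t) <= eta.
Proof.
rewrite xbarS addrAC subrr add0r fnormN fnormZ gtr0_norm// -[leRHS]mulr1 ler_pM2l//.
by apply: fnorm_rowmean_le => // i; exact: fnorm_normalize_le1.
Qed.

Lemma row_near_mean t i : fnorm (xbar t - row i (X t)) <= eta / 256.
Proof. rewrite fnormB; apply: le_trans (row_consensus _ i) (consensus_X t). Qed.

Let Mt t := M (xbar t).

Lemma grad_near_mean t i :
  fnorm (grad (f i) (xbar t) - grad (f i) (row i (X t))) <= Mt t * (eta / 256).
Proof.
have near := row_near_mean t i.
apply: le_trans (grad_lipschitz _ _) _; last by rewrite ler_wpM2l ?modulus_ge0.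
by apply: step_ok; move: eta0; lra.
Qed.

(** Gradient tracking: the mean of [V] is that of the minibatch gradients, whose
    errors are the noise and the distance of the iterates to their mean. *)
Lemma tracking_error t :
  fnorm (grad F (xbar t) - rowmean (V t)) <= n t + Mt t * (eta / 256).
Proof.
rewrite rowmean_V.
apply: le_trans (fnormDB _ (rowmean (gradmx (X t))) _) _.
rewrite addrC fnormB lerD2l grad_average// gradmx_mean -scalerBr -sumrB.
rewrite fnormZ ger0_norm ?invr_ge0 ?ler0n// mulrC ler_pdivrMr ?ltr0n// mulr_natr.
apply: le_trans (fnorm_sum _ _ _) _.
rewrite -[leRHS](_ : \sum_(i < m) Mt t * (eta / 256) = _); last by rewrite sumr_const card_ord.
by apply: ler_sum => i _; exact: grad_near_mean.
Qed.

(** For each agent the direction is that of its row of [V], whose error is that of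
    the mean of [V] plus the deviation of the row; averaged over the agents,
    Cauchy-Schwarz bounds the deviations by [c t]. *)
Lemma descent_step t :
  F (xbar t.+1) <= F (xbar t) - eta * g t +
    eta * (2 * c t + 2 * n t + (1 + 1 / 128) * (Mt t * eta)).
Proof.
have Mge0 := modulus_ge0 (xbar t).
have step := xbar_step t.
have stepOK : 0 < L1 -> fnorm (xbar t.+1 - xbar t) <= L1^-1 by apply: step_ok; move: eta0; lra.
apply: le_trans (average_descent stepOK) _.
have sq : M (xbar t) * fnorm (xbar t.+1 - xbar t) ^+ 2 <= Mt t * eta ^+ 2.
  by rewrite ler_wpM2l// lerXn2r ?nnegrE ?fnorm_ge0// ltW.
suff prog : g t - 2 * c t - 2 * (n t + Mt t * (eta / 256)) <=
    fdot (grad F (xbar t)) (rowmean (normalize_rows (V t))).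
  have -> : xbar t.+1 - xbar t = - (eta *: rowmean (normalize_rows (V t))).
    by rewrite xbarS addrAC subrr add0r.
  rewrite fdotNr fdotZr.
  move: prog => /(ler_wpM2l (ltW eta0)); move: sq; rewrite {1}xbarS addrAC subrr add0r.
  lra.
rewrite rowmeanE fdotZr fdot_sumr -(@ler_pM2l _ m%:R) ?ltr0n// [leRHS]mulrA mulfV ?mul1r; last first.
  by rewrite pnatr_eq0 -lt0n.
apply: (@le_trans _ _ (\sum_i (g t - 2 * fnorm (grad F (xbar t) - row i (V t))))); last first.
  by apply: ler_sum => i _; rewrite rowK; exact: normalized_progress.
rewrite big_split /= sumr_const card_ord sumrN -mulr_sumr -mulr_natl.
have H : \sum_i fnorm (grad F (xbar t) - row i (V t)) <=
    m%:R * (n t + Mt t * (eta / 256)) + Num.sqrt m%:R * consensus_error (V t).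
  apply: (@le_trans _ _ (\sum_i ((n t + Mt t * (eta / 256)) + fnorm (row i (V t) - rowmean (V t))))).
    apply: ler_sum => i _; apply: le_trans (fnormDB _ (rowmean (V t)) _) _.
    by apply: lerD; [exact: tracking_error|rewrite fnormB].
  by rewrite big_split /= sumr_const card_ord -[(_ + _) *+ _]mulr_natl lerD2l; exact: sum_row_consensus.
have cE : Num.sqrt m%:R * consensus_error (V t) = m%:R * c t.
  rewrite /c -{2}[m%:R]sqr_sqrtr ?ler0n// expr2; field.
  by apply: lt0r_neq0; have := sm_ge1; lra.
move: H; rewrite cE; move: (\sum_i _) => S; lra.
Qed.

Lemma c_ge0 t : 0 <= c t.
Proof. by rewrite divr_ge0 ?sqrtr_ge0 ?fnorm_ge0. Qed.

(** The increment of the minibatch gradients is the noise of two rounds plus the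
    drift of the exact gradients, which is measured by comparing both rounds
    with the gradient at the mean iterate of the first one. *)
Lemma tracking_consensus t :
  c t.+1 <= 512^-1 * (c t + (N t + N t.+1) / m%:R + 2 * (Mt t * eta)).
Proof.
have Mge0 := modulus_ge0 (xbar t).
have sm0 : 0 < Num.sqrt (m%:R : R) by have := sm_ge1; lra.
have drift : fnorm (gradmx (X t.+1) - gradmx (X t)) <= Num.sqrt m%:R * (2 * (Mt t * eta)).
  apply: fnorm_le_rows => [|i]; first by rewrite !mulr_ge0// ltW.
  rewrite linearB /= !row_gradmx.
  apply: le_trans (fnormDB _ (grad (f i) (xbar t)) _) _.
  have near : fnorm (xbar t - row i (X t.+1)) <= eta + eta / 256.
    apply: le_trans (fnormDB _ (xbar t.+1) _) _; apply: lerD; last exact: row_near_mean.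
    by rewrite fnormB; exact: xbar_step.
  have : fnorm (grad (f i) (xbar t) - grad (f i) (row i (X t.+1))) <= Mt t * (eta + eta / 256).
    apply: le_trans (grad_lipschitz _ _) _; last by rewrite ler_wpM2l.
    by apply: step_ok; move: eta0; lra.
  rewrite fnormB => /drift_arith; apply; last exact: grad_near_mean.
  by rewrite mulr_ge0// ltW.
have dG : fnorm (G t.+1 - G t) <= N t + N t.+1 + Num.sqrt m%:R * (2 * (Mt t * eta)).
  apply: le_trans (fnormDB _ (gradmx (X t.+1)) _) _; rewrite -/(N t.+1).
  rewrite addrAC [leRHS]addrC lerD2l.
  apply: le_trans (fnormDB _ (gradmx (X t)) _) _.
  by rewrite (fnormB (gradmx (X t)) (G t)) -/(N t) [leLHS]addrC lerD2l.
have dV : consensus_error (V t.+1) <=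
    rho * (consensus_error (V t) + (N t + N t.+1 + Num.sqrt m%:R * (2 * (Mt t * eta)))).
  rewrite VS; apply: le_trans (gossip_contract _) _; rewrite ler_wpM2l//.
  rewrite -addrA; apply: le_trans (consensusD _ _) _; rewrite lerD2l.
  by apply: le_trans dG; exact: consensus_le_fnorm.
have cE s : consensus_error (V s) = Num.sqrt m%:R * c s.
  by rewrite /c mulrC divfK// lt0r_neq0.
have NE s : N s = Num.sqrt m%:R * (Num.sqrt m%:R * (N s / m%:R)).
  rewrite mulrA -expr2 sqr_sqrtr ?ler0n// mulrC divfK// pnatr_eq0 -lt0n//.
have Npos s : 0 <= N s / m%:R by rewrite divr_ge0 ?fnorm_ge0 ?ler0n.
have Mw : 0 <= Mt t * eta by rewrite mulr_ge0// ltW.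
move: dV; rewrite !cE [in X in X -> _](NE t) [in X in X -> _](NE t.+1) => dV.
rewrite [(N t + _) / _]mulrDl.
exact: (tracking_arith sm0 rho0 rho_small rho_le (c_ge0 t) (Npos t) (Npos t.+1) Mw dV).
Qed.

(** [F / eta + (2 + 1/64) c] telescopes because the consensus error enters the
    descent with weight 2 and shrinks by 512 at each round. *)
Lemma trajectory_sum T : has_lbound (range F) ->
  31 / 64 * \sum_(t < T) g t <= (F x0 - infval F) / eta + (2 + 1 / 64) * c 0%N +
    \sum_(t < T) (2 * n t + (N t + N t.+1) / m%:R / 128 + 33 / 32 * (Lf * eta)).
Proof.
move=> lbF.
suff H : F (xbar T) / eta + (2 + 1 / 64) * c T + 31 / 64 * \sum_(t < T) g t <=
    F x0 / eta + (2 + 1 / 64) * c 0%N +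
    \sum_(t < T) (2 * n t + (N t + N t.+1) / m%:R / 128 + 33 / 32 * (Lf * eta)).
  have : infval F / eta <= F (xbar T) / eta.
    by rewrite ler_pM2r ?invr_gt0//; apply: ge_inf => //; exists (xbar T).
  by have := c_ge0 T; rewrite mulrBl; lra.
elim: T => [|T IH].
  by rewrite !big_ord0 mulr0 !addr0 /xbar X0 rowmean_ones.
rewrite !big_ord_recr /=; move: IH; move: (\sum_(i < T) _) (\sum_(i < T) _) => S1 S2 IH.
apply: (potential_arith eta0 (c_ge0 T) _ _ _ (descent_step T) (tracking_consensus T) IH).
- by rewrite mulr_ge0 ?modulus_ge0// ltW.
- by rewrite mulrDl lerD2l half_arith ?fnorm_ge0.
- by rewrite divr_ge0 ?addr_ge0 ?fnorm_ge0 ?ler0n.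
Qed.

(** From the mean iterate to that of one agent: they are [eta / 256] apart, which
    costs a factor [513 / 512] and a fraction of [Lf eta]. *)
Lemma trajectory_bound i T : has_lbound (range F) ->
  \sum_(t < T) fnorm (grad F (row i (X t))) <=
  17 / 8 * ((F x0 - infval F) / eta + (2 + 1 / 64) * c 0%N +
    \sum_(t < T) (2 * n t + (N t + N t.+1) / m%:R / 128 + 17 / 16 * (Lf * eta))).
Proof.
move=> lbF; have TS := trajectory_sum T lbF.
have H : \sum_(t < T) fnorm (grad F (row i (X t))) <=
    \sum_(t < T) (513 / 512 * g t + Lf * eta / 256).
  apply: ler_sum => t _; have near := row_near_mean t i.
  have Hd : fnorm (grad F (xbar t) - grad F (row i (X t))) <= Mt t * eta / 256.
    rewrite -mulrA; apply: le_trans (average_lipschitz _) _; last by rewrite ler_wpM2l ?modulus_ge0.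
    by apply: step_ok; move: eta0; lra.
  apply: (rows_arith _ Hd).
    by have := fnormD (grad F (row i (X t)) - grad F (xbar t)) (grad F (xbar t)); rewrite subrK fnormB.
  by rewrite mulrDl lerD2l half_arith ?fnorm_ge0.
apply: le_trans H _; rewrite big_split /= -mulr_sumr.
have -> : \sum_(t < T) (2 * n t + (N t + N t.+1) / m%:R / 128 + 17 / 16 * (Lf * eta)) =
  \sum_(t < T) (2 * n t + (N t + N t.+1) / m%:R / 128 + 33 / 32 * (Lf * eta)) +
  \sum_(t < T) 1 / 32 * (Lf * eta).
  by rewrite -big_split /=; apply: eq_bigr => t _; exact: split_arith.
have -> : \sum_(t < T) Lf * eta / 256 = T%:R * (Lf * eta) / 256.
  by rewrite sumr_const card_ord -[LHS]mulr_natl mulrA.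
have -> : \sum_(t < T) 1 / 32 * (Lf * eta) = T%:R * (Lf * eta) / 32.
  by rewrite sumr_const card_ord -[LHS]mulr_natl; field.
have TL0 : 0 <= T%:R * (Lf * eta) by rewrite !mulr_ge0 ?ler0n ?Lf_ge0// ltW.
have g0 : 0 <= \sum_(t < T) g t by apply: sumr_ge0 => t _; exact: fnorm_ge0.
exact: collect_arith TL0 g0 TS.
Qed.

End Trajectory.
End Objective.

(** * Independence and frozen averaging *)

Section Independence.
Context (R : realType) (dO : measure_display) (Omega : measurableType dO).
Variable P : probability Omega R.

(** Both sides are finite measures in [B] that agree on a generating
    pi-system. *)
Lemma independent_sigma_algebra (G : set (set Omega)) (E : set Omega) :
  setI_closed G -> G setT -> G `<=` measurable -> measurable E ->
  (forall B, G B -> P (B `&` E) = (P B * P E)%E) ->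
  forall B, <<s G >> B -> P (B `&` E) = (P B * P E)%E.
Proof.
move=> GI GT Gm mE H B GB.
have PE0 : 0 <= fine (P E) by rewrite fine_ge0.
have PEf : P E \is a fin_num by rewrite fin_num_measure.
pose m1 : {measure set Omega -> \bar R} := mrestr P mE.
pose m2 : {measure set Omega -> \bar R} := mscale (NngNum PE0) P.
have m2E A : m2 A = (P A * P E)%E by rewrite /m2 /= /mscale /= fineK// muleC.
have -> : P (B `&` E) = m1 B by [].
rewrite -m2E; apply: (@g_sigma_algebra_measure_unique _ _ _ G Gm (fun=> setT)) => //.
- by apply/seteqP; split => // w _; exists 0%N.
- by move=> A GA; rewrite m2E -H.
- move=> _; apply: (@le_lt_trans _ _ (P setT)); last by rewrite probability_setT ltry.
  by apply: le_measure; rewrite ?inE ?setTI.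
Qed.

Section JointLaw.
Context (d1 d2 : measure_display) (T1 : measurableType d1) (T2 : measurableType d2).
Variables (Y : Omega -> T1) (xi : Omega -> T2) (D : probability T2 R).
Hypotheses (mY : measurable_fun setT Y) (mxi : measurable_fun setT xi).
Hypothesis law : forall C, measurable C -> P (xi @^-1` C) = D C.
Hypothesis indep : forall A C, measurable A -> measurable C ->
  P (Y @^-1` A `&` xi @^-1` C) = (P (Y @^-1` A) * P (xi @^-1` C))%E.

Let mpair : measurable_fun setT (fun w => (Y w, xi w)).
Proof. exact: measurable_fun_pair. Qed.

Let mY_mixin := isMeasurableFun.Build _ _ _ _ _ mY.
Let mY_pack : {mfun _ >-> _} := HB.pack Y mY_mixin.
Let mpair_mixin := isMeasurableFun.Build _ _ _ _ _ mpair.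
Let mpair_pack : {mfun _ >-> _} := HB.pack (fun w => (Y w, xi w)) mpair_mixin.

(** Fubini for a pair of independent variables: average over the second one
    first, the first one being frozen. *)
Lemma independent_fubini (h : T1 * T2 -> \bar R) :
  measurable_fun [set: T1 * T2] h -> (forall z, 0 <= h z)%E ->
  (\int[P]_w h (Y w, xi w) = \int[P]_w \int[D]_s h (Y w, s))%E.
Proof.
move=> mh h0.
have -> : (\int[P]_w h (Y w, xi w) = \int[distribution P mpair_pack]_z h z)%E.
  by rewrite ge0_integral_pushforward.
have E : (\int[distribution P mpair_pack]_z h z = \int[distribution P mY_pack \x D]_z h z)%E.
  apply: eq_measure_integral => A mA _; apply/esym.
  apply: product_measure_unique => // B C mB mC.
  by have := indep mB mC; rewrite law.
rewrite E fubini_tonelli1//.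
rewrite ge0_integral_pushforward//=.
- exact: measurable_fun_fubini_tonelli_F.
- by move=> x _; exact: integral_ge0.
Qed.

End JointLaw.
End Independence.

(** * What is known from a family of variables *)

Section Cylinders.
Context (R : realType) (dO : measure_display) (Omega : measurableType dO).
Context (I : choiceType) (dT : I -> measure_display).
Context (T : forall p : I, measurableType (dT p)).
Variables (P : probability Omega R) (Z : forall p : I, Omega -> T p).
Hypothesis mZ : forall p, measurable_fun setT (Z p).

(** What is known from the variables in [S] is the sigma-algebra generated by this
    pi-system.  It lives on the sample space, so the variables may take values
    in different types, without forming a product space. *)
Definition cylinders (S : pred I) : set (set Omega) :=
  [set B | exists (J : seq I) (A : forall p, set (T p)),
    [/\ uniq J, all S J, forall p, measurable (A p) &
        B = \bigcap_(p in [set` J]) (Z p @^-1` A p)]].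

Lemma cylinders_setT S : cylinders S setT.
Proof.
exists [::], (fun=> setT); split => //.
by apply/seteqP; split => // w _ p; rewrite /= in_nil.
Qed.

Lemma cylinders_setI S : setI_closed (cylinders S).
Proof.
move=> _ _ [J1 [A1 [u1 s1 m1 ->]]] [J2 [A2 [u2 s2 m2 ->]]].
exists (undup (J1 ++ J2)), (fun p => (if p \in J1 then A1 p else setT) `&`
  (if p \in J2 then A2 p else setT)); split.
- exact: undup_uniq.
- by apply/allP => p; rewrite mem_undup mem_cat => /orP[]; exact: allP.
- by move=> p; apply: measurableI; case: ifP.
apply/seteqP; split => w.
  move=> [w1 w2] p /=; rewrite mem_undup mem_cat => _; split.
    by case: ifP => // pJ; exact: w1.
  by case: ifP => // pJ; exact: w2.
move=> H; split => p /= pJ.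
  have /= := H p; rewrite mem_undup mem_cat pJ => /(_ isT)[]; by [].
have /= := H p; rewrite mem_undup mem_cat pJ orbT => /(_ isT)[]; by [].
Qed.

Lemma measurable_preimage_Z p (A : set (T p)) : measurable A -> measurable (Z p @^-1` A).
Proof. by move=> mA; rewrite -[X in measurable X]setTI; exact: mZ. Qed.

Lemma cylinders_measurable S : cylinders S `<=` measurable.
Proof.
move=> _ [J [A [_ _ mA ->]]].
by apply: fin_bigcap_measurable => // p _; exact: measurable_preimage_Z.
Qed.

Lemma measurable_cylinders (S : pred I) p : S p ->
  measurable_fun setT (Z p : g_sigma_algebraType (cylinders S) -> T p).
Proof.
move=> Sp _ A mA; rewrite setTI; apply: sub_sigma_algebra.
exists [:: p], (dfwith (fun q => [set: T q]) p A); split => //=; first by rewrite Sp.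
  move=> q; have [<-|qp] := eqVneq p q; first by rewrite dfwithin.
  by rewrite dfwithout.
apply/seteqP; split => w.
  by move=> Aw q /=; rewrite inE => /eqP ->; rewrite dfwithin.
by move=> /(_ p) /=; rewrite mem_head dfwithin; apply.
Qed.

Lemma sub_cylinders_measurable (S : pred I) d' (T' : measurableType d')
    (Y : g_sigma_algebraType (cylinders S) -> T') :
  measurable_fun setT Y -> measurable_fun setT (Y : Omega -> T').
Proof.
move=> mY _ A mA; have /= := mY measurableT A mA.
apply: smallest_sub; last exact: cylinders_measurable.
exact: sigma_algebra_measurable.
Qed.

Hypothesis indepZ : mutually_independent P Z.

Lemma cylinders_independent (S : pred I) q (C : set (T q)) B : ~~ S q -> measurable C ->
  cylinders S B -> P (B `&` Z q @^-1` C) = (P B * P (Z q @^-1` C))%E.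
Proof.
move=> Sq mC [J [A [uJ sJ mA ->]]].
have qJ : q \notin J by apply: contra Sq => /(allP sJ).
pose A' := dfwith A q C.
have A'J p : p \in J -> A' p = A p.
  by move=> pJ; rewrite /A' dfwithout//; apply: contraNneq qJ => ->.
have mA' p : measurable (A' p).
  rewrite /A'; have [<-|qp] := eqVneq q p; first by rewrite dfwithin.
  by rewrite dfwithout.
have uqJ : uniq (q :: J) by rewrite /= qJ.
have := indepZ uqJ mA'; rewrite big_cons {2}/A' dfwithin.
have -> : \bigcap_(p in [set` q :: J]) Z p @^-1` A' p =
    (\bigcap_(p in [set` J]) (Z p @^-1` A p)) `&` Z q @^-1` C.
  apply/seteqP; split => w.
    move=> H; split; last by have /= := H q; rewrite mem_head /A' dfwithin; apply.
    by move=> p /= pJ; have /= := H p; rewrite inE pJ orbT A'J//; apply.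
  move=> [H1 H2] p /=; rewrite inE => /orP[/eqP ->|pJ]; first by rewrite /A' dfwithin.
  by rewrite A'J//; exact: H1.
move=> ->; rewrite muleC; congr (_ * _)%E; rewrite indepZ//.
by apply: eq_big_seq => p pJ; rewrite A'J.
Qed.

(** Independence passes from the cylinders to the sigma-algebra they generate,
    hence to everything computed from the variables in [S], which can be frozen
    while the variable [q] is averaged. *)
Lemma fresh_fubini (S : pred I) q d1 (T1 : measurableType d1)
    (Y : g_sigma_algebraType (cylinders S) -> T1) (D : probability (T q) R)
    (h : T1 * T q -> \bar R) :
  ~~ S q -> (forall C, measurable C -> P (Z q @^-1` C) = D C) ->
  measurable_fun setT Y -> measurable_fun [set: T1 * T q] h -> (forall z, 0 <= h z)%E ->
  (\int[P]_w h (Y w, Z q w) = \int[P]_w \int[D]_s h (Y w, s))%E.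
Proof.
move=> Sq law mY mh h0; have mY' := sub_cylinders_measurable mY.
apply: (independent_fubini mY' (@mZ q) law _ mh h0) => A C mA mC.
apply: (independent_sigma_algebra (@cylinders_setI S)).
- exact: cylinders_setT.
- exact: cylinders_measurable.
- exact: measurable_preimage_Z.
- by move=> B; exact: cylinders_independent.
- by have := mY measurableT A mA; rewrite setTI.
Qed.

(** The integral over the event is that of [Y] times the indicator, a variable
    independent of [Y]; averaging the indicator first yields the probability. *)
Lemma independent_event_integral (N : Omega -> nat) (n : nat)
    (Y : g_sigma_algebraType (cylinders predT) -> \bar R) :
  measurable (N @^-1` [set n]) -> independent_of_family P Z N ->
  measurable_fun setT Y -> (forall w, 0 <= Y w)%E ->
  (\int[P]_(w in N @^-1` [set n]) Y w = P (N @^-1` [set n]) * \int[P]_w Y w)%E.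
Proof.
move=> mN indN mY Y0; pose Y' : Omega -> \bar R := Y.
have mY' : measurable_fun setT Y' := sub_cylinders_measurable mY.
set E := N @^-1` [set n]; rewrite -/E in mN.
change (\int[P]_(w in E) Y' w = P E * \int[P]_w Y' w)%E.
have Y'0 w : (0 <= Y' w)%E by exact: Y0.
have mE1 : measurable_fun setT (\1_E : Omega -> R) by exact: measurable_indic.
have H (A : set (\bar R)) (C : set R) : measurable A -> measurable C ->
    P (Y' @^-1` A `&` (\1_E : Omega -> R) @^-1` C) =
    (P (Y' @^-1` A) * P ((\1_E : Omega -> R) @^-1` C))%E.
  move=> mA mC.
  pose YA : set Omega := Y' @^-1` A.
  have key F : F = E \/ F = ~` E \/ F = setT \/ F = set0 ->
      P (YA `&` F) = (P (YA) * P F)%E.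
    have GA : <<s cylinders predT >> (YA).
      by have := mY measurableT A mA; rewrite setTI.
    have mA' : measurable YA.
      by have := mY' measurableT A mA; rewrite setTI.
    have HE : P (YA `&` E) = (P (YA) * P E)%E.
      apply: (independent_sigma_algebra (@cylinders_setI predT)) => //.
      - exact: cylinders_setT.
      - exact: cylinders_measurable.
      - move=> B [J [A' [uJ _ mA'' ->]]].
        by rewrite setIC indN// muleC.
    move=> [->//|[->|[->|->]]].
    - have -> : YA `&` ~` E = YA `\` (YA `&` E).
        by rewrite setDIr setDv set0U setDE.
      have Yfin : (P YA < +oo)%E.
        by rewrite ltey_eq fin_num_measure.
      rewrite (measureD mA' (measurableI _ _ mA' mN) Yfin).
      rewrite setIA setIid [X in (_ - X)%E]HE probability_setC//.
      by rewrite muleBr ?mule1 ?fin_num_measure// fin_num_adde_defr.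
    - by rewrite setIT probability_setT mule1.
    - by rewrite setI0 measure0 mule0.
  rewrite -/YA.
  apply: key; rewrite preimage_indic.
  by case: ifPn => _; case: ifPn => _; tauto.
pose pk : {mfun Omega >-> R} := mfun_Sub (mem_set mE1).
have pkE : (pk : Omega -> R) = \1_E by [].
pose h (z : \bar R * R) := (`|z.1| * `|z.2|%R%:E)%E.
have mh : measurable_fun [set: \bar R * R] h.
  apply: emeasurable_funM.
    by apply: measurableT_comp => //; exact: measurable_fst.
  apply/measurable_EFinP; apply: measurableT_comp => //; exact: measurable_snd.
have h0 z : (0 <= h z)%E by rewrite mule_ge0// lee_fin.
have absE w : `|(\1_E w : R)|%R = \1_E w by rewrite ger0_norm// indicE ler0n.
have := independent_fubini (D := distribution P pk) mY' mE1 (fun C _ => erefl) H mh h0.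
rewrite /h /= => H1.
transitivity (\int[P]_w (`|Y' w| * (`|\1_E w|%R)%:E))%E.
  rewrite integral_mkcond; apply: eq_integral => w _.
  rewrite patchE absE indicE gee0_abs//; case: ifP => _; rewrite ?mule1 ?mule0//.
rewrite H1.
transitivity (\int[P]_w (P E * Y' w))%E; last first.
  by rewrite ge0_integralZl.
apply: eq_integral => w _; rewrite ge0_integralZl//; last first.
  by apply/measurable_EFinP; exact: normr_measurable.
rewrite gee0_abs// muleC; congr (_ * _)%E.
rewrite ge0_integral_pushforward//=; last by apply/measurable_EFinP; exact: normr_measurable.
under eq_integral do rewrite absE.
by rewrite preimage_setT integral_indic ?setIT.
Qed.

End Cylinders.

(** * Gradient noise of a fresh sample *)

Section Oracle.
Context (R : realType) (d : nat) (dX : measure_display) (Xi : measurableType dX).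
Variables (D : probability Xi R) (sigma : R).
Variables (F : 'rV[R]_d -> Xi -> R) (g : 'rV[R]_d -> R).
Hypothesis oracle : stochastic_oracle D sigma F g.

(** The Borel sets of [R^d] are those of tuples, so random vectors are passed to
    measurable functions as tuples. *)
Definition trow (x : d.-tuple R) : 'rV[R]_d := \row_k tnth x k.
Definition vtup (v : 'rV[R]_d) : d.-tuple R := [tuple v 0 k | k < d].

Lemma vtupK : cancel vtup trow.
Proof. by move=> v; apply/rowP => k; rewrite mxE tnth_mktuple. Qed.

Definition noise (x : 'rV[R]_d) (s : Xi) : 'rV[R]_d := sgrad F x s - grad g x.

Lemma measurable_sgrad j :
  measurable_fun [set: d.-tuple R * Xi] (fun z => sgrad F (trow z.1) z.2 0 j).
Proof. by have [] := oracle. Qed.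

(** The exact gradient is an integral of the stochastic one over the sample,
    so its measurability comes from Fubini. *)
Lemma measurable_grad j : measurable_fun setT (fun x : d.-tuple R => grad g (trow x) 0 j).
Proof.
have [_ _ mean _] := oracle; have mG := measurable_sgrad j.
apply/measurable_EFinP; pose G := EFin \o (fun z : d.-tuple R * Xi => sgrad F (trow z.1) z.2 0 j).
have mEG : measurable_fun setT G by exact/measurable_EFinP.
rewrite (_ : _ \o _ = (fun x => (\int[D]_s G^\+ (x, s) - \int[D]_s G^\- (x, s))%E)).
  apply: emeasurable_funB.
    by apply: (@measurable_fun_fubini_tonelli_F _ _ _ _ _ D) => //; exact: measurable_funepos.
  by apply: (@measurable_fun_fubini_tonelli_F _ _ _ _ _ D) => //; exact: measurable_funeneg.
apply/funext => x /=; have [_ <-] := mean (trow x) j.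
by rewrite unlock integralE; congr (_ - _)%E; apply: eq_integral => s _; rewrite ?funeposE ?funenegE.
Qed.

Lemma measurable_noise j :
  measurable_fun [set: d.-tuple R * Xi] (fun z => noise (trow z.1) z.2 0 j).
Proof.
rewrite (_ : (fun z : d.-tuple R * Xi => _) =
  (fun z => sgrad F (trow z.1) z.2 0 j - grad g (trow z.1) 0 j)).
  apply: measurable_funB; first exact: measurable_sgrad.
  exact: measurableT_comp (measurable_grad j) (measurable_fst).
by apply/funext => z; rewrite !mxE.
Qed.

Lemma integrable_noise x j : D.-integrable setT (fun s => (noise x s 0 j)%:E).
Proof.
have [_ _ mean _] := oracle; have [iF _] := mean x j.
rewrite (_ : (fun s => _) = (fun s => (sgrad F x s 0 j)%:E - (grad g x 0 j)%:E)%E).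
  by apply: integrableB => //; apply: finite_measure_integrable_cst.
by apply/funext => s; rewrite !mxE.
Qed.

Lemma integral_noise x j : (\int[D]_s (noise x s 0 j)%:E = 0)%E.
Proof.
have [_ _ mean _] := oracle; have [iF EF] := mean x j.
rewrite (eq_integral (fun s => (sgrad F x s 0 j)%:E - (grad g x 0 j)%:E)%E); last first.
  by move=> s _; rewrite !mxE.
rewrite integralB//; last exact: finite_measure_integrable_cst.
move: EF; rewrite unlock => ->; rewrite integral_cst//.
rewrite [X in (_ * X)%E](_ : _ = 1%E); last exact: probability_setT.
rewrite mule1.
by rewrite subee.
Qed.

Lemma measurable_noise_sqr :
  measurable_fun [set: d.-tuple R * Xi] (fun z => fnorm (noise (trow z.1) z.2) ^+ 2).
Proof.
under eq_fun do rewrite fnorm_sqr_rV.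
by apply: measurable_sum => j; apply: measurable_funX; exact: measurable_noise.
Qed.

Lemma integral_noise_sqr x : (\int[D]_s (fnorm (noise x s) ^+ 2)%:E <= (sigma ^+ 2)%:E)%E.
Proof. by have [_ _ _ /(_ x)] := oracle; rewrite unlock. Qed.

End Oracle.

Section FreshNoise.
Context (R : realType) (d : nat) (dO : measure_display) (Omega : measurableType dO).
Context (I : choiceType) (dT : I -> measure_display) (T : forall p : I, measurableType (dT p)).
Variables (P : probability Omega R) (Z : forall p : I, Omega -> T p).
Hypothesis mZ : forall p, measurable_fun setT (Z p).
Hypothesis indepZ : mutually_independent P Z.
Variables (S : pred I) (q : I) (D : probability (T q) R) (sigma : R).
Variables (F : 'rV[R]_d -> T q -> R) (g : 'rV[R]_d -> R).
Hypothesis oracle : stochastic_oracle D sigma F g.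
Hypothesis fresh : ~~ S q.
Hypothesis law : forall C, measurable C -> P (Z q @^-1` C) = D C.
Variable X : Omega -> 'rV[R]_d.
Hypothesis mX : forall j,
  measurable_fun setT ((fun w => X w 0 j) : g_sigma_algebraType (cylinders Z S) -> R).

Let mXt : measurable_fun setT
  ((fun w => vtup (X w)) : g_sigma_algebraType (cylinders Z S) -> d.-tuple R).
Proof.
apply/measurable_fun_tnthP => j.
rewrite (_ : _ \o _ = fun w => X w 0 j); first exact: mX.
by apply/funext => w /=; rewrite tnth_mktuple.
Qed.

Lemma measurable_fresh_noise j : measurable_fun setT (fun w => noise F g (X w) (Z q w) 0 j).
Proof.
have mY : measurable_fun setT (fun w : Omega => vtup (X w)) := sub_cylinders_measurable mZ mXt.
have := measurableT_comp (measurable_noise oracle j) (measurable_fun_pair mY (@mZ q)).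
rewrite (_ : _ \o _ = fun w => noise F g (X w) (Z q w) 0 j)//.
by apply/funext => w /=; rewrite vtupK.
Qed.

Lemma fresh_noise_second_moment :
  (\int[P]_w (fnorm (noise F g (X w) (Z q w)) ^+ 2)%:E <= (sigma ^+ 2)%:E)%E.
Proof.
pose h (z : d.-tuple R * T q) := (fnorm (noise F g (trow z.1) z.2) ^+ 2)%:E.
have mh : measurable_fun [set: d.-tuple R * T q] h.
  by apply/measurable_EFinP; exact: measurable_noise_sqr oracle.
have h0 z : (0 <= h z)%E by rewrite lee_fin sqr_ge0.
have := fresh_fubini mZ indepZ fresh law mXt mh h0.
rewrite /h /= (eq_integral (fun w => (fnorm (noise F g (X w) (Z q w)) ^+ 2)%:E)); last first.
  by move=> w _; rewrite vtupK.
move=> ->.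
have mI : measurable_fun setT (fun w : Omega => \int[D]_s h (vtup (X w), s))%E.
  have mF := @measurable_fun_fubini_tonelli_F _ _ _ _ _ D h mh h0.
  exact: (measurableT_comp mF (sub_cylinders_measurable mZ mXt)).
apply: (@le_trans _ _ (\int[P]_w (sigma ^+ 2)%:E)%E).
  apply: ge0_le_integral => //.
  - by move=> w _; apply: integral_ge0 => s _; exact: (h0 (vtup (X w), s)).
  - by move=> w _; exact: (integral_noise_sqr oracle).
by rewrite integral_cst// [X in (_ * X)%E](_ : _ = 1%E) ?mule1//; exact: probability_setT.
Qed.

(** For a frozen past the integrand has mean 0, so its positive and negative parts
    have equal integrals; Fubini for nonnegative functions then applies to each
    part. *)
Lemma fresh_noise_orthogonal (U : Omega -> R) j :
  measurable_fun setT (U : g_sigma_algebraType (cylinders Z S) -> R) ->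
  P.-integrable setT (fun w => (U w * noise F g (X w) (Z q w) 0 j)%:E) ->
  (\int[P]_w (U w * noise F g (X w) (Z q w) 0 j)%:E = 0)%E.
Proof.
move=> mU iU.
pose h (z : (R * d.-tuple R) * T q) : \bar R := (z.1.1 * noise F g (trow z.1.2) z.2 0 j)%:E.
have mh : measurable_fun [set: (R * d.-tuple R) * T q] h.
  apply/measurable_EFinP; apply: measurable_funM.
    exact: measurableT_comp measurable_fst measurable_fst.
  apply: (measurableT_comp (measurable_noise oracle j) (f := fun z : d.-tuple R * T q => noise F g (trow z.1) z.2 0 j) (g := fun z : (R * d.-tuple R) * T q => (z.1.2, z.2))).
  apply: measurable_fun_pair; last exact: measurable_snd.
  exact: measurableT_comp measurable_snd measurable_fst.
have mY : measurable_fun setT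
    ((fun w => (U w, vtup (X w))) : g_sigma_algebraType (cylinders Z S) -> R * d.-tuple R).
  exact: measurable_fun_pair.
have hE w : h ((U w, vtup (X w)), Z q w) = (U w * noise F g (X w) (Z q w) 0 j)%:E.
  by rewrite /h /= vtupK.
have zint z : D.-integrable setT (fun s => h (z, s)).
  exact: (integrableZl measurableT z.1 (integrable_noise oracle (trow z.2) j)).
have z0 z : (\int[D]_s h (z, s) = 0)%E.
  rewrite /h /=; under eq_integral do rewrite EFinM.
  by rewrite integralZl ?(integral_noise oracle) ?mule0//; exact: integrable_noise oracle _ _.
have eq_pn z : (\int[D]_s h^\+ (z, s) = \int[D]_s h^\- (z, s))%E.
  have hp : (\int[D]_s h^\+ (z, s) = \int[D]_s (fun s => h (z, s))^\+ s)%E.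
    by apply: eq_integral => s _; rewrite !funeposE.
  have hn : (\int[D]_s h^\- (z, s) = \int[D]_s (fun s => h (z, s))^\- s)%E.
    by apply: eq_integral => s _; rewrite !funenegE.
  rewrite hp hn; have := z0 z; rewrite integralE => /eqP.
  rewrite sube_eq ?add0e => [/eqP//| |].
    exact: integrable_pos_fin_num.
  by rewrite fin_num_adde_defl// integrable_neg_fin_num.
have Hp : (\int[P]_w h^\+ ((U w, vtup (X w)), Z q w) = \int[P]_w h^\- ((U w, vtup (X w)), Z q w))%E.
  rewrite (fresh_fubini mZ indepZ fresh law mY (measurable_funepos mh))//.
  rewrite (fresh_fubini mZ indepZ fresh law mY (measurable_funeneg mh))//.
  by apply: eq_integral => w _; exact: eq_pn.
under eq_integral do rewrite -hE.
rewrite integralE.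
rewrite [X in (X - _)%E](_ : _ = \int[P]_w h^\+ ((U w, vtup (X w)), Z q w))%E; last first.
  by apply: eq_integral => w _; rewrite !funeposE.
rewrite [X in (_ - X)%E](_ : _ = \int[P]_w h^\- ((U w, vtup (X w)), Z q w))%E; last first.
  by apply: eq_integral => w _; rewrite !funenegE.
rewrite -Hp subee//.
have := integrable_pos_fin_num measurableT iU.
rewrite (_ : (\int[P]_w _ = \int[P]_w h^\+ ((U w, vtup (X w)), Z q w))%E)//.
by apply: eq_integral => w _; rewrite !funeposE hE.
Qed.

End FreshNoise.

(** * Second moments of orthogonal noises *)

Section SecondMoment.
Context (R : realType) (dO : measure_display) (Omega : measurableType dO).
Variable P : probability Omega R.

Lemma integral_cstP (r : R) : (\int[P]_w r%:E = r%:E)%E.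
Proof.
rewrite integral_cst// [X in (_ * X)%E](_ : _ = 1%E) ?mule1//; exact: probability_setT.
Qed.

Lemma ge0_integrable (Y : Omega -> R) (c : R) : measurable_fun setT Y -> (forall w, 0 <= Y w) ->
  (\int[P]_w (Y w)%:E <= c%:E)%E -> P.-integrable setT (EFin \o Y).
Proof.
move=> mY Y0 Yc; apply/integrableP; split; first exact/measurable_EFinP.
apply: le_lt_trans (ltry c); apply: le_trans Yc.
by under eq_integral => w _ do rewrite /= ger0_norm ?Y0//.
Qed.

(** Jensen for the square, by [Y <= Y ^ 2 / (2 c) + c / 2]. *)
Lemma first_moment_le (Y : Omega -> R) (c : R) : 0 < c ->
  measurable_fun setT Y -> (forall w, 0 <= Y w) ->
  (\int[P]_w (Y w ^+ 2)%:E <= (c ^+ 2)%:E)%E -> (\int[P]_w (Y w)%:E <= c%:E)%E.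
Proof.
move=> c0 mY Y0 Y2.
have mY2 : measurable_fun setT (fun w => Y w ^+ 2) by exact: measurable_funX.
apply: (@le_trans _ _ (\int[P]_w ((2 * c)^-1%:E * (Y w ^+ 2)%:E + (c / 2)%:E))%E).
  apply: ge0_le_integral => //.
  - by move=> w _; rewrite lee_fin.
  - exact/measurable_EFinP.
  - apply: emeasurable_funD => //; apply: measurable_funeM; exact/measurable_EFinP.
  - move=> w _; rewrite -EFinM -EFinD lee_fin -subr_ge0.
    have -> : (2 * c)^-1 * Y w ^+ 2 + c / 2 - Y w = (2 * c)^-1 * (Y w - c) ^+ 2.
      by field; exact: lt0r_neq0.
    by rewrite mulr_ge0 ?sqr_ge0// invr_ge0; lra.
rewrite ge0_integralD//.
- rewrite integral_cstP ge0_integralZl//.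
  + apply: (@le_trans _ _ ((2 * c)^-1%:E * (c ^+ 2)%:E + (c / 2)%:E)%E).
      by rewrite leeD2r// lee_wpmul2l// lee_fin invr_ge0; lra.
    rewrite -EFinM -EFinD lee_fin le_eqVlt; apply/orP; left; apply/eqP; field.
    exact: lt0r_neq0.
  + exact/measurable_EFinP.
  + by move=> w _; rewrite lee_fin sqr_ge0.
  + by rewrite lee_fin invr_ge0; lra.
- by move=> w _; rewrite mule_ge0// lee_fin ?sqr_ge0// invr_ge0; lra.
- by apply: measurable_funeM; exact/measurable_EFinP.
- by move=> w _; rewrite lee_fin; lra.
Qed.

Context (d : nat) (J : finType) (delta : J -> Omega -> 'rV[R]_d) (sigma : R).
Hypothesis mdelta : forall q j, measurable_fun setT (fun w => delta q w 0 j).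
Hypothesis delta2 : forall q, (\int[P]_w (fnorm (delta q w) ^+ 2)%:E <= (sigma ^+ 2)%:E)%E.
Hypothesis ortho : forall q q' j, q != q' ->
  P.-integrable setT (fun w => (delta q w 0 j * delta q' w 0 j)%:E) ->
  (\int[P]_w (delta q w 0 j * delta q' w 0 j)%:E = 0)%E.

Let msqr q : measurable_fun setT (fun w => fnorm (delta q w) ^+ 2).
Proof.
under eq_fun do rewrite fnorm_sqr_rV.
by apply: measurable_sum => j; exact: measurable_funX.
Qed.

Let isqr q : P.-integrable setT (fun w => (fnorm (delta q w) ^+ 2)%:E).
Proof.
exact: (ge0_integrable (msqr q) (fun w => sqr_ge0 _) (@delta2 q)).
Qed.

Let coord_le q w j : delta q w 0 j ^+ 2 <= fnorm (delta q w) ^+ 2.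
Proof.
rewrite fnorm_sqr_rV (bigD1 j)//= lerDl; apply: sumr_ge0 => k _; exact: sqr_ge0.
Qed.

Let iprod q q' j : P.-integrable setT (fun w => (delta q w 0 j * delta q' w 0 j)%:E).
Proof.
apply: (@le_integrable _ _ _ P _ measurableT _
  (fun w => (fnorm (delta q w) ^+ 2)%:E + (fnorm (delta q' w) ^+ 2)%:E)%E).
- by apply/measurable_EFinP; exact: measurable_funM.
- move=> w _; rewrite -EFinD /= !lee_fin [leRHS]ger0_norm ?addr_ge0 ?sqr_ge0//.
  apply: le_trans (lerD (coord_le q w j) (coord_le q' w j)).
  move: (delta q w 0 j) (delta q' w 0 j) => x y.
  by rewrite ler_norml; apply/andP; split; have := sqr_ge0 (x + y); have := sqr_ge0 (x - y); nra.
- exact: integrableD.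
Qed.

(** The square is expanded coordinate by coordinate; the integrals of the cross
    terms are 0 by orthogonality. *)
Lemma second_moment_sum (a : J -> R) :
  (\int[P]_w (fnorm (\sum_q a q *: delta q w) ^+ 2)%:E <=
    (\sum_q a q ^+ 2 * sigma ^+ 2)%:E)%E.
Proof.
pose F (k : 'I_d * (J * J)) w :=
  ((a k.2.1 * a k.2.2)%:E * (delta k.2.1 w 0 k.1 * delta k.2.2 w 0 k.1)%:E)%E.
have iF k : P.-integrable setT (F k) by exact: integrableZl.
have FE w : (fnorm (\sum_q a q *: delta q w) ^+ 2)%:E = (\sum_k F k w)%E.
  rewrite fnorm_sqr /fdot big_ord1.
  rewrite (eq_bigr (fun j => \sum_(q : J * J) a q.1 * a q.2 * (delta q.1 w 0 j * delta q.2 w 0 j))); last first.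
    move=> j _; rewrite summxE big_distrlr pair_big /=.
    by apply: eq_bigr => q _; rewrite !mxE; ring.
  rewrite pair_big /= -sumEFin; apply: eq_bigr => k _; by rewrite /F EFinM.
under eq_integral do rewrite FE.
rewrite integral_sum//.
have -> : (\sum_k \int[P]_w F k w = \sum_(k : 'I_d * J) \int[P]_w ((a k.2 ^+ 2)%:E * (delta k.2 w 0 k.1 ^+ 2)%:E))%E.
  rewrite -(pair_big predT predT (fun j q => \int[P]_w F (j, q) w)%E) /=.
  rewrite -(pair_big predT predT (fun j q => \int[P]_w ((a q ^+ 2)%:E * (delta q w 0 j ^+ 2)%:E))%E) /=.
  apply: eq_bigr => j _.
  rewrite -(pair_big predT predT (fun q q' => \int[P]_w F (j, (q, q')) w)%E) /=.
  apply: eq_bigr => q _; rewrite (bigD1 q)//= big1 ?adde0 => [|q' q'q].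
    by apply: eq_integral => w _; rewrite /F /= !expr2.
  by rewrite /F /= integralZl// ortho ?mule0// eq_sym.
rewrite -(pair_big predT predT (fun j q => \int[P]_w ((a q ^+ 2)%:E * (delta q w 0 j ^+ 2)%:E))%E) /=.
rewrite exchange_big /= -sumEFin; apply: lee_sum => q _.
have i2 j : P.-integrable setT (fun w => (delta q w 0 j ^+ 2)%:E).
  by under eq_fun do rewrite expr2; exact: iprod.
rewrite (eq_bigr (fun j => (a q ^+ 2)%:E * \int[P]_w (delta q w 0 j ^+ 2)%:E)%E); last first.
  by move=> j _; rewrite integralZl.
rewrite -ge0_sume_distrr; last first.
  by move=> j _; apply: integral_ge0 => w _; rewrite lee_fin sqr_ge0.
rewrite [(_ * sigma ^+ 2)%:E]EFinM lee_wpmul2l ?lee_fin ?sqr_ge0//.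
rewrite -integral_sum//; apply: le_trans (@delta2 q).
by under [leRHS]eq_integral do rewrite fnorm_sqr_rV -sumEFin.
Qed.

End SecondMoment.

(** * Measurability of the iterates *)

Section RandomMatrix.
Context (R : realType) (dO : measure_display) (Omega : measurableType dO).

Definition measurable_mx p q (A : Omega -> 'M[R]_(p, q)) : Prop :=
  forall i j, measurable_fun setT (fun w => A w i j).

Lemma measurable_mx_cst p q (A : 'M[R]_(p, q)) : measurable_mx (fun=> A).
Proof. by move=> i j; exact: measurable_cst. Qed.

Lemma measurable_mxD p q (A B : Omega -> 'M[R]_(p, q)) :
  measurable_mx A -> measurable_mx B -> measurable_mx (fun w => A w + B w).
Proof.
move=> mA mB i j; under eq_fun do rewrite mxE; exact: measurable_funD.
Qed.

Lemma measurable_mxZ p q (a : R) (A : Omega -> 'M[R]_(p, q)) :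
  measurable_mx A -> measurable_mx (fun w => a *: A w).
Proof. by move=> mA i j; under eq_fun do rewrite mxE; exact: measurable_funM. Qed.

Lemma measurable_mxN p q (A : Omega -> 'M[R]_(p, q)) :
  measurable_mx A -> measurable_mx (fun w => - A w).
Proof.
move=> mA; under eq_fun do rewrite -scaleN1r; exact: measurable_mxZ.
Qed.

Lemma measurable_mulmx p q s (W : 'M[R]_(p, q)) (A : Omega -> 'M[R]_(q, s)) :
  measurable_mx A -> measurable_mx (fun w => W *m A w).
Proof.
move=> mA i j; under eq_fun do rewrite mxE.
by apply: measurable_sum => k; exact: measurable_funM.
Qed.

Lemma measurable_AccGossip m d (W : 'M[R]_m) K (Y : Omega -> 'M[R]_(m, d)) :
  measurable_mx Y -> measurable_mx (fun w => AccGossip (Y w) W K).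
Proof.
move=> mY; rewrite /AccGossip; set step := fun Z : 'M[R]_(m, d) * 'M[R]_(m, d) => _.
suff [] : measurable_mx (fun w => (iter K step (Y w, Y w)).1) /\
  measurable_mx (fun w => (iter K step (Y w, Y w)).2) by [].
elim: K => [//|K [IH1 IH2]]; split => //=.
apply: measurable_mxD; first by apply: measurable_mxZ; exact: measurable_mulmx.
by apply: measurable_mxN; exact: measurable_mxZ.
Qed.

Lemma measurable_sqrt : measurable_fun setT (@Num.sqrt R).
Proof. by apply: continuous_measurable_fun; exact: sqrt_continuous. Qed.

Lemma measurable_fnorm p q (A : Omega -> 'M[R]_(p, q)) :
  measurable_mx A -> measurable_fun setT (fun w => fnorm (A w)).
Proof.
move=> mA; apply: (measurableT_comp measurable_sqrt).
by apply: measurable_sum => i; apply: measurable_sum => j; exact: measurable_funX.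
Qed.

Lemma measurable_row p q (A : Omega -> 'M[R]_(p, q)) i :
  measurable_mx A -> measurable_mx (fun w => row i (A w)).
Proof. by move=> mA k j; under eq_fun do rewrite mxE; exact: mA. Qed.

(** The inverse is the power of exponent -1, also at 0, where both are 0. *)
Lemma measurable_invr_ge0 (Y : Omega -> R) : (forall w, 0 <= Y w) ->
  measurable_fun setT Y -> measurable_fun setT (fun w => (Y w)^-1).
Proof.
move=> Y0 mY; under eq_fun => w do rewrite -powR_inv1 ?Y0//.
exact: (@measurableT_comp _ _ _ _ _ _ (@powR R ^~ (-1))).
Qed.

Lemma measurable_normalize m d (V : Omega -> 'M[R]_(m, d)) :
  measurable_mx V -> measurable_mx (fun w => normalize_rows (V w)).
Proof.
move=> mV i j; under eq_fun do rewrite !mxE.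
apply: measurable_funM; last exact: mV.
apply: measurable_invr_ge0 => [w|]; first exact: fnorm_ge0.
exact: (measurable_fnorm (measurable_row i mV)).
Qed.

Lemma measurable_consensus m d (V : Omega -> 'M[R]_(m, d)) :
  measurable_mx V -> measurable_fun setT (fun w => consensus_error (V w)).
Proof.
move=> mV; apply: measurable_fnorm; apply: measurable_mxD => //.
apply: measurable_mxN; apply: measurable_mulmx; apply: measurable_mxZ.
exact: measurable_mulmx.
Qed.

Lemma measurable_vtup d (X : Omega -> 'rV[R]_d) :
  measurable_mx X -> measurable_fun setT (fun w => vtup (X w)).
Proof.
move=> mX; apply/measurable_fun_tnthP => j.
rewrite (_ : _ \o _ = fun w => X w 0 j); first exact: mX.
by apply/funext => w /=; rewrite tnth_mktuple.
Qed.

Context (m d b : nat) (dX : 'I_m -> measure_display).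
Context (Xi : forall i, measurableType (dX i)).
Variables (D : forall i, probability (Xi i) R) (sigma : R).
Variables (F : forall i, 'rV[R]_d -> Xi i -> R) (f : 'I_m -> 'rV[R]_d -> R).
Hypothesis oracle : forall i, stochastic_oracle (D i) sigma (@F i) (f i).

Lemma measurable_minibatch (X : Omega -> 'M[R]_(m, d))
    (s : Omega -> forall i : 'I_m, 'I_b -> Xi i) :
  measurable_mx X -> (forall i k, measurable_fun setT (fun w => s w i k)) ->
  measurable_mx (fun w => minibatch_grad F (X w) (s w)).
Proof.
move=> mX ms i j; under eq_fun do rewrite !mxE summxE.
apply: measurable_funM => //; apply: measurable_sum => k.
have := measurableT_comp (measurable_sgrad (oracle i) j)
  (measurable_fun_pair (measurable_vtup (measurable_row i mX)) (ms i k)).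
rewrite (_ : _ \o _ = fun w => sgrad (@F i) (row i (X w)) (s w i k) 0 j)//.
by apply/funext => w /=; rewrite vtupK.
Qed.

Lemma measurable_gradmx_row (X : Omega -> 'rV[R]_d) i :
  measurable_mx X -> measurable_mx (fun w => grad (f i) (X w)).
Proof.
move=> mX k j; rewrite (ord1 k).
have := measurableT_comp (measurable_grad (oracle i) j) (measurable_vtup mX).
rewrite (_ : _ \o _ = fun w => grad (f i) (X w) 0 j)//.
by apply/funext => w /=; rewrite vtupK.
Qed.

Variables (W : 'M[R]_m) (x0 : 'rV[R]_d) (eta : R) (Khat K : nat).
Variable s : Omega -> nat -> forall i : 'I_m, 'I_b -> Xi i.

Lemma measurable_dnsgd t :
  (forall t' i k, (t' < t)%N -> measurable_fun setT (fun w => s w t' i k)) ->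
  measurable_mx (fun w => (dnsgd F W x0 eta Khat K (s w) t).1) /\
  ((forall i k, measurable_fun setT (fun w => s w t i k)) ->
   measurable_mx (fun w => (dnsgd F W x0 eta Khat K (s w) t).2)).
Proof.
elim: t => [|t IH] ms /=.
  split=> [|ms0]; first exact: measurable_mx_cst.
  by apply: measurable_AccGossip; apply: measurable_minibatch => //; exact: measurable_mx_cst.
have [mX mV] := IH (fun t' i k tt' => ms t' i k (ltnW tt')).
have mst i k := ms t i k (ltnSn t).
have mX' : measurable_mx (fun w => AccGossip
    ((dnsgd F W x0 eta Khat K (s w) t).1 -
     eta *: normalize_rows (dnsgd F W x0 eta Khat K (s w) t).2) W K).
  apply: measurable_AccGossip; apply: measurable_mxD => //; apply: measurable_mxN.
  by apply: measurable_mxZ; apply: measurable_normalize; exact: mV.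
split=> [//|mst1].
apply: measurable_AccGossip; apply: measurable_mxD.
  by apply: measurable_mxD; [exact: mV|exact: measurable_minibatch].
by apply: measurable_mxN; exact: measurable_minibatch.
Qed.

End RandomMatrix.

(** * Expected noise and expected output *)

Section MeanBound.
Context (R : realType) (dO : measure_display) (Omega : measurableType dO).
Variable P : probability Omega R.

(** Bundling measurability and nonnegativity with the bound makes bounds on
    expectations stable under sums and nonnegative multiples. *)
Definition mean_le (Y : Omega -> R) (c : R) : Prop :=
  [/\ measurable_fun setT Y, forall w, 0 <= Y w & (\int[P]_w (Y w)%:E <= c%:E)%E].

Lemma mean_le_cst c : 0 <= c -> mean_le (fun=> c) c.
Proof. by move=> c0; split => //; rewrite integral_cstP. Qed.

Lemma mean_leD Y Z c e : mean_le Y c -> mean_le Z e -> mean_le (fun w => Y w + Z w) (c + e).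
Proof.
move=> [mY Y0 Yc] [mZ Z0 Ze]; split.
- exact: measurable_funD.
- by move=> w; rewrite addr_ge0.
under eq_integral do rewrite EFinD.
rewrite ge0_integralD//; first by rewrite EFinD leeD.
all: by [exact/measurable_EFinP|move=> w _; rewrite lee_fin].
Qed.

Lemma mean_leZ a Y c : 0 <= a -> mean_le Y c -> mean_le (fun w => a * Y w) (a * c).
Proof.
move=> a0 [mY Y0 Yc]; split.
- exact: measurable_funM.
- by move=> w; rewrite mulr_ge0.
under eq_integral do rewrite EFinM.
rewrite ge0_integralZl//; first by rewrite EFinM lee_wpmul2l.
all: by [exact/measurable_EFinP|move=> w _; rewrite lee_fin].
Qed.

Lemma mean_le_sum (I : Type) (r : seq I) (Y : I -> Omega -> R) c :
  (forall t, mean_le (Y t) (c t)) ->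
  mean_le (fun w => \sum_(t <- r) Y t w) (\sum_(t <- r) c t).
Proof.
move=> H; elim: r => [|t r IH].
  under eq_fun do rewrite big_nil.
  by rewrite big_nil; exact: mean_le_cst.
under eq_fun do rewrite big_cons.
by rewrite big_cons; exact: mean_leD.
Qed.

Lemma mean_leW Y c e : c <= e -> mean_le Y c -> mean_le Y e.
Proof. by move=> ce [mY Y0 Yc]; split => //; apply: le_trans Yc _; rewrite lee_fin. Qed.

Lemma mean_le_dom (Y Z : Omega -> R) c : measurable_fun setT Y -> (forall w, 0 <= Y w <= Z w) ->
  mean_le Z c -> mean_le Y c.
Proof.
move=> mY YZ [mZ Z0 Zc]; split => // [w|]; first by have /andP[] := YZ w.
apply: le_trans Zc; apply: ge0_le_integral => //.
- by move=> w _; rewrite lee_fin; have /andP[] := YZ w.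
- exact/measurable_EFinP.
- exact/measurable_EFinP.
- by move=> w _; rewrite lee_fin; have /andP[] := YZ w.
Qed.

Lemma mean_le_sqr (Y : Omega -> R) c : 0 < c -> measurable_fun setT Y -> (forall w, 0 <= Y w) ->
  mean_le (fun w => Y w ^+ 2) (c ^+ 2) -> mean_le Y c.
Proof. by move=> c0 mY Y0 [_ _ H]; split => //; exact: first_moment_le. Qed.

End MeanBound.

Section Sampling.
Context (R : realType) (m d b T : nat) (sigma : R).
Context (dX : 'I_m -> measure_display) (Xi : forall i, measurableType (dX i)).
Variables (D : forall i, probability (Xi i) R).
Variables (F : forall i, 'rV[R]_d -> Xi i -> R) (f : 'I_m -> 'rV[R]_d -> R).
Context (dO : measure_display) (Omega : measurableType dO) (P : probability Omega R).
Variables (xi : nat -> forall i : 'I_m, 'I_b -> {RV P >-> Xi i}).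
Variable tau : 'I_m -> {RV P >-> nat}.
Variables (W : 'M[R]_m) (x0 : 'rV[R]_d) (eta : R) (Khat K : nat).
Hypotheses (m0 : (0 < m)%N) (b0 : (0 < b)%N) (sigma0 : 0 < sigma).
Hypothesis oracle : forall i, stochastic_oracle (D i) sigma (@F i) (f i).
Hypothesis sampling : dnsgd_sampling T D xi tau.

Let I : choiceType := (nat * 'I_m * 'I_b)%type.
Let Z (p : I) : Omega -> Xi p.1.2 := xi p.1.1 p.1.2 p.2.

Let mZ (p : I) : measurable_fun setT (Z p).
Proof. exact: measurable_funP. Qed.

Let indepZ : mutually_independent P Z.
Proof. by have [] := sampling. Qed.

Let lawZ (p : I) (C : set (Xi p.1.2)) : measurable C -> P (Z p @^-1` C) = D p.1.2 C.
Proof. by have [law _ _ _] := sampling; exact: law. Qed.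

Let XV t w := dnsgd F W x0 eta Khat K (fun t i k => xi t i k w) t.
Let X t w := (XV t w).1.
Let V t w := (XV t w).2.
Let G t w := minibatch_grad F (X t w) (fun i k => xi t i k w).

Let past t : pred I := fun p => (p.1.1 < t)%N.

Let measurable_Z_on (S : pred I) t i k : S (t, i, k) ->
  measurable_fun setT (xi t i k : g_sigma_algebraType (cylinders Z S) -> Xi i).
Proof. by move=> Sp; exact: (measurable_cylinders (Z := Z) Sp). Qed.

Let measurable_X_on (S : pred I) t : {subset past t <= S} ->
  measurable_mx (X t : g_sigma_algebraType (cylinders Z S) -> 'M[R]_(m, d)).
Proof.
move=> pS.
have [] := @measurable_dnsgd _ _ (g_sigma_algebraType (cylinders Z S)) _ _ _ _ _ _ _ _ _ oracle W x0 eta Khat K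
  (fun w t i k => xi t i k w) t => //.
by move=> t' i k t't; apply: measurable_Z_on; exact: pS.
Qed.

Let measurable_XV t : measurable_mx (X t) /\ measurable_mx (V t).
Proof.
have mxi t' i k : measurable_fun setT (xi t' i k) by exact: measurable_funP.
have [mX mV] := measurable_dnsgd oracle W x0 eta Khat K
  (s := fun w t i k => xi t i k w) (t := t) (fun t' i k _ => mxi t' i k).
by split => //; exact: mV.
Qed.

Let J : finType := ('I_m * 'I_b)%type.
Let delta t (q : J) w : 'rV[R]_d := noise (@F q.1) (f q.1) (row q.1 (X t w)) (xi t q.1 q.2 w).

Let fresh_past t (q : J) : ~~ past t (t, q.1, q.2).
Proof. by rewrite /past /= ltnn. Qed.

Let measurable_delta t q j : measurable_fun setT (fun w => delta t q w 0 j).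
Proof.
have mX : forall j, measurable_fun setT
    ((fun w => row q.1 (X t w) 0 j) : g_sigma_algebraType (cylinders Z (past t)) -> R).
  move=> k; exact: (measurable_row q.1 (measurable_X_on (S := past t) (fun p h => h))).
exact: (measurable_fresh_noise (q := (t, q.1, q.2)) mZ (oracle q.1) mX).
Qed.

Let delta_second t q : (\int[P]_w (fnorm (delta t q w) ^+ 2)%:E <= (sigma ^+ 2)%:E)%E.
Proof.
have mX : forall j, measurable_fun setT
    ((fun w => row q.1 (X t w) 0 j) : g_sigma_algebraType (cylinders Z (past t)) -> R).
  move=> k; exact: (measurable_row q.1 (measurable_X_on (S := past t) (fun p h => h))).
apply: (fresh_noise_second_moment (q := (t, q.1, q.2)) mZ indepZ (oracle q.1) (fresh_past t q) _ mX).
exact: (@lawZ (t, q.1, q.2)).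
Qed.

(** The noise of [q] is computed from the past and the sample of [q], for which
    the sample of [q'] is fresh. *)
Let delta_ortho t q q' j : q != q' ->
  P.-integrable setT (fun w => (delta t q w 0 j * delta t q' w 0 j)%:E) ->
  (\int[P]_w (delta t q w 0 j * delta t q' w 0 j)%:E = 0)%E.
Proof.
move=> qq'.
pose S : pred I := fun p => past t p || (p == (t, q.1, q.2)).
have mXS : measurable_mx (X t : g_sigma_algebraType (cylinders Z S) -> 'M[R]_(m, d)).
  by apply: measurable_X_on => p pp; apply/orP; left.
have fresh : ~~ S (t, q'.1, q'.2).
  rewrite /S negb_or fresh_past/=; apply: contra qq' => /eqP[].
  by case: q q' {mXS S} => [i k] [i' k'] /= -> ->.
have mU : measurable_fun setT
    ((fun w => delta t q w 0 j) : g_sigma_algebraType (cylinders Z S) -> R).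
  have mxi : measurable_fun setT (xi t q.1 q.2 : g_sigma_algebraType (cylinders Z S) -> Xi q.1).
    by apply: measurable_Z_on; rewrite /S eqxx orbT.
  have := measurableT_comp (measurable_noise (oracle q.1) j)
    (measurable_fun_pair (measurable_vtup (measurable_row q.1 mXS)) mxi).
  rewrite (_ : _ \o _ = fun w => delta t q w 0 j)//.
  by apply/funext => w /=; rewrite vtupK.
apply: (fresh_noise_orthogonal (q := (t, q'.1, q'.2)) mZ indepZ (oracle q'.1) fresh _ _ mU).
  exact: (@lawZ (t, q'.1, q'.2)).
by move=> k; exact: (measurable_row q'.1 mXS).
Qed.

Let delta_sum t (a : J -> R) :
  mean_le P (fun w => fnorm (\sum_q a q *: delta t q w) ^+ 2) (\sum_q a q ^+ 2 * sigma ^+ 2).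
Proof.
split; last exact: (second_moment_sum (@measurable_delta t) (@delta_second t) (@delta_ortho t)).
  apply: measurable_funX; apply: measurable_fnorm => i j; rewrite (ord1 i).
  under eq_fun do rewrite summxE.
  by apply: measurable_sum => q; under eq_fun do rewrite mxE; exact: measurable_funM.
by move=> w; rewrite sqr_ge0.
Qed.


Let m_neq0 : (m%:R : R) != 0. Proof. by rewrite pnatr_eq0 -lt0n. Qed.
Let b_neq0 : (b%:R : R) != 0. Proof. by rewrite pnatr_eq0 -lt0n. Qed.

Let row_noise t i w :
  row i (G t w - gradmx f (X t w)) = b%:R^-1 *: \sum_(k < b) delta t (i, k) w.
Proof.
rewrite linearB /= rowK row_gradmx /delta /noise /= sumrB scalerBr; congr (_ - _).
by rewrite sumr_const card_ord -[grad _ _ *+ _]scaler_nat scalerA mulVf// scale1r.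
Qed.

Let scale : R := sigma / Num.sqrt (m%:R * b%:R).

Let mb_gt0 : (0 : R) < m%:R * b%:R. Proof. by rewrite mulr_gt0// ltr0n. Qed.

Let scale_gt0 : 0 < scale.
Proof. by rewrite divr_gt0// sqrtr_gt0. Qed.

Let scale_sqr : scale ^+ 2 = sigma ^+ 2 / (m%:R * b%:R).
Proof. by rewrite expr_div_n sqr_sqrtr// ltW. Qed.

Lemma measurable_gradient_error t : measurable_mx (fun w => G t w - gradmx f (X t w)).
Proof.
move=> i j.
have -> : (fun w => (G t w - gradmx f (X t w)) i j) =
    (fun w => (b%:R^-1 * \sum_(k < b) delta t (i, k) w 0 j)).
  apply/funext => w; have /rowP/(_ j) := row_noise t i w.
  by rewrite mxE => ->; rewrite mxE summxE.
apply: measurable_funM => //; apply: measurable_sum => k; exact: measurable_delta.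
Qed.

(** The error is the average of [m b] orthogonal noises, of variance at most
    [sigma ^ 2 / (m b)]. *)
Lemma mean_gradient_noise t :
  mean_le P (fun w => fnorm (rowmean (G t w) - rowmean (gradmx f (X t w)))) scale.
Proof.
have H w : rowmean (G t w) - rowmean (gradmx f (X t w)) =
    \sum_(q : J) (m%:R * b%:R)^-1 *: delta t q w.
  rewrite -rowmeanN -rowmeanD rowmeanE.
  under eq_bigr do rewrite row_noise.
  rewrite -[X in _ *: X = _]scaler_sumr scalerA pair_big /= -invfM scaler_sumr.
  by apply: eq_bigr => -[i k] _.
apply: mean_le_sqr => // [|w|]; last 2 first.
- exact: fnorm_ge0.
- under eq_fun do rewrite H.
  apply: mean_leW (delta_sum t _).
  rewrite sumr_const card_prod !card_ord scale_sqr -[leLHS]mulr_natr natrM.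
  by rewrite le_eqVlt; apply/orP; left; apply/eqP; field; rewrite m_neq0 b_neq0.
apply: measurable_fnorm => k j; rewrite (ord1 k); under eq_fun do rewrite H summxE.
by apply: measurable_sum => q; under eq_fun do rewrite mxE; exact: measurable_funM.
Qed.

(** Each of the [m] rows has variance at most [sigma ^ 2 / b], and the norm is
    divided by [m], not by [sqrt m]: hence the same [scale] as for the mean. *)
Lemma mean_gradient_error t :
  mean_le P (fun w => fnorm (G t w - gradmx f (X t w)) / m%:R) scale.
Proof.
have mE := measurable_fnorm (@measurable_gradient_error t).
apply: mean_le_sqr => // [|w|].
- by apply: measurable_funM.
- by rewrite divr_ge0 ?fnorm_ge0.
have row_le i : mean_le P (fun w => fnorm (row i (G t w - gradmx f (X t w))) ^+ 2) (sigma ^+ 2 / b%:R).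
  have H w : row i (G t w - gradmx f (X t w)) =
      \sum_(q : J) (if q.1 == i then b%:R^-1 else 0) *: delta t q w.
    rewrite row_noise scaler_sumr.
    rewrite -(pair_big predT predT (fun i' k => (if i' == i then b%:R^-1 else 0) *: delta t (i', k) w)) /=.
    rewrite (bigD1 i)//= [X in _ = _ + X]big1 ?addr0.
      by apply: eq_bigr => k _; rewrite eqxx.
    by move=> i' /negPf i'i; apply: big1 => k _; rewrite i'i scale0r.
  under eq_fun do rewrite H.
  apply: mean_leW (delta_sum t _).
  rewrite -(pair_big predT predT (fun i' (k : 'I_b) => (if i' == i then b%:R^-1 else 0) ^+ 2 * sigma ^+ 2)) /=.
  rewrite (bigD1 i)//= [X in _ + X]big1 ?addr0; last first.
    by move=> i' /negPf i'i; apply: big1 => k _; rewrite i'i expr0n mul0r.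
  under eq_bigr do rewrite eqxx.
  rewrite sumr_const card_ord -[leLHS]mulr_natr.
  by rewrite le_eqVlt; apply/orP; left; apply/eqP; field.
have := mean_leZ (a := m%:R^-1 ^+ 2) (sqr_ge0 _) (mean_le_sum (index_enum 'I_m) row_le).
rewrite sumr_const card_ord => H.
rewrite (_ : (fun w => _) = (fun w => m%:R^-1 ^+ 2 * \sum_i fnorm (row i (G t w - gradmx f (X t w))) ^+ 2)).
  apply: mean_leW H; rewrite scale_sqr -[sigma ^+ 2 / b%:R *+ m]mulr_natr.
  by rewrite le_eqVlt; apply/orP; left; apply/eqP; field; rewrite m_neq0 b_neq0.
by apply/funext => w; rewrite exprMn -fnorm_sqr_rows mulrC.
Qed.

Hypothesis df : forall i x, differentiable (f i) x.

Let gradnorm t i w := fnorm (grad (average f) (row i (X t w))).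

Lemma measurable_average_grad (d' : measure_display) (O' : measurableType d') (Y : O' -> 'rV[R]_d) :
  measurable_mx Y -> measurable_fun setT (fun w => fnorm (grad (average f) (Y w))).
Proof.
move=> mY; apply: measurable_fnorm.
under eq_fun do rewrite grad_average//.
apply: measurable_mxZ => k j; under eq_fun do rewrite summxE.
by apply: measurable_sum => i; exact: (measurable_gradmx_row oracle i mY).
Qed.

Lemma measurable_output_gradient t i : measurable_fun setT (gradnorm t i).
Proof.
by apply: measurable_average_grad; apply: measurable_row; have [] := measurable_XV t.
Qed.

(** On the event [tau = t] the output is the iterate of round [t].  These events
    have probability [1 / T], are independent of the samples and cover a set of
    probability 1. *)
Lemma mean_output i c : (0 < T)%N ->
  mean_le P (fun w => \sum_(t < T) gradnorm t i w) c ->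
  ('E_P[fun w => gradnorm (tau i w) i w] <= (c / T%:R)%:E)%E.
Proof.
move=> T0 [_ _ Hc]; rewrite unlock.
have [_ _ tau_law tau_ind] := sampling.
pose E t := tau i @^-1` [set t].
have mE t : measurable (E t) by rewrite /E -[X in measurable X]setTI; exact: measurable_funP.
have PE t : (t < T)%N -> P (E t) = (T%:R^-1)%:E by exact: tau_law.
pose A := \big[setU/set0]_(t < T) E t.
have mA : measurable A by exact: bigsetU_measurable.
have tE : trivIset setT E.
  by apply/trivIsetP => s t _ _ st; apply/seteqP; split => // w [/= ws wt]; rewrite -ws -wt eqxx in st.
have PA : P A = 1%E.
  rewrite /A measure_bigsetU//.
  rewrite (eq_bigr (fun=> (T%:R^-1)%:E)); last by move=> t _; exact: PE.
  by rewrite sumEFin sumr_const card_ord -[X in X%:E]mulr_natr mulVf// pnatr_eq0 -lt0n.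
have PAc : P (~` A) = 0%E by rewrite probability_setC// PA subee.
have mh : measurable_fun setT (fun w => (gradnorm (tau i w) i w)%:E).
  have -> : [set: Omega] = \bigcup_t E t by apply/seteqP; split => // w _; exists (tau i w).
  apply/measurable_fun_bigcup => // t.
  apply: (eq_measurable_fun (fun w => (gradnorm t i w)%:E)).
    by move=> w; rewrite inE /E /= => ->.
  by apply: measurable_funTS; apply/measurable_EFinP; exact: measurable_output_gradient.
have -> : (\int[P]_w (gradnorm (tau i w) i w)%:E = \int[P]_(w in A) (gradnorm (tau i w) i w)%:E)%E.
  have -> : (\int[P]_w (gradnorm (tau i w) i w)%:E = \int[P]_(w in setT `\` ~` A) (gradnorm (tau i w) i w)%:E)%E.
    by apply: (ge0_negligible_integral (measurableC mA) measurableT mh) => // w _; rewrite lee_fin fnorm_ge0.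
  by rewrite setTD setCK.
rewrite /A -(big_mkord predT E) ge0_integral_bigsetU//=; last 4 first.
- exact: iota_uniq.
- exact: sub_trivIset tE.
- by rewrite big_mkord; exact: measurable_funTS.
- by move=> w _; rewrite lee_fin fnorm_ge0.
rewrite big_mkord.
have Et (t : 'I_T) : (\int[P]_(w in E t) (gradnorm (tau i w) i w)%:E =
    T%:R^-1%:E * \int[P]_w (gradnorm t i w)%:E)%E.
  have -> : (\int[P]_(w in E t) (gradnorm (tau i w) i w)%:E = \int[P]_(w in E t) (gradnorm t i w)%:E)%E.
    by apply: eq_integral => w; rewrite inE /E /= => ->.
  rewrite -(PE t (ltn_ord t)).
  apply: (independent_event_integral (Z := Z) mZ (mE t) (tau_ind i)) => [|w]; last by rewrite lee_fin fnorm_ge0.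
  apply/measurable_EFinP; apply: measurable_average_grad; apply: measurable_row.
  exact: measurable_X_on.
under eq_bigr do rewrite Et.
rewrite -ge0_sume_distrr; last by move=> t _; apply: integral_ge0 => w _; rewrite lee_fin fnorm_ge0.
rewrite -ge0_integral_sum//; last 2 first.
- by move=> t; apply/measurable_EFinP; exact: measurable_output_gradient.
- by move=> t w _; rewrite lee_fin fnorm_ge0.
under eq_integral do rewrite sumEFin.
by rewrite mulrC EFinM lee_wpmul2l// lee_fin invr_ge0 ler0n.
Qed.

End Sampling.

(** * Step size, batch size, horizon and complexity *)

Ltac nonneg := repeat first
  [ assumption | exact: sqr_ge0 | exact: ler0n | exact: ltW | apply: exprn_ge0
  | apply: mulr_ge0 | apply: addr_ge0 | rewrite invr_ge0 ].

Section StepAndBatch.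
Variable R : realType.
Variables (Lf L1 eps : R).
Hypotheses (Lf0 : 0 < Lf) (L10 : 0 <= L1) (eps0 : 0 < eps).

Let den0 : 0 < 4 * Lf + 1. Proof. by move: Lf0; lra. Qed.

Lemma step_size_gt0 : 0 < step_size Lf L1 eps.
Proof.
rewrite /step_size; case: eqP => [_|/eqP L1n0]; first by rewrite divr_gt0.
by rewrite lt_min !divr_gt0// mulr_gt0// lt_def L1n0.
Qed.

Lemma step_size_le : step_size Lf L1 eps * (4 * Lf + 1) <= eps.
Proof.
rewrite -ler_pdivlMr// /step_size; case: eqP => // _.
by rewrite ge_min lexx.
Qed.

Lemma step_size_L1 : L1 * step_size Lf L1 eps <= 1 / 2.
Proof.
rewrite /step_size; case: eqP => [->|/eqP L1n0]; first by rewrite mul0r divr_ge0.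
have L1p : 0 < L1 by rewrite lt_def L1n0.
apply: (@le_trans _ _ (L1 * (1 / (2 * L1)))).
  by rewrite ler_pM2l// ge_min lexx orbT.
by rewrite le_eqVlt; apply/orP; left; apply/eqP; field.
Qed.

(** The two lower bounds on [T] are the two cases of the minimum in the step. *)
Lemma horizon_step (phi T : R) : 0 <= phi ->
  8 * (4 * Lf + 1) / eps ^+ 2 * phi <= T -> 16 * L1 / eps * phi <= T ->
  8 * phi <= T * (step_size Lf L1 eps * eps).
Proof.
move=> phi0 H1 H2.
have C1 : 8 * phi <= T * (eps / (4 * Lf + 1) * eps).
  have : 8 * phi = 8 * (4 * Lf + 1) / eps ^+ 2 * phi * (eps / (4 * Lf + 1) * eps).
    by field; rewrite !lt0r_neq0.
  by move=> ->; rewrite ler_wpM2r// mulr_ge0 ?divr_ge0 ?ltW.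
rewrite /step_size; case: eqP => // /eqP L1n0.
have L1p : 0 < L1 by rewrite lt_def L1n0.
have [_|_] := leP (eps / (4 * Lf + 1)) (1 / (2 * L1)) => //.
have -> : 8 * phi = 16 * L1 / eps * phi * (1 / (2 * L1) * eps).
  by field; rewrite L1n0 lt0r_neq0.
by rewrite ler_wpM2r// mulr_ge0 ?divr_ge0 ?mulr_ge0 ?ltW.
Qed.

Variables (m : nat) (sigma : R).
Hypotheses (m0 : (0 < m)%N) (sigma0 : 0 < sigma).

Lemma batch_bound_gt0 : 0 < batch_bound m Lf L1 sigma eps.
Proof.
rewrite /batch_bound lt_max; apply/orP; left.
have mR : 0 < (m%:R : R) by rewrite ltr0n.
by apply: divr_gt0; rewrite !mulr_gt0 ?exprn_gt0.
Qed.

(** As [4 Lf <= 4 Lf + 1], the first bound on [b] gives [m b >= (64 sigma / eps) ^ 2]. *)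
Lemma batch_noise b : batch_bound m Lf L1 sigma eps <= b%:R ->
  sigma / Num.sqrt (m%:R * b%:R) <= eps / 64.
Proof.
move=> hb; have bR : 0 < (b%:R : R) := lt_le_trans batch_bound_gt0 hb.
have mR : 0 < (m%:R : R) by rewrite ltr0n.
have mb : 0 < m%:R * b%:R :> R by rewrite mulr_gt0.
rewrite ler_pdivrMr ?sqrtr_gt0//.
have rhs0 : 0 <= eps / 64 * Num.sqrt (m%:R * b%:R).
  by rewrite mulr_ge0 ?sqrtr_ge0// divr_ge0// ltW.
rewrite -(@ler_pXn2r _ 2) ?nnegrE ?(ltW sigma0)//.
rewrite exprMn (sqr_sqrtr (ltW mb)).
move: hb; rewrite /batch_bound ge_max => /andP[+ _].
rewrite ler_pdivrMr ?mulr_gt0 ?exprn_gt0// => h.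
have L2 : 0 < Lf ^+ 2 by rewrite exprn_gt0.
rewrite -(ler_pM2l L2).
have : 16 * Lf ^+ 2 <= (4 * Lf + 1) ^+ 2 by move: Lf0; nra.
have : 0 <= sigma ^+ 2 by exact: sqr_ge0.
move: h; move: (sigma ^+ 2) => s h s0 h2.
have h3 : 256 * (16 * Lf ^+ 2) * s <= 256 * (4 * Lf + 1) ^+ 2 * s.
  by rewrite ler_wpM2r// ler_pM2l.
have := le_trans h3 h; rewrite expr_div_n; lra.
Qed.

End StepAndBatch.

Section Complexity.
Variable R : realType.
Variables (Lf L1 eps Df phi kappa ell : R).
Hypotheses (Lf0 : 0 < Lf) (L10 : 0 <= L1) (eps0 : 0 < eps) (Df0 : 0 < Df).
Hypotheses (kappa0 : 0 < kappa) (ell0 : 0 < ell) (ellLf : ell <= Lf).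
Hypotheses (phi0 : 0 <= phi) (phiD : phi <= 5 * Df).

Let Lfw : 0 <= Lf := ltW Lf0.
Let Dfw : 0 <= Df := ltW Df0.
Let epsw : 0 <= eps := ltW eps0.
Let kappaw : 0 <= kappa := ltW kappa0.

(** [4 Lf + 1 <= (4 + 1 / ell) Lf] as soon as [ell <= Lf]: this is how the additive
    1 in the step size disappears from the complexities. *)
Definition complexity_const : R := 4 + ell^-1.
Let c := complexity_const.

Let c4 : 4 <= c. Proof. by rewrite lerDl invr_ge0 ltW. Qed.

Let den_le : 4 * Lf + 1 <= c * Lf.
Proof.
rewrite /c /complexity_const [leRHS]mulrDl lerD2l -(@ler_pM2l _ ell)// mulr1 mulrA mulfV ?lt0r_neq0// mul1r//.
Qed.

Let horizon : R := Num.max (8 * (4 * Lf + 1) / eps ^+ 2 * phi) (16 * L1 / eps * phi).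

Let horizon_le : horizon <= 40 * c * (Lf * Df / eps ^+ 2 + L1 * Df / eps).
Proof.
have e1 : 0 < eps^-1 by rewrite invr_gt0.
have e2 : 0 < (eps ^+ 2)^-1 by rewrite invr_gt0 exprn_gt0.
have P1 : 0 <= Lf * Df / eps ^+ 2 by rewrite divr_ge0 ?mulr_ge0 ?sqr_ge0.
have P2 : 0 <= L1 * Df / eps by rewrite divr_ge0 ?mulr_ge0.
have c0 : 0 <= 40 * c by move: c4; lra.
rewrite /horizon ge_max; apply/andP; split.
  apply: (@le_trans _ _ (40 * c * (Lf * Df / eps ^+ 2))); last by rewrite ler_wpM2l// lerDl.
  apply: (@le_trans _ _ (8 * (c * Lf) / eps ^+ 2 * (5 * Df))).
    apply: ler_pM => //; last by rewrite ler_pM2r// ler_pM2l.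
    by rewrite divr_ge0 ?sqr_ge0//; move: Lf0; lra.
  by rewrite le_eqVlt; apply/orP; left; apply/eqP; ring.
apply: (@le_trans _ _ (40 * c * (L1 * Df / eps))); last by rewrite ler_wpM2l// lerDr.
apply: (@le_trans _ _ (16 * L1 / eps * (5 * Df))).
  by rewrite ler_wpM2l// divr_ge0 ?mulr_ge0.
have -> : 16 * L1 / eps * (5 * Df) = 80 * (L1 * Df / eps) by ring.
by rewrite ler_wpM2r//; move: c4; lra.
Qed.

(** With [q = L1 eps / Lf] and [A] the first of the four terms, the product of the
    bounds on [T] and [b] consists of the four terms, with [A q ^ 3] as the third
    one, and of [A q] and [A q ^ 2], both at most [A + A q ^ 3]. *)
Lemma sample_complexity (m : nat) (sigma T b : R) : (0 < m)%N -> 0 < sigma ->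
  0 <= T -> 0 <= b ->
  b <= kappa * batch_bound m Lf L1 sigma eps -> T <= kappa * (horizon + 1) ->
  T * b <= 3 * (40 * c) * (256 * c ^+ 2) * kappa ^+ 2 * (m%:R^-1 *
    (Lf * sigma ^+ 2 * Df / eps ^+ 4 + sigma ^+ 2 / eps ^+ 2
     + L1 ^+ 3 * sigma ^+ 2 * Df / (Lf ^+ 2 * eps) + L1 ^+ 2 * sigma ^+ 2 / Lf ^+ 2)).
Proof.
move=> m0 s0 T0 b0 hb hT.
have mR : 0 < (m%:R : R) by rewrite ltr0n.
have c0 : 0 < c by move: c4; lra.
have hb' : b <= kappa * (256 * c ^+ 2 * (m%:R^-1 * (sigma ^+ 2 / eps ^+ 2 + L1 ^+ 2 * sigma ^+ 2 / Lf ^+ 2))).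
  apply: le_trans hb _; rewrite ler_pM2l//.
  have Q1 : 0 <= m%:R^-1 * (sigma ^+ 2 / eps ^+ 2) by rewrite mulr_ge0 ?divr_ge0 ?sqr_ge0 ?invr_ge0.
  have Q2 : 0 <= m%:R^-1 * (L1 ^+ 2 * sigma ^+ 2 / Lf ^+ 2).
    by nonneg.
  have c2 : 4 <= c ^+ 2 by move: c4; nra.
  rewrite mulrDr mulrDr /batch_bound ge_max; apply/andP; split.
    rewrite -[leLHS]addr0; apply: lerD; last by rewrite mulr_ge0// mulr_ge0 ?sqr_ge0.
    have -> : 256 * (4 * Lf + 1) ^+ 2 * sigma ^+ 2 / (m%:R * Lf ^+ 2 * eps ^+ 2) =
      256 * ((4 * Lf + 1) / Lf) ^+ 2 * (m%:R^-1 * (sigma ^+ 2 / eps ^+ 2)).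
      by field; rewrite !lt0r_neq0.
    rewrite ler_wpM2r// ler_pM2l// lerXn2r ?nnegrE ?ler_pdivrMr//; last exact: ltW.
    by rewrite divr_ge0 ?ltW//; move: Lf0; lra.
  rewrite -[leLHS]add0r; apply: lerD; first by rewrite mulr_ge0// mulr_ge0 ?sqr_ge0.
  have -> : 1024 * L1 ^+ 2 * sigma ^+ 2 / (m%:R * Lf ^+ 2) =
      1024 * (m%:R^-1 * (L1 ^+ 2 * sigma ^+ 2 / Lf ^+ 2)).
    by field; rewrite !lt0r_neq0.
  by rewrite ler_wpM2r//; lra.
have hT' : T <= kappa * (40 * c * (Lf * Df / eps ^+ 2 + L1 * Df / eps + 1)).
  apply: le_trans hT _; rewrite ler_pM2l// mulrDr; apply: lerD; first exact: horizon_le.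
  by move: c4; lra.
have := ler_pM T0 b0 hT' hb' => /le_trans; apply.
set A := Lf * sigma ^+ 2 * Df / eps ^+ 4; set q := L1 * eps / Lf.
set B := sigma ^+ 2 / eps ^+ 2; set E := L1 ^+ 2 * sigma ^+ 2 / Lf ^+ 2.
have A0 : 0 <= A by rewrite /A; nonneg.
have q0 : 0 <= q by rewrite /q; nonneg.
have B0 : 0 <= B by rewrite /B; nonneg.
have E0 : 0 <= E by rewrite /E; nonneg.
have -> : L1 ^+ 3 * sigma ^+ 2 * Df / (Lf ^+ 2 * eps) = A * q ^+ 3.
  by rewrite /A /q; field; rewrite !lt0r_neq0.
have H : (Lf * Df / eps ^+ 2 + L1 * Df / eps + 1) * (B + E) =
    A + A * q + A * q ^+ 2 + A * q ^+ 3 + B + E.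
  by rewrite /A /q /B /E; field; rewrite !lt0r_neq0.
have -> : kappa * (40 * c * (Lf * Df / eps ^+ 2 + L1 * Df / eps + 1)) *
    (kappa * (256 * c ^+ 2 * (m%:R^-1 * (B + E)))) =
    ((40 * c) * (256 * c ^+ 2) * kappa ^+ 2 * m%:R^-1) * ((Lf * Df / eps ^+ 2 + L1 * Df / eps + 1) * (B + E)) by ring.
rewrite H.
have -> : 3 * (40 * c) * (256 * c ^+ 2) * kappa ^+ 2 * (m%:R^-1 * (A + B + A * q ^+ 3 + E)) =
  ((40 * c) * (256 * c ^+ 2) * kappa ^+ 2 * m%:R^-1) * (3 * (A + B + A * q ^+ 3 + E)) by ring.
apply: ler_wpM2l; first by nonneg.
have q1 : q <= 1 + q ^+ 3.
  have [q1|q1] := leP q 1; first by have := exprn_ge0 3 q0; lra.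
  have : 1 <= q ^+ 2 by rewrite exprn_ege1// ltW.
  by move=> h; have := ler_wpM2l q0 h; rewrite mulr1 -exprS; lra.
have q2 : q ^+ 2 <= 1 + q ^+ 3.
  have [q1'|q1'] := leP q 1; first by have := exprn_ile1 2 q0 q1'; have := exprn_ge0 3 q0; lra.
  by have := ler_wpM2r (sqr_ge0 q) (ltW q1'); rewrite mul1r -exprS; lra.
have := ler_wpM2l A0 q1; have := ler_wpM2l A0 q2.
have : 0 <= A * q ^+ 3 by rewrite mulr_ge0// exprn_ge0.
by rewrite !mulrDr mulr1; move: A0 B0 E0; clearbody A B E; lra.
Qed.

(** As [1 <= T], the bound on the horizon is at least 1: multiplying the initial
    rounds by it puts them in the same form as [T K]. *)
Lemma communication_complexity (Klog Khatlog g T K Khat : R) :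
  0 < g -> 0 <= Klog -> 0 <= Khatlog -> 1 <= T -> 0 <= K ->
  T <= kappa * horizon -> K <= kappa * (Klog / g) -> Khat <= kappa * (Khatlog / g) ->
  T * K + Khat <= 3 * (40 * c) * (256 * c ^+ 2) * kappa ^+ 2 * ((Klog + Khatlog) *
    (Lf * Df / (g * eps ^+ 2) + L1 * Df / (g * eps))).
Proof.
move=> g0 Kl0 Khl0 T1 K0 hT hK hKhat.
have c0 : 0 < c by move: c4; lra.
set H := Lf * Df / eps ^+ 2 + L1 * Df / eps.
have H0 : 0 <= H by rewrite /H; nonneg.
have hT' : T <= kappa * (40 * c * H).
  by apply: le_trans hT _; rewrite ler_pM2l//; exact: horizon_le.
have -> : Lf * Df / (g * eps ^+ 2) + L1 * Df / (g * eps) = H / g.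
  by rewrite /H; field; rewrite !lt0r_neq0.
apply: (@le_trans _ _ (40 * c * kappa ^+ 2 * ((Klog + Khatlog) * (H / g)))); last first.
  have Q : 0 <= kappa ^+ 2 * ((Klog + Khatlog) * (H / g)).
    by nonneg.
  have c3 : 40 * c <= 3 * (40 * c) * (256 * c ^+ 2).
    rewrite mulrAC -[leLHS]mul1r; apply: ler_wpM2r; first by move: c0; lra.
    by move: c4; nra.
  rewrite -[leLHS]mulrA -[leRHS]mulrA; exact: ler_wpM2r.
have TK : T * K <= kappa * (40 * c * H) * (kappa * (Klog / g)).
  by apply: ler_pM => //; apply: le_trans T1.
have KT : Khat <= kappa * (40 * c * H) * (kappa * (Khatlog / g)).
  apply: le_trans hKhat _; rewrite ler_peMl//.
    by nonneg.
  exact: le_trans T1 hT'.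
apply: le_trans (lerD TK KT) _; rewrite le_eqVlt; apply/orP; left; apply/eqP; ring.
Qed.

End Complexity.

(** * Convergence *)

Section Arithmetic.
Variable R : realType.

(** The horizon turns [Df / eta + 2 e = phi / eta] into at most [T eps / 8], the
    noise terms take [2 / 64 + 1 / 4096] and the curvature [17 / 64] of [T eps];
    17/8 times the sum of these shares is less than 1. *)
Lemma error_budget (Df eta e s L eps T phi : R) :
  0 < eta -> 0 <= e -> 0 <= Df -> 0 < T -> phi = Df + 2 * eta * e ->
  8 * phi <= T * (eta * eps) -> s <= eps / 64 -> L * eta <= eps / 4 -> 0 <= eps ->
  17 / 8 * (Df / eta + (2 + 1 / 64) * e + T * (2 * s + (s + s) / 128 + 17 / 16 * (L * eta))) / T
  <= eps.
Proof.
move=> eta0 e0 Df0 T0 phiE hT hs hL eps0.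
rewrite ler_pdivrMr//.
have h1 : Df / eta + 2 * e <= T * eps / 8.
  rewrite -(@ler_pM2r _ eta)// mulrDl divfK ?lt0r_neq0//.
  by move: hT; rewrite phiE; lra.
have h2 : 0 <= Df / eta by rewrite divr_ge0// ltW.
have h3 : 2 * s + (s + s) / 128 + 17 / 16 * (L * eta) <= (2 / 64 + 1 / 4096 + 17 / 64) * eps by lra.
have h4 := ler_wpM2l (ltW T0) h3.
have h5 : 0 <= T * eps by rewrite mulr_ge0// ltW.
move: (Df / eta) h1 h2 => x h1 h2.
move: (T * (2 * s + (s + s) / 128 + 17 / 16 * (L * eta))) h4 => y h4.
have : y <= (2 / 64 + 1 / 4096 + 17 / 64) * (T * eps) by rewrite mulrCA.
by rewrite (mulrC eps); move: (T * eps) h1 h5 => z; lra.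
Qed.

(** The logarithm in the number of initial rounds makes the contraction beat
    the ratio of the initial heterogeneity to the initial gap. *)
Lemma initial_budget (eta S Df x : R) : 0 < eta -> 0 <= S -> 0 < Df ->
  ln (2 + eta * S / Df) <= x -> eta * (expR (- x) * S) <= Df.
Proof.
move=> eta0 S0 Df0 hx.
have q0 : 0 <= eta * S / Df by rewrite divr_ge0 ?mulr_ge0// ltW.
have H : expR (- x) <= (2 + eta * S / Df)^-1.
  rewrite -[X in _ <= X^-1]lnK ?posrE; last by lra.
  by rewrite -expRN ler_expR lerN2.
have := ler_wpM2r S0 H => /(ler_wpM2l (ltW eta0)) /le_trans; apply.
rewrite mulrCA mulrC ler_pdivrMr; last by lra.
rewrite mulrDr [Df * (_ / _)]mulrC divfK ?lt0r_neq0//.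
by rewrite lerDr mulr_ge0// ltW.
Qed.

End Arithmetic.

Section Convergence.
Context (R : realType) (m d : nat) (L0 L1 zeta sigma eps : R).
Context (dX : 'I_m -> measure_display) (Xi : forall i, measurableType (dX i)).
Variables (D : forall i, probability (Xi i) R).
Variables (F : forall i, 'rV[R]_d -> Xi i -> R) (fi : 'I_m -> 'rV[R]_d -> R).
Variables (W : 'M[R]_m) (x0 : 'rV[R]_d) (Khat K T b : nat).
Context (dO : measure_display) (Omega : measurableType dO) (P : probability Omega R).
Variables (xi : nat -> forall i : 'I_m, 'I_b -> {RV P >-> Xi i}).
Variable tau : 'I_m -> {RV P >-> nat}.

Let f := average fi.
Let Lf := L0 + L1 * zeta.
Let Deltaf := f x0 - infval f.
Let eta := step_size Lf L1 eps.
Let XV t w := dnsgd F W x0 eta Khat K (fun t i k => xi t i k w) t.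

Hypotheses (m0 : (0 < m)%N) (L00 : 0 <= L0) (L10 : 0 <= L1) (zeta0 : 0 <= zeta).
Hypotheses (sigma0 : 0 < sigma) (eps0 : 0 < eps) (Lf0 : 0 < Lf).
Hypothesis df : forall i x, differentiable (fi i) x.
Hypothesis lbf : has_lbound (range f).
Hypothesis smooth : forall i, L0L1_smooth L0 L1 (fi i).
Hypothesis het : bounded_heterogeneity zeta fi.
Hypothesis oracle : forall i, stochastic_oracle (D i) sigma (@F i) (fi i).
Hypothesis mixW : mixing_matrix W.
Hypothesis sampling : dnsgd_sampling T D xi tau.
Hypothesis b0 : (0 < b)%N.

Let eta0 : 0 < eta. Proof. exact: step_size_gt0. Qed.

Let Deltaf_ge0 : 0 <= Deltaf.
Proof. by rewrite subr_ge0; apply: ge_inf => //; exists x0. Qed.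

Let G t w := minibatch_grad F (XV t w).1 (fun i k => xi t i k w).

Let scale := sigma / Num.sqrt (m%:R * b%:R).

Let sm_gt0 : 0 < Num.sqrt (m%:R : R).
Proof. by rewrite sqrtr_gt0 ltr0n. Qed.

(** One call of accelerated gossip turns the heterogeneity and the noise of the
    first gradients into the initial consensus error. *)
Lemma initial_consensus :
  mean_le P (fun w => consensus_error (XV 0%N w).2)
    (2 * expR (- (Khat%:R * Num.sqrt (spectral_gap W) / 4)) *
      (Num.sqrt m%:R * (zeta + sigma))).
Proof.
set e := 2 * _; have e0 : 0 <= e by rewrite mulr_ge0 ?expR_ge0.
have mR : (m%:R : R) != 0 by rewrite pnatr_eq0 -lt0n.
have mean0 := mean_gradient_error W x0 eta Khat K m0 b0 sigma0 oracle sampling 0%N.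
have zm : 0 <= Num.sqrt m%:R * zeta by rewrite mulr_ge0// ltW.
have bound := mean_leZ e0 (mean_leD (mean_leZ (ler0n R m) mean0) (mean_le_cst P zm)).
have mV : measurable_mx (fun w => (XV 0%N w).2).
  have mxi t' i k : measurable_fun setT (xi t' i k) by exact: measurable_funP.
  have [_] := measurable_dnsgd oracle W x0 eta Khat K
    (s := fun w t i k => xi t i k w) (t := 0%N) (fun t' i k _ => mxi t' i k).
  by apply=> i k; exact: mxi.
apply: (mean_leW _ (mean_le_dom (measurable_consensus mV) _ bound)).
  rewrite ler_wpM2l// mulrDr [leRHS]addrC lerD2r.
  rewrite -/scale -{1}(sqr_sqrtr (ler0n R m)) expr2 -mulrA ler_pM2l//.
  have sb : 0 < Num.sqrt (b%:R : R) by rewrite sqrtr_gt0 ltr0n.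
  have -> : Num.sqrt m%:R * scale = sigma / Num.sqrt b%:R.
    by rewrite /scale sqrtrM ?ler0n//; field; rewrite !lt0r_neq0.
  rewrite ler_pdivrMr// ler_peMr ?(ltW sigma0)//.
  by rewrite -[leLHS]sqrtr1 ler_sqrt ?ler0n// ler1n.
move=> w; rewrite consensus_ge0/=.
apply: le_trans (AccGossip_contracts m0 mixW _ _) _; rewrite -/e ler_wpM2l//.
apply: le_trans (consensus_le m0 _ (grad f x0)) _.
apply: le_trans (fnormDB _ (gradmx fi (XV 0%N w).1) _) _.
apply: lerD; first by rewrite mulrC divfK.
apply: fnorm_le_rows => // i.
rewrite linearB /= row_ones row_gradmx row_ones; exact: het.
Qed.

Let cons0 := fine (\int[P]_w (consensus_error (XV 0%N w).2)%:E).

Let cons0E : (\int[P]_w (consensus_error (XV 0%N w).2)%:E)%E = cons0%:E.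
Proof.
have [mY Y0 Yc] := initial_consensus; rewrite fineK// ge0_fin_numE.
  by apply: le_lt_trans Yc _; exact: ltry.
by apply: integral_ge0 => w _; rewrite lee_fin.
Qed.

Let cons0_ge0 : 0 <= cons0.
Proof. by rewrite fine_ge0//; apply: integral_ge0 => w _; rewrite lee_fin consensus_ge0. Qed.

Definition potential : R := Deltaf + 2 * eta * (cons0 / Num.sqrt m%:R).

Lemma potentialE : (Deltaf%:E + (2 * eta / Num.sqrt m%:R)%:E *
    'E_P[fun w => consensus_error (XV 0%N w).2])%E = potential%:E.
Proof.
rewrite unlock cons0E -EFinM -EFinD; congr EFin; rewrite /potential; congr (_ + _).
by rewrite mulrAC mulrA.
Qed.

Lemma potential_ge : Deltaf <= potential.
Proof. by rewrite lerDl mulr_ge0 ?divr_ge0 ?mulr_ge0// ltW. Qed.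

(** The initial consensus error contributes at most [4 Deltaf]: a factor 2 from
    the definition of the potential and a factor 2 from the gossip rate. *)
Lemma potential_le : 0 < Deltaf ->
  4 * (init_log eta zeta sigma Deltaf / Num.sqrt (spectral_gap W)) <= Khat%:R ->
  potential <= 5 * Deltaf.
Proof.
move=> Df0 hK.
have /andP[gap0 _] := spectral_gap_bounds m0 mixW.
have g0 : 0 < Num.sqrt (spectral_gap W) by rewrite sqrtr_gt0.
have hx : init_log eta zeta sigma Deltaf <= Khat%:R * Num.sqrt (spectral_gap W) / 4.
  by move: hK; rewrite mulrA ler_pdivrMr// => h; lra.
have S0 : 0 <= zeta + sigma by rewrite addr_ge0// ltW.
have H := initial_budget eta0 S0 Df0 hx.
have [mY Y0 Yc] := initial_consensus.
move: Yc; rewrite cons0E lee_fin => Yc.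
have : cons0 / Num.sqrt m%:R <= 2 * (expR (- (Khat%:R * Num.sqrt (spectral_gap W) / 4)) * (zeta + sigma)).
  by rewrite ler_pdivrMr//; apply: le_trans Yc _; rewrite le_eqVlt; apply/orP; left; apply/eqP; ring.
move=> /(ler_wpM2l (ltW eta0)); rewrite /potential; move: H.
move: (expR _ * _) (cons0 / _) => u v; rewrite mulrCA -[2 * eta * v]mulrA; lra.
Qed.

Hypothesis T0 : (0 < T)%N.
Hypothesis batch : batch_bound m Lf L1 sigma eps <= b%:R.
Hypothesis horizon1 : 8 * (4 * Lf + 1) / eps ^+ 2 * potential <= T%:R.
Hypothesis horizon2 : 16 * L1 / eps * potential <= T%:R.
Hypothesis rounds : 84 * (gossip_log m eta / Num.sqrt (spectral_gap W)) <= K%:R.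

(** The sure bound on the trajectory is integrated term by term and divided by
    [T]; the resulting sum is within the error budget. *)
Theorem dnsgd_convergence i :
  ('E_P[fun w => fnorm (grad f (row i (XV (tau i w) w).1))] <= eps%:E)%E.
Proof.
have [rho [rho0 rho_small] contract] := gossip_rounds m0 mixW (ltW eta0) rounds.
have TR : 0 < (T%:R : R) by rewrite ltr0n.
have etaL : L1 * eta <= 1 / 2 by exact: step_size_L1.
have scale0 : 0 <= scale by rewrite divr_ge0 ?sqrtr_ge0 ?ltW.
have en t := mean_gradient_noise W x0 eta Khat K m0 b0 sigma0 oracle sampling t.
have eN t := mean_gradient_error W x0 eta Khat K m0 b0 sigma0 oracle sampling t.
have eC : mean_le P (fun w => consensus_error (XV 0%N w).2) cons0.
  by have [mY Y0 _] := initial_consensus; split; rewrite ?cons0E.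
have Le0 : 0 <= 17 / 16 * (Lf * eta) by rewrite !mulr_ge0 ?ltW.
have eT t := mean_leD (mean_leD (mean_leZ (ler0n R 2) (en t))
  (mean_leZ (a := 128^-1) (ltac:(by [])) (mean_leD (eN t) (eN t.+1)))) (mean_le_cst P Le0).
have c1 : 0 <= (2 + 1 / 64) / Num.sqrt (m%:R : R) by rewrite divr_ge0// ?ltW//; lra.
have c2 : (0 : R) <= 17 / 8 by lra.
have De0 : 0 <= Deltaf / eta by rewrite divr_ge0// ltW.
have bound := mean_leZ c2 (mean_leD (mean_leD (mean_le_cst P De0) (mean_leZ c1 eC))
  (mean_le_sum (index_enum 'I_T) (fun t : 'I_T => eT t))).
move: bound; set C := (X in mean_le P _ X) => bound.
have mean_sum : mean_le P (fun w => \sum_(t < T) fnorm (grad f (row i (XV t w).1))) C.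
  apply: (mean_le_dom _ _ bound).
    apply: measurable_sum => t.
    exact: (measurable_output_gradient xi W x0 eta Khat K oracle df t i).
  move=> w; apply/andP; split; first by apply: sumr_ge0 => t _; exact: fnorm_ge0.
  have V0 : rowmean (XV 0%N w).2 = rowmean (G 0%N w) by exact: rowmean_AccGossip.
  have := trajectory_bound m0 L00 L10 zeta0 df smooth het eta0 etaL
    rho0 rho_small (fun Y => rowmean_AccGossip mixW Y K) (contract d)
    (X := fun t => (XV t w).1) (V := fun t => (XV t w).2) (G := fun t => G t w) (x0 := x0)
    erefl (fun t => erefl) V0 (fun t => erefl) i T lbf.
  move=> /le_trans; apply; rewrite ler_wpM2l// -/f -/Deltaf -/Lf.
  rewrite le_eqVlt; apply/orP; left; apply/eqP; congr (_ + _ + _); first by rewrite mulrA mulrAC.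
  apply: eq_bigr => t _; congr (_ + _ + _).
  by rewrite -mulrDl [in RHS]mulrC.
apply: le_trans (mean_output oracle sampling df T0 mean_sum) _; rewrite lee_fin.
rewrite /C -/scale sumr_const card_ord -[_ *+ T]mulr_natl.
have hL : Lf * eta <= eps / 4.
  by have : eta * (4 * Lf + 1) <= eps by [exact: step_size_le]; move: eta0; lra.
have := error_budget eta0 (divr_ge0 cons0_ge0 (ltW sm_gt0)) Deltaf_ge0 TR erefl
  (horizon_step Lf0 L10 eps0 (le_trans Deltaf_ge0 potential_ge) horizon1 horizon2)
  (batch_noise Lf0 eps0 m0 sigma0 batch) hL (ltW eps0).
apply: le_trans; rewrite le_eqVlt; apply/orP; left; apply/eqP.
rewrite -/scale (mulrC 128^-1) -[_ / _ * cons0]mulrA (mulrC _^-1 cons0).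
by [].
Qed.

End Convergence.

(** * The convergence theorem *)

(* cK, cKhat, cPhi and C are the constants of the O, Theta and soft-O notations:
   the first three are absolute, C depends only on kappa and ell.
   An upper bound with kappa says that a parameter is chosen of the order of
   its prescribed lower bound; ell is a positive lower bound of Lf. *)
Theorem corollary1 (R : realType) :
  exists cK cKhat cPhi : R, [/\ 0 < cK, 0 < cKhat, 0 < cPhi &
  forall kappa ell : R, 0 < kappa -> 0 < ell ->
  exists C : R, 0 < C /\
  forall (m d : nat) (L0 L1 zeta sigma eps : R)
    (dX : 'I_m -> measure_display) (Xi : forall i, measurableType (dX i))
    (D : forall i, probability (Xi i) R)
    (F : forall i, 'rV[R]_d -> Xi i -> R)
    (fi : 'I_m -> 'rV[R]_d -> R)
    (W : 'M[R]_m) (x0 : 'rV[R]_d) (Khat K T b : nat)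
    (dO : measure_display) (Omega : measurableType dO) (P : probability Omega R)
    (xi : nat -> forall i : 'I_m, 'I_b -> {RV P >-> Xi i})
    (tau : 'I_m -> {RV P >-> nat}),
  let f := average fi in
  let Lf := L0 + L1 * zeta in
  let Deltaf := f x0 - infval f in
  let gamma := spectral_gap W in
  let eta := step_size Lf L1 eps in
  let XV t w := dnsgd F W x0 eta Khat K (fun t i k => xi t i k w) t in
  let DeltaPhi := (Deltaf%:E + (2 * eta / Num.sqrt m%:R)%:E *
                     'E_P[fun w => consensus_error (XV 0%N w).2])%E in
  let xhat i w := row i (XV (tau i w) w).1 in
  let bmin := batch_bound m Lf L1 sigma eps in
  let Tmin := horizon_bound Lf L1 eps DeltaPhi in
  let Klog := gossip_log m eta in
  let Khatlog := init_log eta zeta sigma Deltaf in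
  (0 < m)%N -> 0 <= L0 -> 0 <= L1 -> 0 <= zeta -> 0 < sigma -> 0 < eps ->
  0 < Lf ->
  (forall i x, differentiable (fi i) x) ->
  (forall i, expected_loss (D i) (F i) (fi i)) ->
  has_lbound (range f) ->
  (forall i, L0L1_smooth L0 L1 (fi i)) ->
  bounded_heterogeneity zeta fi ->
  (forall i, stochastic_oracle (D i) sigma (F i) (fi i)) ->
  mixing_matrix W ->
  dnsgd_sampling T D xi tau ->
  bmin <= b%:R ->
  (0 < T)%N -> (Tmin <= T%:R%:E)%E ->
  cK * (Klog / Num.sqrt gamma) <= K%:R ->
  cKhat * (Khatlog / Num.sqrt gamma) <= Khat%:R ->
  [/\ 0 < Deltaf ->
        (Deltaf%:E <= cPhi%:E * DeltaPhi)%E /\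
        (DeltaPhi <= (cPhi * Deltaf)%:E)%E,
      forall i, ('E_P[fun w => fnorm (grad f (xhat i w))] <= eps%:E)%E,
      0 < Deltaf -> ell <= Lf ->
        b%:R <= kappa * bmin -> (T%:R%:E <= kappa%:E * (Tmin + 1))%E ->
        (T * b)%:R <= C * (m%:R^-1 *
          (Lf * sigma ^+ 2 * Deltaf / eps ^+ 4 + sigma ^+ 2 / eps ^+ 2
           + L1 ^+ 3 * sigma ^+ 2 * Deltaf / (Lf ^+ 2 * eps)
           + L1 ^+ 2 * sigma ^+ 2 / Lf ^+ 2)) &
      0 < Deltaf -> ell <= Lf ->
        (T%:R%:E <= kappa%:E * Tmin)%E ->
        K%:R <= kappa * (Klog / Num.sqrt gamma) ->
        Khat%:R <= kappa * (Khatlog / Num.sqrt gamma) ->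
        (T * K + Khat)%:R <= C * ((Klog + Khatlog) *
          (Lf * Deltaf / (Num.sqrt gamma * eps ^+ 2)
           + L1 * Deltaf / (Num.sqrt gamma * eps)))] ].
Proof.
exists 84, 4, 5; split=> // kappa ell kappa0 ell0.
have c0 : 0 < complexity_const ell by rewrite addr_gt0 ?invr_gt0.
exists (3 * (40 * complexity_const ell) * (256 * complexity_const ell ^+ 2) * kappa ^+ 2).
split; first by rewrite !mulr_gt0 ?exprn_gt0.
move=> m d L0 L1 zeta sigma eps dX Xi D F fi W x0 Khat K T b dO Omega P xi tau.
move=> f Lf Deltaf gamma eta XV DeltaPhi xhat bmin Tmin Klog Khatlog.
move=> m0 L00 L10 zeta0 sigma0 eps0 Lf0 df _ lbf smooth het oracle mixW sampling batch T0 hT hK hKhat.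
have b0 : (0 < b)%N.
  by rewrite -(ltr0n R); apply: lt_le_trans batch; exact: batch_bound_gt0.
set phi := potential L0 L1 zeta eps F fi W x0 Khat K xi.
have phiE : DeltaPhi = phi%:E.
  exact: (potentialE L0 L1 eps x0 Khat K m0 zeta0 sigma0 het oracle mixW sampling b0).
have phi_ge : Deltaf <= phi by apply: potential_ge.
have Df0 : 0 <= Deltaf by rewrite subr_ge0; apply: ge_inf => //; exists x0.
have phi0 : 0 <= phi := le_trans Df0 phi_ge.
have TminE : Tmin = (Num.max (8 * (4 * Lf + 1) / eps ^+ 2 * phi) (16 * L1 / eps * phi))%:E.
  by rewrite /Tmin phiE /horizon_bound EFin_max !EFinM.
have phi_le : 0 < Deltaf -> phi <= 5 * Deltaf.
  by move=> Dp; exact: (potential_le K m0 L10 zeta0 sigma0 eps0 Lf0 het oracle mixW sampling b0 Dp hKhat).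
split.
- move=> Dp; rewrite phiE -EFinM !lee_fin; split; last exact: phi_le.
  by move: phi_ge phi0; lra.
- move: hT; rewrite TminE lee_fin ge_max => /andP[h1 h2] i.
  exact: (dnsgd_convergence m0 L00 L10 zeta0 sigma0 eps0 Lf0 df lbf smooth het oracle
    mixW sampling b0 T0 batch h1 h2 hK i).
- move=> Dp ellLf hb hTk; rewrite natrM; apply: (sample_complexity Lf0 L10 eps0 Dp kappa0 ell0 ellLf phi0 (phi_le Dp) m0 sigma0) => //.
  by move: hTk; rewrite TminE -EFinD -EFinM lee_fin.
- move=> Dp ellLf hTk hKk hKhatk; rewrite natrD natrM.
  apply: (communication_complexity Lf0 L10 eps0 Dp kappa0 ell0 ellLf phi0 (phi_le Dp)) => //.
  + by rewrite sqrtr_gt0; have /andP[] := spectral_gap_bounds m0 mixW.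
  + by apply: gossip_log_ge0 => //; apply: ltW; exact: step_size_gt0.
  + apply: ln_ge0; have etaw : 0 <= eta by apply: ltW; exact: step_size_gt0.
    have q0 : 0 <= eta * (zeta + sigma) / Deltaf.
      by apply: divr_ge0 => //; apply: mulr_ge0 => //; apply: addr_ge0 => //; exact: ltW.
    by move: q0; lra.
  + by rewrite ler1n.
  + by move: hTk; rewrite TminE -EFinM lee_fin.
Qed.
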